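(* Consider the $N$-player aggregative game with coupled constraints and the distributed algorithm (D) described in the context. Assume: (1) (smoothness) for every $i\in\mathcal V$, $J_i$ is twice continuously differentiable; (monotonicity) $F$ is strictly monotone on $\Omega$, i.e. $(x-y)^T(F(x)-F(y))>0$ for all $x\ne y$ in $\Omega$; (feasibility) $\Omega$ is compact and convex; (constraint qualification) $0\in\operatorname{rint}(\Omega-\mathcal X)$, where $\Omega-\mathcal X=\{z_1-z_2 : z_1\in\Omega, z_2\in\mathcal X\}$ and $\operatorname{rint}$ is the relative interior; (2) for every $t\ge 0$ the graph $\mathcal G(t)$ is undirected and connected. Let the constants $\alpha,\beta,\gamma>0$ satisfy $\alpha>(N-1)\bar f_1$ and $\beta>\gamma(N-1)\bar f_2$. Then system (D) is stable and converges to the set $X^*\times\Lambda^*$, that is, along the solution of (D) with the prescribed initial conditions, $$\lim_{t\to+\infty}\|\lambda_i(t)-\bar\lambda(t)\|=0\quad\text{for all } i=1,\dots,N,$$ $$\lim_{t\to+\infty}\big\|(x(t),\bar\lambda(t))-P_{X^*\times\Lambda^*}(x(t),\bar\lambda(t))\big\|=0,$$ where $x(t)=(x_1(t),\dots,x_N(t))$.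
   Context: Game. $\mathcal V=\{1,\dots,N\}$. Player $i$ chooses $x_i\in\Omega_i\subset\mathbb R^{n_i}$ ($\Omega_i$ closed, convex, nonempty); $n=\sum_i n_i$, $\Omega=\Omega_1\times\cdots\times\Omega_N\subset\mathbb R^n$, $x=(x_1,\dots,x_N)$, and $x_{-i}$ collects all components except $x_i$. The cost of player $i$ is $J_i(x_i,x_{-i})=\vartheta_i(x_i,\sigma(x))$ with $\vartheta_i:\mathbb R^{n_i+m}\to\mathbb R$ and aggregation $\sigma(x)=\frac1N\sum_{i=1}^N\varphi_i(x_i)$, $\varphi_i:\mathbb R^{n_i}\to\mathbb R^m$ (the derivatives of $\vartheta_i,\varphi_i$ written below are tacitly assumed to exist). The coupled constraint set is $\mathcal X=\{x\in\mathbb R^n: Ax=b\}$ with $A=[A_1,\dots,A_N]$, $A_i\in\mathbb R^{l\times n_i}$, $b=\sum_i b_i$, $b_i\in\mathbb R^l$. The pseudo-gradient is $F:\mathbb R^n\to\mathbb R^n$, $F(x)=(\nabla_{x_1}J_1(x_1,x_{-1}),\dots,\nabla_{x_N}J_N(x_N,x_{-N}))$. Notation. $P_C(z)=\operatorname{argmin}_{y\in C}\|z-y\|$ is the Euclidean projection onto a closed convex set $C$. $\operatorname{sgn}$ is the sign function, applied componentwise to vectors. $\mathcal N_i=\mathcal N_i(t)$ is the set of neighbors of $i$ in the (time-varying) graph $\mathcal G(t)$ with node set $\mathcal V$. Constants. $\bar f_1=\sup_{i\in\mathcal V}\big(\sup_{x_i\in\Omega_i}\|\nabla\varphi_i(x_i)\|\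 \sup_{y,z\in\Omega}\|y-z\|\big)$ and $\bar f_2=\sup_{i\in\mathcal V}\sup_{x_i\in\Omega_i}\|A_ix_i-b_i\|$ (finite). Maps. $G_i:\mathbb R^{n_i+m}\to\mathbb R^{n_i}$, $G_i(x_i,y_i)=\nabla_{x_i}\vartheta_i(x_i,y_i)+\frac1N(\mathcal J\varphi_i(x_i))^T\nabla_\sigma\vartheta_i(x_i,y_i)$, where $\mathcal J\varphi_i$ is the Jacobian matrix; thus $G_i(x_i,\sigma(x))=\nabla_{x_i}J_i(x_i,x_{-i})$. Algorithm (D): for $i\in\mathcal V$, $$\dot x_i=P_{\Omega_i}\big(x_i-G_i(x_i,\eta_i)-\tfrac{\gamma}{N}A_i^T\lambda_i\big)-x_i,$$ $$\dot\lambda_i=\beta\sum_{j\in\mathcal N_i}\operatorname{sgn}(\lambda_j-\lambda_i)+\gamma(A_ix_i-b_i),$$ $$\dot\zeta_i=\alpha\sum_{j\in\mathcal N_i}\operatorname{sgn}(\eta_j-\eta_i),\qquad \eta_i=\zeta_i+\varphi_i(x_i),$$ with $\lambda_i(t)\in\mathbb R^l$, $\zeta_i(t)\in\mathbb R^m$ and initial conditions $x_i(0)\in\Omega_i$, $\lambda_i(0)=A_ix_i(0)-b_i$, $\zeta_i(0)=0$. Solutions are absolutely continuous and understood in the Filippov sense (on $[0,\infty)$). Averaged dual variable: $\bar\lambda(t)=\frac1N(Ax(0)-b)+\frac{\gamma}{N}\int_0^t(Ax(\tau)-b)\,d\tau$. $X^*\times\Lambda^*$ denotes the set of all $(x,\bar\lambda)\in\mathbb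 R^n\times\mathbb R^l$ satisfying $0=P_\Omega\big(x-F(x)-\frac{\gamma}{N}A^T\bar\lambda\big)-x$ and $0=\frac{\gamma}{N}(Ax-b)$.
   Formalization: The maps G_i are additionally assumed continuous (true if ϑ_i and φ_i are C¹); with mere existence of the derivatives the claim fails, since Filippov solutions of (D) need not converge. *)

(* Defs.v *)
(* Vectors of R^d are columns 'cV[R]_d. *)
From mathcomp Require Export all_boot all_order all_algebra.
From mathcomp Require Export all_classical all_reals all_analysis.
Export Order.TTheory GRing.Theory Num.Theory.
Export numFieldNormedType.Exports.
Set Implicit Arguments.
Unset Strict Implicit.
Unset Printing Implicit Defensive.
Local Open Scope classical_set_scope.
Local Open Scope ring_scope.

Section Euclidean.
Variable R : realType.

Definition dotv (d : nat) (u v : 'cV[R]_d) : R := (u^T *m v) 0 0.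

(* The library norm on matrices is the sup norm; it induces the same topology
   but not the same projections and constants. *)
Definition enorm (d : nat) (u : 'cV[R]_d) : R := Num.sqrt (dotv u u).

(* Operator norm induced by the Euclidean norms. *)
Definition opnorm (p d : nat) (M : 'M[R]_(p, d)) : R :=
  sup [set enorm (M *m v) | v in [set v : 'cV[R]_d | enorm v <= 1]].

Definition is_proj (d : nat) (C : set 'cV[R]_d) (z y : 'cV[R]_d) : Prop :=
  C y /\ forall w, C w -> enorm (z - y) <= enorm (z - w).

(* The argmin; the default value 0 is only taken when no minimizer exists. *)
Definition proj (d : nat) (C : set 'cV[R]_d) (z : 'cV[R]_d) : 'cV[R]_d :=
  xget 0 [set y | is_proj C z y].

Definition grad (d : nat) (f : 'cV[R]_d -> R^o) (x : 'cV[R]_d) : 'cV[R]_d :=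
  \col_k ('D_(delta_mx k 0) f x).

(* The library's 'J is for row vectors; this is the usual p x d matrix. *)
Definition jac (d p : nat) (f : 'cV[R]_d -> 'cV[R]_p) (x : 'cV[R]_d) :
    'M[R]_(p, d) :=
  \matrix_(k, j) ('D_(delta_mx j 0) f x) k 0.

Definition C1 (d : nat) (f : 'cV[R]_d -> R^o) : Prop :=
  (forall x, differentiable f x) /\
  (forall v : 'cV[R]_d, continuous (fun x => 'D_v f x)).

Definition C2 (d : nat) (f : 'cV[R]_d -> R^o) : Prop :=
  C1 f /\ (forall v : 'cV[R]_d, C1 (fun x => 'D_v f x)).

Definition strictly_monotone_on (d : nat) (C : set 'cV[R]_d)
    (F : 'cV[R]_d -> 'cV[R]_d) : Prop :=
  forall x y, C x -> C y -> x <> y -> 0 < dotv (x - y) (F x - F y).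

Definition affine_set (d : nat) (S : set 'cV[R]_d) : Prop :=
  forall (x y : 'cV[R]_d) (t : R), S x -> S y -> S (t *: x + (1 - t) *: y).

Definition aff_hull (d : nat) (C : set 'cV[R]_d) : set 'cV[R]_d :=
  \bigcap_(S in [set S | affine_set S /\ C `<=` S]) S.

Definition conv_hull (d : nat) (C : set 'cV[R]_d) : set 'cV[R]_d :=
  \bigcap_(S in [set S | @convex_set R 'cV[R]_d S /\ C `<=` S]) S.

Definition rint (d : nat) (C : set 'cV[R]_d) : set 'cV[R]_d :=
  [set z | C z /\
    exists2 e : R, 0 < e &
      [set y | enorm (y - z) < e] `&` aff_hull C `<=` C].

(* Lebesgue null subsets of R^d: those covered by countably many closed boxes
   of arbitrarily small total volume.  The index set D lets covers be finite. *)
Definition null_set (d : nat) (S : set 'cV[R]_d) : Prop :=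
  forall e : R, 0 < e ->
    exists (D : set nat) (a b : nat -> 'cV[R]_d),
      [/\ forall k i, a k i 0 <= b k i 0,
          S `<=` \bigcup_(k in D)
                   [set y | forall i, a k i 0 <= y i 0 <= b k i 0] &
          (\esum_(k in D) (\prod_i (b k i 0 - a k i 0))%:E <= e%:E)%E].

Definition filippov (d : nat) (f : 'cV[R]_d -> 'cV[R]_d) (z : 'cV[R]_d) :
    set 'cV[R]_d :=
  [set v | forall (delta : R) (S : set 'cV[R]_d), 0 < delta -> null_set S ->
     closure (conv_hull [set f y | y in [set y | enorm (y - z) < delta] `\` S])
       v].

Definition abs_continuous_on (d : nat) (a b : R) (z : R -> 'cV[R]_d) : Prop :=
  forall e : R, 0 < e -> exists2 delta : R, 0 < delta &
    forall (k : nat) (s t : 'I_k -> R),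
      (forall i, a <= s i /\ s i <= t i /\ t i <= b) ->
      trivIset setT (fun i => `]s i, t i[%classic) ->
      \sum_i (t i - s i) < delta ->
      \sum_i enorm (z (t i) - z (s i)) < e.

(* Solutions on [0, +oo[; values of z at negative times are irrelevant. *)
Definition filippov_solution (d : nat) (f : R -> 'cV[R]_d -> 'cV[R]_d)
    (z : R -> 'cV[R]_d) : Prop :=
  (forall T : R, 0 < T -> abs_continuous_on 0 T z) /\
  {ae (@lebesgue_measure R), forall t : R,
     0 <= t -> derivable z t 1 /\ filippov (f t) (z t) ('D_1 z t)}.

End Euclidean.

(* Players are indexed by 'I_N, strategy profiles are block columns with
   x_i = submxcol x i. *)
Section Game.
Variables (R : realType) (N : nat) (n_ : 'I_N -> nat) (m l : nat).
Local Notation n := (\sum_i n_ i)%N.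
Variable Omega_ : forall i : 'I_N, set 'cV[R]_(n_ i).
Variable theta : forall i : 'I_N, 'cV[R]_(n_ i + m) -> R^o.
Variable phi : forall i : 'I_N, 'cV[R]_(n_ i) -> 'cV[R]_m.
Variable A_ : forall i : 'I_N, 'M[R]_(l, n_ i).
Variable b_ : 'I_N -> 'cV[R]_l.
Arguments Omega_ i : clear implicits.
Arguments theta i : clear implicits.
Arguments phi i : clear implicits.

Definition Omega : set 'cV[R]_n :=
  [set x | forall i, Omega_ i (submxcol x i)].

Definition sigma (x : 'cV[R]_n) : 'cV[R]_m :=
  (N%:R)^-1 *: \sum_i phi i (submxcol x i).

Definition cost (i : 'I_N) (x : 'cV[R]_n) : R^o :=
  theta i (col_mx (submxcol x i) (sigma x)).

(* The i-th block collects the partial derivatives of J_i with respect to the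
   coordinates of x_i. *)
Definition pseudo_grad (x : 'cV[R]_n) : 'cV[R]_n :=
  \mxcol_i submxcol (grad (cost i) x) i.

Definition Amx : 'M[R]_(l, n) := \mxrow_i A_ i.

Definition bvec : 'cV[R]_l := \sum_i b_ i.

Definition coupled_set : set 'cV[R]_n := [set x | Amx *m x = bvec].

Definition f1bar : R :=
  sup [set sup [set opnorm (jac (phi i) u) | u in Omega_ i]
           * sup [set enorm (y - z) | y in Omega & z in Omega]
      | i in [set: 'I_N]].

Definition f2bar : R :=
  sup [set sup [set enorm (A_ i *m u - b_ i) | u in Omega_ i]
      | i in [set: 'I_N]].

Definition Gmap (i : 'I_N) (u : 'cV[R]_(n_ i)) (y : 'cV[R]_m) :
    'cV[R]_(n_ i) :=
  usubmx (grad (theta i) (col_mx u y))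
  + (N%:R)^-1 *: ((jac (phi i) u)^T *m dsubmx (grad (theta i) (col_mx u y))).

Arguments Gmap i u y : clear implicits.

Definition sgnv (d : nat) (u : 'cV[R]_d) : 'cV[R]_d := map_mx Num.sg u.

(* State (x, lambda, zeta) stacked in R^(n + (N l + N m)). *)
Definition state (x : 'cV[R]_n) (lam : 'I_N -> 'cV[R]_l)
    (zeta : 'I_N -> 'cV[R]_m) :
    'cV[R]_(n + ((\sum_(i < N) l) + (\sum_(i < N) m))) :=
  col_mx x (col_mx (\mxcol_(i < N) lam i) (\mxcol_(i < N) zeta i)).

(* Right-hand side of the algorithm at a time when the graph is e. *)
Definition field_at (alpha beta gamma : R) (e : rel 'I_N)
    (x : 'cV[R]_n) (lam : 'I_N -> 'cV[R]_l) (zeta : 'I_N -> 'cV[R]_m) :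
    'cV[R]_(n + ((\sum_(i < N) l) + (\sum_(i < N) m))) :=
  let eta i := zeta i + phi i (submxcol x i) in
  state
    (\mxcol_i (proj (Omega_ i)
                 (submxcol x i - Gmap i (submxcol x i) (eta i)
                  - (gamma / N%:R) *: ((A_ i)^T *m lam i))
               - submxcol x i))
    (fun i => beta *: (\sum_(j | e i j) sgnv (lam j - lam i))
              + gamma *: (A_ i *m submxcol x i - b_ i))
    (fun i => alpha *: \sum_(j | e i j) sgnv (eta j - eta i)).

Definition algo_field (alpha beta gamma : R) (G : R -> rel 'I_N) (t : R)
    (z : 'cV[R]_(n + ((\sum_(i < N) l) + (\sum_(i < N) m)))) :
    'cV[R]_(n + ((\sum_(i < N) l) + (\sum_(i < N) m))) :=
  field_at alpha beta gamma (G t) (usubmx z)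
    (fun i => submxcol (usubmx (dsubmx z)) i)
    (fun i => submxcol (dsubmx (dsubmx z)) i).

Definition lambda_bar (gamma : R) (x : R -> 'cV[R]_n) (t : R) : 'cV[R]_l :=
  (N%:R)^-1 *: (Amx *m x 0 - bvec)
  + (gamma / N%:R) *:
      \col_k (\int[@lebesgue_measure R]_(s in `[0, t])
                ((Amx *m x s - bvec) k 0)).

(* X^* x Lambda^*, pairs (x, lambda) being stacked in R^(n + l). *)
Definition equilibria (gamma : R) : set 'cV[R]_(n + l) :=
  [set w | let x := usubmx w in let lam := dsubmx w in
     0 = proj Omega (x - pseudo_grad x - (gamma / N%:R) *: (Amx^T *m lam)) - x
     /\ 0 = (gamma / N%:R) *: (Amx *m x - bvec)].

End Game.

Arguments Gmap {R N n_ m} theta phi i u y.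

Definition undirected_connected (N : nat) (e : rel 'I_N) : Prop :=
  symmetric e /\ forall i j, connect e i j.

(* Main.v *)
(* In the Lyapunov function sum_i (a_i - mean a)^2 the signs of a consensus
   protocol on a connected graph dissipate at least the largest difference
   |a_p - a_q|, while the inputs contribute at most N - 1 times their bound times
   that difference. Hence, coordinate by coordinate, the lambda_i and the eta_i
   reach consensus in finite time; their averages are lambda_bar and sigma(x),
   because the signs cancel in the sum. From then on (x, lambda_bar) is a
   classical solution of the projected primal-dual flow
     x' = P(x - g) - x,   lambda' = r,
   with g = F x + c A^T lambda, r = c (A x - b) and c = gamma / N. For an
   equilibrium (x0, lambda0), obtained from the constraint qualification, the
   sum of the regularised gap function of g, of |r|^2 / 2 and of half the squared
   distance to (x0, lambda0) decreases at least at the rate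
   <F x - F x0, x - x0>. Strict monotonicity then gives x -> x0, Barbalat's lemma
   x' -> 0, and the distance of the bounded curve (x, lambda_bar) to the closed
   set of equilibria tends to 0 by compactness. *)

Require Import Defs.
From mathcomp Require Import measurable_realfun ring lra.
Local Open Scope classical_set_scope.
Local Open Scope ring_scope.

Set Implicit Arguments.
Unset Strict Implicit.
Unset Printing Implicit Defensive.

(** * Euclidean geometry *)

Section Euclid.
Context {R : realType}.
Implicit Types d : nat.

(** The field is discontinuous and velocities are known only almost everywhere, so the differential
    inequalities for the algorithm rest on one fact: an absolutely continuous function with
    nonpositive derivative almost everywhere does not increase. A Filippov velocity is only tested
    by linear functionals, whose upper bounds on nearby values of the field survive convex hulls and
    closure. The squared distance to an equilibrium alone need not decrease: testing the projection
    against [x0] leaves [g . x'] uncontrolled. The derivative of the gap contains exactly the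
    missing [|x'|^2 + g . x'], which is why the gap is added. [F] need not be a gradient, so the
    multiplier cannot come from a convex programme. It is a limit of penalty multipliers, each
    penalised problem being made strongly monotone by a term [e x] and solved by minimising its gap,
    without a fixed-point theorem. The multiplier need not be unique, hence convergence to the set
    of equilibria. *)

Lemma dotvE d (u v : 'cV[R]_d) : dotv u v = \sum_k u k 0 * v k 0.
Proof. by rewrite /dotv mxE; apply: eq_bigr => k _; rewrite mxE. Qed.

Lemma dotvC d (u v : 'cV[R]_d) : dotv u v = dotv v u.
Proof. by rewrite !dotvE; apply: eq_bigr => k _; rewrite mulrC. Qed.

Lemma dotvDl d (u v w : 'cV[R]_d) : dotv (u + v) w = dotv u w + dotv v w.
Proof. by rewrite /dotv linearD mulmxDl mxE. Qed.

Lemma dotvNl d (u w : 'cV[R]_d) : dotv (- u) w = - dotv u w.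
Proof. by rewrite /dotv linearN mulNmx mxE. Qed.

Lemma dotvZl d a (u w : 'cV[R]_d) : dotv (a *: u) w = a * dotv u w.
Proof. by rewrite /dotv linearZ -scalemxAl mxE. Qed.

Lemma dotvDr d (u v w : 'cV[R]_d) : dotv u (v + w) = dotv u v + dotv u w.
Proof. by rewrite dotvC dotvDl !(dotvC u). Qed.

Lemma dotvNr d (u w : 'cV[R]_d) : dotv u (- w) = - dotv u w.
Proof. by rewrite dotvC dotvNl dotvC. Qed.

Lemma dotvZr d a (u w : 'cV[R]_d) : dotv u (a *: w) = a * dotv u w.
Proof. by rewrite dotvC dotvZl dotvC. Qed.

Lemma dotv0l d (u : 'cV[R]_d) : dotv 0 u = 0.
Proof. by rewrite /dotv linear0 mul0mx mxE. Qed.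

Lemma dotv0r d (u : 'cV[R]_d) : dotv u 0 = 0.
Proof. by rewrite dotvC dotv0l. Qed.

Definition dotvEl := (dotvDl, dotvDr, dotvNl, dotvNr, dotvZl, dotvZr).

Lemma dotvDD d (u v : 'cV[R]_d) :
  dotv (u + v) (u + v) = dotv u u + 2 * dotv u v + dotv v v.
Proof. by rewrite dotvDl !dotvDr (dotvC v u); ring. Qed.

Lemma dotvBB d (u v : 'cV[R]_d) :
  dotv (u - v) (u - v) = dotv u u - 2 * dotv u v + dotv v v.
Proof. by rewrite dotvDD dotvNr dotvNl dotvNr; ring. Qed.

Lemma dotv_trmx p d (M : 'M[R]_(p, d)) u v :
  dotv (M^T *m u) v = dotv u (M *m v).
Proof. by rewrite /dotv trmx_mul trmxK mulmxA. Qed.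

Lemma dotv_ge0 d (u : 'cV[R]_d) : 0 <= dotv u u.
Proof. by rewrite dotvE; apply: sumr_ge0 => k _; rewrite -expr2 sqr_ge0. Qed.

Lemma dotv_eq0 d (u : 'cV[R]_d) : dotv u u = 0 -> u = 0.
Proof.
rewrite dotvE => /eqP; rewrite psumr_eq0; last first.
  by move=> k _; rewrite -expr2 sqr_ge0.
move=> /allP u0; apply/colP => k; rewrite mxE.
by have /implyP/(_ isT) := u0 k (mem_index_enum _); rewrite -expr2 sqrf_eq0 => /eqP.
Qed.

Lemma enorm_ge0 d (u : 'cV[R]_d) : 0 <= enorm u.
Proof. exact: sqrtr_ge0. Qed.

Lemma sqr_enorm d (u : 'cV[R]_d) : enorm u ^+ 2 = dotv u u.
Proof. by rewrite sqr_sqrtr// dotv_ge0. Qed.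

Lemma enorm0 d : enorm (0 : 'cV[R]_d) = 0.
Proof. by rewrite /enorm dotv0l sqrtr0. Qed.

Lemma enorm_eq0 d (u : 'cV[R]_d) : enorm u = 0 -> u = 0.
Proof. by move=> u0; apply: dotv_eq0; rewrite -sqr_enorm u0 expr0n. Qed.

Lemma enorm_gt0 d (u : 'cV[R]_d) : u != 0 -> 0 < enorm u.
Proof.
move=> u0; rewrite lt_neqAle enorm_ge0 andbT eq_sym.
by apply: contra u0 => /eqP/enorm_eq0 ->.
Qed.

Lemma enormN d (u : 'cV[R]_d) : enorm (- u) = enorm u.
Proof. by rewrite /enorm dotvNl dotvNr opprK. Qed.

Lemma enormBC d (u v : 'cV[R]_d) : enorm (u - v) = enorm (v - u).
Proof. by rewrite -enormN opprB. Qed.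

Lemma enormZ d a (u : 'cV[R]_d) : enorm (a *: u) = `|a| * enorm u.
Proof.
by rewrite /enorm dotvZl dotvZr mulrA -expr2 sqrtrM ?sqr_ge0// sqrtr_sqr.
Qed.

(** Cauchy-Schwarz, from the nonnegative square of [enorm v *: u - enorm u *: v]; the zero cases are
    set apart because the product of the norms is divided out. *)
Lemma dotv_le_enorm d (u v : 'cV[R]_d) : dotv u v <= enorm u * enorm v.
Proof.
have [->|u0] := eqVneq u 0; first by rewrite dotv0l enorm0 mul0r.
have [->|v0] := eqVneq v 0; first by rewrite dotv0r enorm0 mulr0.
have eu := enorm_gt0 u0; have ev := enorm_gt0 v0.
have := dotv_ge0 (enorm v *: u - enorm u *: v).
rewrite !dotvEl (dotvC v u) -!sqr_enorm => h.
have {}h : enorm u * enorm v * dotv u v <=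
    enorm u * enorm v * (enorm u * enorm v) by lra.
by rewrite ler_pM2l ?mulr_gt0// in h.
Qed.

Lemma normr_dotv_le d (u v : 'cV[R]_d) : `|dotv u v| <= enorm u * enorm v.
Proof.
rewrite ler_norml dotv_le_enorm andbT lerNl -dotvNl -(enormN u).
exact: dotv_le_enorm.
Qed.

Lemma enormD d (u v : 'cV[R]_d) : enorm (u + v) <= enorm u + enorm v.
Proof.
rewrite -(ler_pXn2r (ltn0Sn 1)) ?nnegrE ?addr_ge0 ?enorm_ge0//.
rewrite sqrrD !sqr_enorm !dotvEl (dotvC v u).
have := dotv_le_enorm u v; lra.
Qed.

Lemma enorm_triangle d (v u w : 'cV[R]_d) :
  enorm (u - w) <= enorm (u - v) + enorm (v - w).
Proof. by have := enormD (u - v) (v - w); rewrite addrA subrK. Qed.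

Lemma enormB_le d (u v : 'cV[R]_d) : `|enorm u - enorm v| <= enorm (u - v).
Proof.
have := enormD (u - v) v; have := enormD (v - u) u.
by rewrite !subrK (enormBC v u) ler_norml => *; apply/andP; split; lra.
Qed.

Lemma coord_le_enorm d (u : 'cV[R]_d) k : `|u k 0| <= enorm u.
Proof.
rewrite -(ler_pXn2r (ltn0Sn 1)) ?nnegrE ?enorm_ge0//.
rewrite sqr_enorm real_normK ?num_real// dotvE (bigD1 k)//= -expr2 lerDl.
by apply: sumr_ge0 => j _; rewrite -expr2 sqr_ge0.
Qed.

Lemma enorm_le_sum d (u : 'cV[R]_d) : enorm u <= \sum_k `|u k 0|.
Proof.
have S0 : 0 <= \sum_k `|u k 0| by exact: sumr_ge0.
rewrite -(ler_pXn2r (ltn0Sn 1)) ?nnegrE ?enorm_ge0//.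
rewrite sqr_enorm dotvE expr2 mulr_suml; apply: ler_sum => k _.
rewrite -[leLHS]ger0_norm -?expr2 ?sqr_ge0// normrX expr2.
apply: ler_wpM2l => //; rewrite (bigD1 k)//= lerDl; exact: sumr_ge0.
Qed.

Lemma coord_le_norm d (u : 'cV[R]_d) k : `|u k 0| <= `|u|.
Proof.
rewrite [leRHS]/Num.Def.normr /= mx_normrE; apply/bigmax_geP; right => /=.
by exists (k, 0).
Qed.

Lemma enorm_le_norm d (u : 'cV[R]_d) : enorm u <= d%:R * `|u|.
Proof.
apply: le_trans (enorm_le_sum u) _.
apply: le_trans (ler_sum _ (fun k _ => coord_le_norm u k)) _.
by rewrite sumr_const card_ord mulr_natl.
Qed.

Lemma norm_le_enorm d (u : 'cV[R]_d) : `|u| <= enorm u.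
Proof.
rewrite [leLHS]/Num.Def.normr /= mx_normrE; apply: bigmax_le; first exact: enorm_ge0.
by move=> -[i j] _; rewrite (ord1 j); exact: coord_le_enorm.
Qed.

(** The topology is that of the sup norm while all estimates are Euclidean; since each norm bounds
    the other up to a factor, Euclidean balls generate the same neighbourhoods. *)
Lemma nbhs_enormP d (u : 'cV[R]_d) (P : set 'cV[R]_d) :
  nbhs u P <-> exists2 e, 0 < e & forall v, enorm (v - u) < e -> P v.
Proof.
split=> [/nbhs_ballP[e /= e0 sP]|[e e0 sP]].
  exists e => // v uv; apply: sP; rewrite -ball_normE /ball_ /= distrC.
  exact: le_lt_trans (norm_le_enorm _) _.
(* The [+ 1] keeps the denominator positive in dimension 0. *)
apply/nbhs_ballP; exists (e / (d%:R + 1)) => /=.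
  by rewrite divr_gt0// ltr_pwDr.
move=> v; rewrite -ball_normE /ball_ /= distrC => uv; apply: sP.
apply: le_lt_trans (enorm_le_norm _) _.
rewrite ltr_pdivlMr ?ltr_pwDr// in uv.
by apply: le_lt_trans uv; rewrite mulrC ler_wpM2l// lerDl.
Qed.

Lemma cvg_enormP T (F : set_system T) {FF : Filter F} d (f : T -> 'cV[R]_d) (u : 'cV[R]_d) :
  (f x @[x --> F] --> u) <->
  (forall e : R, 0 < e -> \forall x \near F, enorm (f x - u) < e).
Proof.
split=> [fu e e0|fu P /= /nbhs_enormP[e e0 sP]].
  by apply: (fu [set y | enorm (y - u) < e]); apply/nbhs_enormP; exists e.
by apply: filterS (fu _ e0) => x; exact: sP.
Qed.

Lemma enorm_continuous d : continuous (@enorm R d).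
Proof.
move=> u; apply/(@cvgrPdist_lt _ _ _ (nbhs u)) => e e0; apply/nbhs_enormP; exists e => // v uv.
by apply: le_lt_trans (enormB_le _ _) _; rewrite enormBC.
Qed.

Lemma cvg_sum (V : normedModType R) T (F : set_system T) {FF : Filter F} I
    (r : seq I) (P : pred I) (f : I -> T -> V) (a : I -> V) :
  (forall i, P i -> f i x @[x --> F] --> a i) ->
  \sum_(i <- r | P i) f i x @[x --> F] --> \sum_(i <- r | P i) a i.
Proof. by move=> fa; apply: cvg_big => //; exact: add_continuous. Qed.

Lemma dotv_continuous T (F : set_system T) {FF : Filter F} d
    (f g : T -> 'cV[R]_d) (u v : 'cV[R]_d) :
  f x @[x --> F] --> u -> g x @[x --> F] --> v ->
  dotv (f x) (g x) @[x --> F] --> dotv u v.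
Proof.
move=> fu gv; rewrite dotvE (_ : (fun x => _) = fun x => \sum_k f x k 0 * g x k 0); last first.
  by apply/funext => x; rewrite dotvE.
apply: cvg_sum => k _; apply: cvgM.
  exact: (cvg_comp _ _ fu (@coord_continuous R _ _ k 0 u)).
exact: (cvg_comp _ _ gv (@coord_continuous R _ _ k 0 v)).
Qed.

Lemma linear_mx_continuous p q (V : normedModType R)
  (f : {linear 'M[R]_(p, q) -> V}) : continuous f.
Proof.
move=> u; have fE M : f M = \sum_i \sum_j M i j *: f (delta_mx i j).
  rewrite {1}[M]matrix_sum_delta linear_sum; apply: eq_bigr => i _.
  by rewrite linear_sum; apply: eq_bigr => j _; rewrite linearZ.
rewrite /continuous_at (_ : (f : _ -> V) = fun M => \sum_i \sum_j M i j *: f (delta_mx i j)).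
  apply: (@cvg_sum _ _ (nbhs u)) => i _; apply: (@cvg_sum _ _ (nbhs u)) => j _.
  apply: cvgZ; last exact: cvg_cst.
  exact: (@coord_continuous R p q i j u).
by apply/funext => M; exact: fE.
Qed.

(** Heine-Borel for row vectors, carried to columns by the continuous transpose. *)
Lemma bounded_closed_compact_cV d (K : set 'cV[R]_d) (M : R) :
  (forall u, K u -> enorm u <= M) -> closed K -> compact K.
Proof.
move=> KM Kcl.
have trc : continuous (fun u : 'rV[R]_d => u^T : 'cV[R]_d).
  exact: (@linear_mx_continuous 1 d 'cV[R]_d (@trmx R 1 d)).
have -> : K = (fun u : 'rV[R]_d => u^T : 'cV[R]_d) @` [set u | K u^T].
  apply/seteqP; split=> [u Ku|_ [u Ku <-]//].
  by exists u^T; rewrite /= trmxK.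
apply: continuous_compact; first exact: continuous_subspaceT.
apply: bounded_closed_compact; last first.
  by apply: (@preimage_closed _ _ _ K) => // u _; exact: trc.
exists M; split; first exact: num_real.
move=> x Mx u /= /KM uM; apply: le_trans (ltW Mx).
rewrite [leLHS]/Num.Def.normr /= mx_normrE; apply: bigmax_le => [|-[i j] _ /=].
  by apply: le_trans uM; exact: enorm_ge0.
by apply: le_trans uM; rewrite (ord1 i); have := coord_le_enorm u^T j; rewrite mxE.
Qed.

Lemma dotv_col_mx p q (u1 v1 : 'cV[R]_p) (u2 v2 : 'cV[R]_q) :
  dotv (col_mx u1 u2) (col_mx v1 v2) = dotv u1 v1 + dotv u2 v2.
Proof. by rewrite /dotv tr_col_mx mul_row_col mxE. Qed.

Lemma enorm_usubmx_le p q (u : 'cV[R]_(p + q)) : enorm (usubmx u) <= enorm u.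
Proof.
rewrite -(ler_pXn2r (ltn0Sn 1)) ?nnegrE ?enorm_ge0// !sqr_enorm.
by rewrite -{3 4}(vsubmxK u) dotv_col_mx lerDl dotv_ge0.
Qed.

Lemma enorm_dsubmx_le p q (u : 'cV[R]_(p + q)) : enorm (dsubmx u) <= enorm u.
Proof.
rewrite -(ler_pXn2r (ltn0Sn 1)) ?nnegrE ?enorm_ge0// !sqr_enorm.
by rewrite -{3 4}(vsubmxK u) dotv_col_mx lerDr dotv_ge0.
Qed.

Lemma enorm_col_mx_le p q (u : 'cV[R]_p) (v : 'cV[R]_q) :
  enorm (col_mx u v) <= enorm u + enorm v.
Proof.
rewrite -(ler_pXn2r (ltn0Sn 1)) ?nnegrE ?addr_ge0 ?enorm_ge0//.
rewrite sqrrD !sqr_enorm dotv_col_mx.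
have : 0 <= enorm u * enorm v by rewrite mulr_ge0 ?enorm_ge0.
by move: (enorm u * _) (dotv u u) (dotv v v) => *; lra.
Qed.

Lemma continuous_cV p q (f : 'cV[R]_p -> 'cV[R]_q) :
  (forall u (e : R), 0 < e -> exists2 delta : R, 0 < delta &
     forall v, enorm (v - u) < delta -> enorm (f v - f u) < e) -> continuous f.
Proof.
move=> H u; apply/(@cvg_enormP _ (nbhs u)) => e e0; apply/nbhs_enormP; exact: H.
Qed.

Lemma usubmx_continuous p q : continuous (usubmx : 'cV[R]_(p + q) -> 'cV[R]_p).
Proof.
apply: continuous_cV => u e e0.
exists e => // v; apply: le_lt_trans; apply: le_trans (enorm_usubmx_le _).
by rewrite linearB.
Qed.

Lemma dsubmx_continuous p q : continuous (dsubmx : 'cV[R]_(p + q) -> 'cV[R]_q).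
Proof.
apply: continuous_cV => u e e0.
exists e => // v; apply: le_lt_trans; apply: le_trans (enorm_dsubmx_le _).
by rewrite linearB.
Qed.

Lemma mulmx_cvg T (F : set_system T) {FF : Filter F} p d (M : 'M[R]_(p, d))
    (f : T -> 'cV[R]_d) (u : 'cV[R]_d) :
  f x @[x --> F] --> u -> M *m f x @[x --> F] --> M *m u.
Proof.
move=> fu; apply: (cvg_comp _ _ fu).
exact: (@linear_mx_continuous d 1 'cV[R]_p (mulmx M) u).
Qed.

Lemma enorm_cvg T (F : set_system T) {FF : Filter F} d
    (f : T -> 'cV[R]_d) (u : 'cV[R]_d) :
  f x @[x --> F] --> u -> enorm (f x) @[x --> F] --> enorm u.
Proof. by move=> fu; apply: (cvg_comp _ _ fu); exact: enorm_continuous. Qed.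

End Euclid.

(** * Projections on closed convex sets *)

Section Projection.
Context {R : realType}.
Implicit Types d : nat.

Lemma convex_setP d (C : set 'cV[R]_d) :
  @convex_set R 'cV[R]_d C <->
  (forall x y (t : R), 0 <= t <= 1 -> C x -> C y -> C (t *: x + (1 - t) *: y)).
Proof.
split=> [CC x y t /andP[t0 t1] Cx Cy|CC x y t].
  have := CC x y (Itv01 t0 t1); rewrite !inE; exact.
rewrite !inE => Cx Cy; apply: CC => //.
by apply/andP; split; [exact: ge0|exact: le1].
Qed.

Lemma compact_minimum d (f : 'cV[R]_d -> R) (K : set 'cV[R]_d) :
  K !=set0 -> compact K -> continuous f ->
  exists2 y, K y & forall w, K w -> f y <= f w.
Proof.
move=> K0 Kco fc.
have [y yK yP] := compact_EVT_min K0 Kco (continuous_subspaceT fc).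
by rewrite inE in yK; exists y => // w Kw; apply: yP; rewrite inE.
Qed.

(** Points farther from [z] than a fixed [w0] of [C] cannot be nearest, so the minimum is sought on
    a compact part of [C]. This form also serves the set of equilibria, whose convexity is never
    established. *)
Lemma proj_exists d (C : set 'cV[R]_d) z : closed C -> C !=set0 ->
  is_proj C z (proj C z).
Proof.
move=> Ccl [w0 Cw0].
suff: [set y | is_proj C z y] !=set0 by move=> [y yP]; exact: (xgetPex _ (ex_intro _ y yP)).
pose K := C `&` [set w | enorm (z - w) <= enorm (z - w0)].
have cenorm : continuous (fun w : 'cV[R]_d => enorm (z - w)).
  move=> w; apply/(@cvgrPdist_lt _ _ _ (nbhs w)) => e e0; apply/nbhs_enormP.
  exists e => // v vw; apply: le_lt_trans (enormB_le _ _) _.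
  by rewrite opprB addrC subrKA.
have Kco : compact K.
  apply: (@bounded_closed_compact_cV _ _ _ (enorm z + enorm (z - w0))).
    move=> u [_ /= uw]; have := enormD (u - z) z.
    rewrite subrK => /le_trans; apply.
    by rewrite addrC lerD2l enormBC.
  apply: closedI => //.
  apply: (@preimage_closed _ _ (fun w : 'cV[R]_d => enorm (z - w))
    [set r | r <= enorm (z - w0)]); last exact: closed_le.
  by move=> w _; exact: cenorm.
have [|y [Cy yw0] yP] := compact_minimum _ Kco cenorm; first by exists w0; split => /=.
exists y; split => // w Cw.
have [ww|/ltW ww] := leP (enorm (z - w)) (enorm (z - w0)); first exact: yP.
exact: le_trans ww.
Qed.

Section ClosedConvex.
Variables (d : nat) (C : set 'cV[R]_d).
Hypotheses (Ccl : closed C) (Cconv : @convex_set R 'cV[R]_d C) (C0 : C !=set0).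
Local Notation P := (proj C).

Lemma proj_in z : C (P z).
Proof. by case: (proj_exists z Ccl C0). Qed.

Lemma proj_min z w : C w -> dotv (z - P z) (z - P z) <= dotv (z - w) (z - w).
Proof.
move=> Cw; rewrite -!sqr_enorm; have [_ /(_ _ Cw)] := proj_exists z Ccl C0.
by move=> h; rewrite ler_pXn2r// ?nnegrE ?enorm_ge0.
Qed.

Lemma proj_vi z w : C w -> dotv (z - P z) (w - P z) <= 0.
Proof.
move=> Cw; rewrite leNgt; apply/negP => pos.
set a := dotv _ _ in pos; set D := dotv (w - P z) (w - P z).
have D0 : 0 <= D := dotv_ge0 _.
(* Moving from [P z] towards [w] by a fraction [t] shortens the squared distance by
   [t * (2 * a - t * D)]. This [t] lies in [0, 1] and has [t * D < 2 * a] whether or not [D]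
   vanishes. *)
pose t := a / (a + D).
have aD : 0 < a + D by rewrite ltr_pwDl.
have t01 : 0 <= t <= 1.
  by rewrite divr_ge0 ?(ltW aD) ?(ltW pos)//= (ler_pdivrMr _ _ aD) mul1r lerDl.
have t0 : 0 < t by rewrite divr_gt0.
have := proj_min z ((convex_setP C).1 Cconv _ _ _ t01 Cw (proj_in z)).
have -> : z - (t *: w + (1 - t) *: P z) = (z - P z) - t *: (w - P z).
  by apply/colP => k; rewrite !mxE; ring.
rewrite [X in _ <= X -> _]dotvBB [dotv (t *: _) _]dotvZl !dotvZr -/a -/D.
have tE : t * (a + D) = a by rewrite /t divfK// gt_eqF.
move=> h; have : t * (2 * a - t * D) <= 0 by lra.
rewrite pmulr_rle0//; nra.
Qed.

Lemma proj_unique z y : C y ->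
  (forall w, C w -> dotv (z - y) (w - y) <= 0) -> P z = y.
Proof.
move=> Cy yP; apply/eqP; rewrite -subr_eq0; apply/eqP/dotv_eq0/eqP.
rewrite eq_le dotv_ge0 andbT.
have := yP _ (proj_in z); have := proj_vi z Cy.
rewrite dotvBB !dotvDl !dotvDr !dotvNl !dotvNr (dotvC (P z) y) => *; lra.
Qed.

Lemma proj_firm u v :
  dotv (P u - P v) (P u - P v) <= dotv (P u - P v) (u - v).
Proof.
have := proj_vi u (proj_in v); have := proj_vi v (proj_in u).
move: (P u) (P v) => p q.
rewrite dotvC [X in _ -> X <= _ -> _]dotvC dotvBB.
rewrite !dotvDl !dotvDr !dotvNl !dotvNr (dotvC q p) => *; lra.
Qed.

Lemma proj_nonexpansive u v : enorm (P u - P v) <= enorm (u - v).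
Proof.
have [->|] := eqVneq (P u - P v) 0; first by rewrite enorm0 enorm_ge0.
move=> /enorm_gt0 p; rewrite -(ler_pM2l p) -expr2 sqr_enorm.
by apply: le_trans (proj_firm u v) _; exact: dotv_le_enorm.
Qed.

Lemma proj_continuous : continuous P.
Proof.
move=> u; apply/(@cvg_enormP _ _ (nbhs u)) => e e0; apply/nbhs_enormP; exists e => // v uv.
exact: le_lt_trans (proj_nonexpansive _ _) _.
Qed.

Definition half_sqdist z := 2^-1 * dotv (z - P z) (z - P z).

(** Upper bound: the projection of [u] is a competitor for [v]. Lower bound: the variational
    inequality at [u], tested with the projection of [v]. The half squared distance is thus
    differentiable with gradient [u - P u], although [P] itself need not be. *)
Lemma half_sqdist_expansion u v :
  0 <= half_sqdist v - half_sqdist u - dotv (u - P u) (v - u)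
    <= 2^-1 * dotv (v - u) (v - u).
Proof.
rewrite /half_sqdist; have := proj_min v (proj_in u); have := proj_vi u (proj_in v).
set p := P u; set q := P v.
have -> : v - q = (v - u) + (u - p) - (q - p).
  by rewrite opprB !addrA subrK subrK.
have -> : v - p = (v - u) + (u - p) by rewrite addrA subrK.
move: (v - u) (u - p) (q - p) => a b c h1.
have := dotv_ge0 (a - c).
rewrite !(dotvBB, dotvDD) !dotvDl (dotvC b a) => h2 h3.
by apply/andP; split; lra.
Qed.

Lemma half_sqdist_ge0 z : 0 <= half_sqdist z.
Proof. by rewrite mulr_ge0// dotv_ge0. Qed.

Lemma half_sqdist_eq0 z : half_sqdist z = 0 -> C z.
Proof.
move/eqP; rewrite mulf_eq0 invr_eq0 pnatr_eq0/= => /eqP/dotv_eq0/eqP.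
by rewrite subr_eq0 => /eqP ->; exact: proj_in.
Qed.

Lemma half_sqdist_in z : C z -> half_sqdist z = 0.
Proof.
move=> Cz; rewrite /half_sqdist (_ : P z = z) ?subrr ?dotv0l ?mulr0//.
by apply: proj_unique => // w _; rewrite subrr dotv0l.
Qed.

End ClosedConvex.
End Projection.

(** * Derivatives of curves, by first-order expansions *)

Section Derivative.
Context {R : realType}.

(** Multiplying out the difference quotient admits [h = 0] and turns differentiability into an
    estimate on increments, the form in which inequalities are composed. *)
Lemma is_deriveP (V : normedModType R) (f : R -> V) (t : R) (df : V) :
  is_derive t 1 f df <->
  (forall e : R, 0 < e -> exists2 dt : R, 0 < dt &
     forall h, `|h| < dt -> `|f (t + h) - f t - h *: df| <= e * `|h|).
Proof.
split=> [[/[swap] <- dft] e e0|H].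
  have /cvgrPdist_le/(_ e e0) := dft.
  move=> [dt /= dt0 H]; exists dt => // h ht.
  have [->|h0] := eqVneq h 0.
    by rewrite addr0 subrr scale0r subr0 !normr0 mulr0.
  have := H h; rewrite /ball/= sub0r normrN => /(_ ht h0).
  rewrite -[h *: 1]/(h * 1) mulr1 -[lim _]/('D_1 f t) => H1.
  have -> : f (t + h) - f t - h *: 'D_1 f t =
      - (h *: ('D_1 f t - h^-1 *: (f (h + t) - f t))).
    by rewrite scalerBr scalerA mulfV// scale1r opprB (addrC h).
  by rewrite normrN normrZ mulrC ler_wpM2r.
have L : h^-1 *: (f (h *: 1 + t) - f t) @[h --> 0^'] --> df.
  apply/cvgrPdist_le => e e0; have [dt dt0 Hd] := H e e0.
  exists dt => //= h; rewrite /ball/= sub0r normrN => ht h0.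
  have -> : df - h^-1 *: (f (h *: 1 + t) - f t) =
      - (h^-1 *: (f (t + h) - f t - h *: df)).
    rewrite [h *: 1]mulr1 (addrC h) [in RHS]scalerBr scalerA mulVf// scale1r.
    by rewrite opprB.
  rewrite normrN normrZ normfV mulrC ler_pdivrMr ?normr_gt0//.
  exact: Hd.
by split; [apply/cvg_ex; exists df|exact: cvg_lim].
Qed.

Lemma is_derive_enormP d (f : R -> 'cV[R]_d) (t : R) (df : 'cV[R]_d) :
  is_derive t 1 f df <->
  (forall e : R, 0 < e -> exists2 dt : R, 0 < dt &
     forall h, `|h| < dt -> enorm (f (t + h) - f t - h *: df) <= e * `|h|).
Proof.
rewrite is_deriveP; split=> H e e0.
  have e1 : 0 < e / (d%:R + 1) by rewrite divr_gt0// ltr_pwDr.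
  have [dt dt0 Hd] := H _ e1; exists dt => // h ht.
  apply: le_trans (enorm_le_norm _) _.
  apply: le_trans (ler_wpM2l _ (Hd h ht)) _ => //.
  rewrite mulrA ler_wpM2r// mulrCA ger_pMr// ler_pdivrMr ?ltr_pwDr//.
  by rewrite mul1r lerDl.
have [dt dt0 Hd] := H _ e0; exists dt => // h ht.
exact: le_trans (norm_le_enorm _) (Hd h ht).
Qed.

Lemma is_derive_coord d (f : R -> 'cV[R]_d) (t : R) (df : 'cV[R]_d) k :
  is_derive t 1 f df -> is_derive t 1 (fun s => f s k 0) (df k 0).
Proof.
move=> /is_derive_enormP H; apply/is_deriveP => e e0.
have [dt dt0 Hd] := H e e0; exists dt => // h ht.
apply: le_trans (Hd h ht); have := coord_le_enorm (f (t + h) - f t - h *: df) k.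
by rewrite !mxE.
Qed.

Lemma is_derive_col d (f : R -> 'cV[R]_d) (t : R) (df : 'cV[R]_d) :
  (forall k, is_derive t 1 (fun s => f s k 0) (df k 0)) -> is_derive t 1 f df.
Proof.
move=> H.
have fE : f = fun s => \sum_k f s k 0 *: delta_mx k 0.
  apply/funext => s; rewrite {1}[f s]matrix_sum_delta.
  by apply: eq_bigr => k _; rewrite big_ord1.
have fd : derivable f t 1.
  by apply/derivable_mxP => i j; rewrite (ord1 j); case: (H i).
split => //; rewrite derive_mx//; apply/colP => k; rewrite mxE.
by rewrite (@derive_val _ _ _ _ _ _ _ (H k)).
Qed.

Lemma is_derive_linear (V W : normedModType R) (L : {linear V -> W}) (f : R -> V)
    (t : R) (df : V) : continuous L ->
  is_derive t 1 f df -> is_derive t 1 (L \o f) (L df).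
Proof.
move=> Lc /is_deriveP H; apply/is_deriveP => e e0.
have [M M0 LM] : exists2 M : R, 0 < M & forall v, `|L v| <= M * `|v|.
  have /linear_boundedP[r [_ rP]] := (continuous_linear_bounded 0 (Lc 0)).
  exists (`|r| + 1); first by rewrite ltr_wpDl.
  by apply: rP; rewrite (le_lt_trans (ler_norm _))// ltrDl.
have [dt dt0 Hd] := H (e / M) (divr_gt0 e0 M0); exists dt => // h ht.
rewrite /= -linearB -linearZ -linearB; apply: le_trans (LM _) _.
by apply: le_trans (ler_wpM2l (ltW M0) (Hd h ht)) _; rewrite mulrA mulrCA divff ?gt_eqF// mulr1.
Qed.

Lemma is_derive_mulmx p d (M : 'M[R]_(p, d)) (f : R -> 'cV[R]_d) (t : R) (df : 'cV[R]_d) :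
  is_derive t 1 f df -> is_derive t 1 (fun s => M *m f s) (M *m df).
Proof.
apply: (@is_derive_linear _ _ (mulmx M)); exact: linear_mx_continuous.
Qed.

Lemma is_derive_dotv d (f g : R -> 'cV[R]_d) (t : R) (df dg : 'cV[R]_d) :
  is_derive t 1 f df -> is_derive t 1 g dg ->
  is_derive t 1 (fun s => dotv (f s) (g s)) (dotv df (g t) + dotv (f t) dg).
Proof.
move=> Hf Hg.
have -> : (fun s => dotv (f s) (g s)) = \sum_k (fun s => f s k 0 * g s k 0).
  by apply/funext => s; rewrite dotvE fct_sumE.
have Hk k := @is_deriveM _ _ (fun s => f s k 0) (fun s => g s k 0) t 1 _ _
  (is_derive_coord k Hf) (is_derive_coord k Hg).
apply: (is_derive_eq (is_derive_sum Hk)).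
rewrite !dotvE -big_split/=; apply: eq_bigr => k _.
by rewrite addrC; congr (_ + _); exact: mulrC.
Qed.

Lemma is_derive_half_sqdist d (C : set 'cV[R]_d) (f : R -> 'cV[R]_d) (t : R) (df : 'cV[R]_d) :
  closed C -> @convex_set R 'cV[R]_d C -> C !=set0 ->
  is_derive t 1 f df ->
  is_derive t 1 (fun s => half_sqdist C (f s)) (dotv (f t - proj C (f t)) df).
Proof.
move=> Ccl Cconv C0 /is_derive_enormP H; apply/is_deriveP => e e0.
set p := f t - proj C (f t).
pose M := enorm df + 1; pose q := enorm p + 1.
have M0 : 0 < M by rewrite ltr_wpDl ?enorm_ge0.
have q0 : 0 < q by rewrite ltr_wpDl ?enorm_ge0.
(* The tolerance 1 bounds the increment of [f] by [M * |h|]; the tolerance [e / (2 * q)] brings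
   [dotv p r] below half of the allowed error. The other half pays for the quadratic term, through
   [|h| < e / M ^+ 2]. *)
have e1 : 0 < Num.min 1 (e / (2 * q)) by rewrite lt_min ltr01 divr_gt0// mulr_gt0.
have [dt dt0 Hd] := H _ e1.
exists (Num.min dt (e / M ^+ 2)); first by rewrite lt_min dt0 divr_gt0// exprn_gt0.
move=> h; rewrite lt_min => /andP[h1 h2]; have {}Hd := Hd h h1.
set r := f (t + h) - f t - h *: df in Hd.
have fE : f (t + h) - f t = h *: df + r by rewrite /r addrCA subrr addr0.
have r1 : enorm r <= `|h|.
  by apply: le_trans Hd _; rewrite -[leRHS]mul1r ler_wpM2r// ge_min lexx.
have r2 : enorm r * q <= e / 2 * `|h|.
  rewrite -ler_pdivlMr// mulrAC -[e / 2 / q]mulrA -invfM.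
  by apply: le_trans Hd _; rewrite ler_wpM2r// ge_min lexx orbT.
have fM : enorm (f (t + h) - f t) <= `|h| * M.
  rewrite fE; apply: le_trans (enormD _ _) _; rewrite enormZ /M; lra.
have := half_sqdist_expansion Ccl Cconv C0 (f t) (f (t + h)).
rewrite -/p -sqr_enorm; set x := enorm _ in fM *.
rewrite fE dotvDr dotvZr -[h *: _]/(h * _).
have : `|dotv p r| <= e / 2 * `|h|.
  apply: le_trans (normr_dotv_le _ _) _; rewrite mulrC; apply: le_trans r2.
  by rewrite ler_wpM2l ?enorm_ge0// lerDl.
have : 2^-1 * x ^+ 2 <= e / 2 * `|h|.
  have : x ^+ 2 <= (`|h| * M) ^+ 2 by rewrite ler_pXn2r// ?nnegrE ?enorm_ge0// mulr_ge0// ltW.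
  have : `|h| * M ^+ 2 <= e by rewrite -ler_pdivlMr ?exprn_gt0// ltW.
  rewrite exprMn; have := normr_ge0 h; nra.
set z := e / 2 * `|h|; have -> : e * `|h| = z + z by rewrite /z; field.
clearbody z x; move: (half_sqdist _ (f t)) (half_sqdist _ _) (dotv p df) (dotv p r).
move=> a b u v; rewrite !ler_norml => ? /andP[? ?] /andP[? ?].
by apply/andP; split; lra.
Qed.

End Derivative.

(** * Absolutely continuous functions *)

Section AbsoluteContinuity.
Context {R : realType}.
Notation mu := (@lebesgue_measure R).

(* Absolute continuity with families of disjoint intervals listed from left to
   right, which can be extended by appending one interval. *)
Definition in_order (a b : R) (p : seq (R * R)) :=
  all (fun u => (a <= u.1 <= u.2) && (u.2 <= b)) p &&
  pairwise (fun u v : R * R => u.2 <= v.1) p.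

Definition ac (a b : R) (f : R -> R) : Prop :=
  forall e : R, 0 < e -> exists2 delta : R, 0 < delta &
    forall p, in_order a b p -> \sum_(u <- p) (u.2 - u.1) < delta ->
      \sum_(u <- p) `|f u.2 - f u.1| < e.

(** Passes from the vector solution to scalar quantities controlled by it. A list in order is read
    as a family indexed by ordinals; the order makes the open intervals disjoint. *)
Lemma ac_lipschitz d (a b C : R) (z : R -> 'cV[R]_d) (f : R -> R) :
  abs_continuous_on a b z ->
  (forall s t, a <= s -> s <= t -> t <= b ->
     `|f t - f s| <= C * (enorm (z t - z s) + (t - s))) ->
  ac a b f.
Proof.
move=> zac fz e e0; pose K : R := `|C| + 1.
have K0 : 0 < K by rewrite ltr_wpDl.
have e1 : 0 < e / (2 * K) by rewrite divr_gt0// mulr_gt0.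
have [r r0 zr] := zac _ e1.
exists (Num.min r (e / (2 * K))).
  by rewrite lt_min r0 divr_gt0// mulr_gt0.
move=> p /andP[/allP pab pp]; rewrite lt_min => /andP[l1 l2].
pose x0 : R * R := (0, 0).
have pin (i : 'I_(size p)) : nth x0 p i \in p by exact: mem_nth.
have sumE (F : R * R -> R) : \sum_(u <- p) F u = \sum_(i < size p) F (nth x0 p i).
  by rewrite (big_nth x0) big_mkord.
have ez : \sum_(i < size p) enorm (z (nth x0 p i).2 - z (nth x0 p i).1) < e / (2 * K).
  apply: (zr _ (fun i => (nth x0 p i).1) (fun i => (nth x0 p i).2)).
  - by move=> i; have /andP[/andP[? ?] ?] := pab _ (pin i).
  - move=> i j _ _ [x [/=]]; rewrite !in_itv/= => /andP[xi1 xi2] /andP[xj1 xj2].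
    have disj (i' j' : 'I_(size p)) : (i' < j')%N ->
        (nth x0 p j').1 < x -> x < (nth x0 p i').2 -> False.
      move=> ij h1 h2; have := pairwiseP x0 pp i' j' (ltn_ord i') (ltn_ord j') ij.
      by move=> /(lt_le_trans h2)/(lt_trans h1); rewrite ltxx.
    case: (ltngtP i j) => [ij|ij|/val_inj//]; last by case: (disj _ _ ij xi1 xj2).
    by case: (disj _ _ ij xj1 xi2).
  - by rewrite -(sumE (fun u => u.2 - u.1)).
have le1 : \sum_(u <- p) `|f u.2 - f u.1| <=
    K * (\sum_(u <- p) enorm (z u.2 - z u.1) + \sum_(u <- p) (u.2 - u.1)).
  rewrite -big_split/= mulr_sumr big_seq [leRHS]big_seq.
  apply: ler_sum => u /pab/andP[/andP[au uu] ub].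
  apply: le_trans (fz _ _ au uu ub) _; apply: ler_wpM2r.
    by rewrite addr_ge0 ?enorm_ge0// subr_ge0.
  by rewrite (le_trans (ler_norm _))// lerDl.
apply: le_lt_trans le1 _; rewrite mulrC -ltr_pdivlMr// (sumE (fun u => enorm _)).
have -> : e / K = e / (2 * K) + e / (2 * K) by field; rewrite gt_eqF.
exact: ltrD.
Qed.

Lemma ac_affine (a b s t c k : R) (f : R -> R) : ac a b f -> a <= s -> t <= b ->
  ac s t (fun x => c * f x + k * x).
Proof.
move=> fac as_ tb e e0; pose K : R := `|c| + `|k| + 1.
have K0 : 0 < K by rewrite ltr_wpDl// addr_ge0.
have e1 : 0 < e / (2 * K) by rewrite divr_gt0// mulr_gt0.
have [r r0 fr] := fac _ e1.
exists (Num.min r (e / (2 * K))).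
  by rewrite lt_min r0 divr_gt0// mulr_gt0.
move=> p /andP[pst pp]; rewrite lt_min => /andP[l1 l2].
have pab : in_order a b p.
  apply/andP; split => //; apply: sub_all pst => u /andP[/andP[su ->] ut].
  by rewrite (le_trans as_ su) (le_trans ut tb).
have := fr p pab l1 => fe.
have le1 : \sum_(u <- p) `|c * f u.2 + k * u.2 - (c * f u.1 + k * u.1)| <=
    K * (\sum_(u <- p) `|f u.2 - f u.1| + \sum_(u <- p) (u.2 - u.1)).
  rewrite -big_split/= mulr_sumr big_seq [leRHS]big_seq.
  apply: ler_sum => u /(allP pst)/andP[/andP[au uu] ub].
  have -> : c * f u.2 + k * u.2 - (c * f u.1 + k * u.1) =
    c * (f u.2 - f u.1) + k * (u.2 - u.1) by ring.
  apply: le_trans (ler_normD _ _) _; rewrite !normrM.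
  rewrite [`|u.2 - u.1|]ger0_norm ?subr_ge0// [leRHS]mulrDr.
  apply: lerD; apply: ler_wpM2r => //; rewrite ?subr_ge0// /K.
    by rewrite -addrA lerDl addr_ge0.
  by rewrite addrAC lerDr addr_ge0.
apply: le_lt_trans le1 _; rewrite mulrC -ltr_pdivlMr//.
have -> : e / K = e / (2 * K) + e / (2 * K) by field; rewrite gt_eqF.
exact: ltrD.
Qed.

(** Let [c] be the supremum of the good points. Some good point lies just below [c], and one step
    from it reaches points beyond [c], a contradiction unless [c = b]. *)
Lemma real_induction (a b : R) (Q : R -> Prop) : a <= b -> Q a ->
  (forall c, a <= c <= b -> exists2 r : R, 0 < r &
     forall s t, a <= s -> s <= c -> c <= t -> t <= b -> c - r < s -> t < c + r ->
       Q s -> Q t) ->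
  Q b.
Proof.
move=> ab Qa step.
pose S := [set t | a <= t <= b /\ Q t].
have Sa : S a by split; rewrite ?lexx.
have Sub : ubound S b by move=> t [/andP[]].
have hsS : has_sup S by split; [exists a|exists b].
pose c := sup S.
have cab : a <= c <= b.
  apply/andP; split; first by apply: ub_le_sup => //; exists b.
  by apply: ge_sup => //; exists a.
have [r r0 st] := step c cab; have /andP[ac cb] := cab.
have [s [/andP[as_ sb] Qs] cs] := sup_adherent r0 hsS.
have sc : s <= c by apply: ub_le_sup; [exists b|split; rewrite ?as_].
have Qt t : c <= t -> t <= b -> t < c + r -> Q t.
  by move=> ct tb tr; exact: (st s t as_ sc ct tb cs tr Qs).
have [bc|cb'] := lerP b c.
  by apply: Qt => //; rewrite (le_lt_trans bc)// ltrDl.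
pose t := Num.min b (c + r / 2).
have ct : c < t by rewrite lt_min cb' ltrDl divr_gt0.
have tb : t <= b by rewrite ge_min lexx.
have : S t.
  split; first by rewrite tb andbT (le_trans ac)// ltW.
  apply: Qt => //; first exact: ltW.
  by rewrite gt_min ltrD2l ltr_pdivrMr// ltr_pMr// ltr1n orbT.
by move=> /(ub_le_sup (ex_intro _ b Sub)); rewrite leNgt ct.
Qed.

Lemma null_open_cover (E : set R) (e : R) : mu.-negligible E -> 0 < e ->
  exists U : set R, [/\ open U, E `<=` U & (mu U < e%:E)%E].
Proof.
move=> [B [mB B0 EB]] e0.
have [|U [oU BU UB]] := lebesgue_regularity_outer mB _ e0.
  exact: (eq_ind_r (fun v => (v < +oo)%E) (ltry 0) B0).
exists U; split => //; first exact: subset_trans BU.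
rewrite (_ : U = B `|` (U `\` B)); last by rewrite setDUK.
have mB' : measurable (B : set R) by exact: mB.
have mUB : measurable (U `\` B) by apply: measurableD => //; exact: open_measurable.
have h : (mu (B `|` U `\` B) <= mu B + mu (U `\` B))%E by exact: measureU2.
apply: le_lt_trans h _.
have -> : (mu B + mu (U `\` B) = mu (U `\` B))%E.
  exact: (eq_ind_r (fun v => (v + mu (U `\` B) = mu (U `\` B))%E) (add0e _) B0).
exact: UB.
Qed.

(* An exceptional null set is covered by a small open set U; absolute continuity
   bounds the variation over the finitely many gaps lying in U. *)
Lemma ac_nonincreasing (a b : R) (f : R -> R) : a <= b -> ac a b f ->
  {ae mu, forall t, a <= t <= b -> exists2 df, is_derive t 1 f df & df <= 0} ->
  f b <= f a.
Proof.
move=> ab fac Hae.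
set E := ~` [set t | a <= t <= b -> exists2 df, is_derive t 1 f df & df <= 0].
have EN : mu.-negligible E by exact: Hae.
(* [e] pays for the variation over the gaps around exceptional points, [k] for the slack in the
   slope elsewhere; both are arbitrary. *)
suff H (e k : R) : 0 < e -> 0 < k -> f b - f a <= k * (b - a) + e.
  rewrite -subr_le0 leNgt; apply/negP => pos.
  have ba1 : 0 < b - a + 1 by rewrite ltr_wpDl// subr_ge0.
  pose q := (f b - f a) / (2 * (b - a + 1)).
  have q0 : 0 < q by rewrite divr_gt0// mulr_gt0.
  have := H q q q0 q0; have : q * (b - a + 1) = (f b - f a) / 2.
    by rewrite /q; field; rewrite gt_eqF.
  lra.
move=> e0 k0; have [delta d0 fd] := fac e e0.
have [U [oU EU Ud]] := null_open_cover EN d0.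
have mU : measurable U by exact: open_measurable.
have Ufin (t : R) : (mu (U `&` `[a, t]) \is a fin_num)%E.
  rewrite ge0_fin_numE//; apply: le_lt_trans (ltry delta).
  apply: le_trans (ltW Ud); apply: le_measure; rewrite ?inE//; exact: measurableI.
(* The length budget: gaps recorded up to [t] are to have total length at most [M t], which stays
   below [delta]. *)
pose M (t : R) := fine (mu (U `&` `[a, t])).
have Mb t : M t < delta.
  rewrite -lte_fin fineK//; apply: le_lt_trans Ud.
  by apply: le_measure; rewrite ?inE//; exact: measurableI.
have Mmono s t : s <= t -> M s <= M t.
  move=> st; rewrite -lee_fin !fineK//; apply: le_measure; rewrite ?inE//.
  - exact: measurableI.
  - exact: measurableI.
  - by apply: setIS; apply: subset_itvl; rewrite bnd_simp.
have Madd s t : a <= s -> s <= t -> `]s, t[ `<=` U -> M s + (t - s) <= M t.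
  move=> as_ st stU; rewrite -lee_fin EFinD !fineK//.
  have -> : (t - s)%:E = mu `]s, t[.
    rewrite lebesgue_measure_itv/= lte_fin; case: ltP => // ts.
    by have -> : t = s by [apply/eqP; rewrite eq_le ts st]; rewrite subrr.
  rewrite -measureU//; last 2 first.
  - exact: measurableI.
  - apply/seteqP; split => // x [[_ /=]]; rewrite !in_itv/= => /andP[_ xs] /andP[sx _].
    by have := le_lt_trans xs sx; rewrite ltxx.
  apply: le_measure; rewrite ?inE//.
  - by apply: measurableU => //; exact: measurableI.
  - exact: measurableI.
  - move=> x [[Ux /=]|/=]; rewrite in_itv/= => /andP[x1 x2].
      by split => //=; rewrite in_itv/= x1 (le_trans x2).
    split; first by apply: stU; rewrite /= in_itv/= x1.
    by rewrite /= in_itv/= (ltW x2) (le_trans as_ (ltW x1)).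
(* The invariant of the real induction: [p] lists the gaps used so far, and outside them [f] rises
   with slope at most [k]. *)
pose Q (t : R) := exists p, [/\ in_order a t p, \sum_(u <- p) (u.2 - u.1) <= M t &
   f t - f a <= k * (t - a) + \sum_(u <- p) `|f u.2 - f u.1|].
have order_mono s t p : s <= t -> in_order a s p -> in_order a t p.
  move=> st /andP[H1 H2]; apply/andP; split => //; apply: sub_all H1 => u.
  by move=> /andP[-> /= us]; exact: le_trans st.
suff [p [pord pM pf]] : Q b.
  have := fd p pord (le_lt_trans pM (Mb b)); lra.
apply: (@real_induction a b) => //.
  by exists [::]; rewrite /in_order !big_nil subrr subrr mulr0 addr0 fine_ge0.
move=> c cab; have /andP[ac cb] := cab.
(* At an exceptional [c] the whole step lies in [U] and is appended to [p] as a gap. Otherwise the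
   derivative at [c] bounds the slope by [k] on both sides of [c], and [p] is kept. *)
have [Ec|] := pselect (E c).
  have /nbhs_ballP[r /= r0 rU] : nbhs c U by apply: open_nbhs_nbhs; split => //; exact: EU.
  exists r => // s t as_ sc ct tb rs tr [p [pord pM pf]].
  have st := le_trans sc ct.
  have stU : `]s, t[ `<=` U.
    move=> x /=; rewrite in_itv/= => /andP[sx xt]; apply: rU.
    rewrite /ball/= ltr_norml; apply/andP; split; lra.
  exists (rcons p (s, t)); split.
  - have /andP[H1 H2] := pord; apply/andP; split.
      rewrite all_rcons/= as_ st lexx/=.
      by have /andP[] := order_mono _ _ _ st pord.
    rewrite pairwise_rcons H2 andbT; apply: sub_all H1 => u.
    by move=> /andP[_].
  - rewrite -cats1 big_cat/= big_seq1/=.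
    by apply: le_trans (Madd _ _ as_ st stU); rewrite lerD2r.
  - rewrite -cats1 big_cat/= big_seq1/=.
    have : 0 <= k * (t - s) by apply: mulr_ge0; [exact: ltW|rewrite subr_ge0].
    have := ler_norm (f t - f s); lra.
move=> /contrapT /(_ cab) [df /is_deriveP H df0].
have [r r0 Hr] := H k k0.
exists r => // s t as_ sc ct tb rs tr [p [pord pM pf]].
have st := le_trans sc ct.
exists p; split.
- exact: order_mono st pord.
- exact: le_trans pM (Mmono _ _ st).
have h1 : f t - f c <= k * (t - c).
  have := Hr (t - c); have -> : c + (t - c) = t by ring.
  have ct0 : 0 <= t - c by rewrite subr_ge0.
  rewrite ger0_norm// -[_ *: df]/((t - c) * df) ler_norml => /(_ _)/andP[|_]; first lra.
  have : (t - c) * df <= 0 by rewrite mulr_ge0_le0.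
  lra.
have h2 : f c - f s <= k * (c - s).
  have := Hr (s - c); have -> : c + (s - c) = s by ring.
  have cs0 : s - c <= 0 by rewrite subr_le0.
  rewrite ler0_norm// -[_ *: df]/((s - c) * df) ler_norml => /(_ _)/andP[|]; first lra.
  have : 0 <= (s - c) * df by rewrite mulr_le0.
  lra.
lra.
Qed.

(** Near [c] the values of [g] stay within [e] of [g c], so [f] minus a line of slope [g c + e] does
    not increase and [f] minus a line of slope [g c - e] does not decrease. An almost everywhere
    derivative thereby becomes a genuine one wherever [g] is continuous. *)
Lemma ac_is_derive (a b c : R) (f g : R -> R) : a < c < b -> ac a b f ->
  {ae mu, forall t, a <= t <= b -> is_derive t 1 f (g t)} ->
  {for c, continuous g} -> is_derive c 1 f (g c).
Proof.
move=> /andP[ac_ cb] fac Hae /cvgrPdist_le gc; apply/is_deriveP => e e0.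
have /nbhs_ballP[r /= r0 Hr] := gc e e0.
pose q := Num.min r (Num.min (c - a) (b - c)).
have q0 : 0 < q by rewrite !lt_min r0 !subr_gt0 ac_.
have slope s t k1 k2 : a <= s -> s <= t -> t <= b ->
    (forall x, s <= x <= t -> k1 * g x + k2 <= 0) ->
    k1 * f t + k2 * t <= k1 * f s + k2 * s.
  move=> as_ st tb gx.
  apply: (ac_nonincreasing st (ac_affine k1 k2 fac as_ tb)).
  apply: (@filterS _ _ (ae_filter_ringOfSetsType mu)) Hae => x Hx /andP[sx xt]; exists (k1 * g x + k2).
    have fx : is_derive x 1 f (g x) by apply: Hx; rewrite (le_trans as_ sx) (le_trans xt tb).
    have := is_deriveD (is_deriveZ k1 fx) (is_deriveZ k2 (is_derive_id x 1)).
    by rewrite [k2 *: 1]mulr1.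
  by apply: gx; rewrite sx xt.
have H s t : s <= t -> `|s - c| < q -> `|t - c| < q ->
    `|f t - f s - (t - s) * g c| <= e * (t - s).
  rewrite !ltr_norml !lt_min => st /andP[s1 /and3P[s2 s3 s4]] /andP[t1 /and3P[t2 t3 t4]].
  have qr : q <= r by rewrite ge_min lexx.
  have qa : q <= c - a by rewrite !ge_min lexx orbT.
  have as_ : a <= s by lra.
  have tb : t <= b by lra.
  have gx x : s <= x <= t -> - e <= g c - g x <= e.
    move=> /andP[sx xt]; rewrite -ler_norml; apply: Hr.
    by rewrite /ball/= ltr_norml; apply/andP; split; lra.
  have h1 : 1 * f t + (- (g c + e)) * t <= 1 * f s + (- (g c + e)) * s.
    by apply: slope => // x /gx /andP[]; lra.
  have h2 : -1 * f t + (g c - e) * t <= -1 * f s + (g c - e) * s.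
    by apply: slope => // x /gx /andP[]; lra.
  by rewrite ler_norml; apply/andP; split; lra.
exists q => // h hq; have cq : `|c - c| < q by rewrite subrr normr0.
have chq : `|c + h - c| < q by rewrite addrC addKr.
have [h0|h0] := leP 0 h.
  have := H c (c + h); rewrite lerDl h0 => /(_ isT cq chq).
  by have -> : c + h - c = h by [ring]; rewrite (ger0_norm h0).
have := H (c + h) c.
have -> : c - (c + h) = - h by ring.
rewrite (ltr0_norm h0) -[_ *: g c]/(h * g c).
have -> : f c - f (c + h) - - h * g c = - (f (c + h) - f c - h * g c) by ring.
by rewrite normrN; apply => //; lra.
Qed.

End AbsoluteContinuity.

(** * Filippov velocities and signed consensus *)

Section Filippov.
Context {R : realType}.

Lemma null_set0 d : null_set (set0 : set 'cV[R]_d).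
Proof.
move=> e e0; exists set0, (fun=> 0), (fun=> 0); split => //.
by rewrite esum_set0 lee_fin ltW.
Qed.

(* Only the exceptional set S = set0 of the Filippov regularisation is used. *)
Lemma filippov_le d (f : 'cV[R]_d -> 'cV[R]_d) (z v : 'cV[R]_d) (I : finType)
    (w : I -> R) (r : I -> 'I_d) (c : R) :
  filippov f z v ->
  (forall e : R, 0 < e -> exists2 delta : R, 0 < delta &
     forall y, enorm (y - z) < delta -> \sum_i w i * f y (r i) 0 <= c + e) ->
  \sum_i w i * v (r i) 0 <= c.
Proof.
move=> fv fc; apply/ler_addgt0Pr => e e0.
have e2 : 0 < e / 2 by rewrite divr_gt0.
have [delta d0 fy] := fc _ e2.
have := fv delta set0 d0 (@null_set0 d).
pose W := 1 + \sum_i `|w i|.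
have W0 : 0 < W by rewrite ltr_pwDl// sumr_ge0.
(* A half-space is convex, so it contains the convex hull as soon as it contains the nearby values
   of [f]; the closure costs the other [e / 2]. *)
pose S := [set u : 'cV[R]_d | \sum_i w i * u (r i) 0 <= c + e / 2].
move=> /(_ [set u | enorm (u - v) < e / (2 * W)]) [].
  by apply/nbhs_enormP; exists (e / (2 * W)) => //; rewrite divr_gt0// mulr_gt0.
move=> u [uC /= uv].
have Su : S u.
  apply: (uC S); split.
    apply/convex_setP => x y t /andP[t0 t1] Sx Sy; rewrite /S/=.
    have -> : \sum_i w i * (t *: x + (1 - t) *: y) (r i) 0 =
        t * (\sum_i w i * x (r i) 0) + (1 - t) * (\sum_i w i * y (r i) 0).
      by rewrite !mulr_sumr -big_split/=; apply: eq_bigr => i _; rewrite !mxE; ring.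
    rewrite /S/= in Sx Sy.
    have : t * (\sum_i w i * x (r i) 0) <= t * (c + e / 2) by rewrite ler_wpM2l.
    have : (1 - t) * (\sum_i w i * y (r i) 0) <= (1 - t) * (c + e / 2).
      by rewrite ler_wpM2l// subr_ge0.
    lra.
  by move=> _ [y [yz _] <-]; exact: fy.
have : \sum_i w i * v (r i) 0 - \sum_i w i * u (r i) 0 <= e / 2.
  rewrite -sumrB; apply: (@le_trans _ _ (\sum_i `|w i| * (e / (2 * W)))).
    apply: ler_sum => i _; rewrite -mulrBr.
    apply: le_trans (ler_norm _) _; rewrite normrM ler_wpM2l//.
    apply: le_trans (ltW uv); rewrite distrC.
    by have := coord_le_enorm (u - v) (r i); rewrite !mxE.
  rewrite -mulr_suml.
  have -> : e / 2 = W * (e / (2 * W)) by field; rewrite gt_eqF.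
  by apply: ler_wpM2r; [rewrite divr_ge0// ?ltW// mulr_gt0|rewrite lerDr].
rewrite /S/= in Su; lra.
Qed.

(** The linear bound with weights 1 and -1. It is applied to the coordinates of [x], whose velocity
    is classical. *)
Lemma filippov_coord d (f : 'cV[R]_d -> 'cV[R]_d) (z v : 'cV[R]_d) (k : 'I_d) :
  filippov f z v -> {for z, continuous (fun y => f y k 0)} -> v k 0 = f z k 0.
Proof.
move=> fv /(@cvgrPdist_le _ _ _ (nbhs z)) fc.
have fd e : 0 < e -> exists2 delta : R, 0 < delta &
    forall y, enorm (y - z) < delta -> `|f z k 0 - f y k 0| <= e.
  by move=> /fc /nbhs_enormP.
apply/eqP; rewrite eq_le; apply/andP; split.
  have := @filippov_le d f z v unit (fun=> 1) (fun=> k) (f z k 0) fv.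
  rewrite !big_const !card_unit/= addr0 mul1r; apply => e /fd[delta d0 H].
  exists delta => // y /H; rewrite big_const card_unit/= addr0 mul1r ler_norml.
  move=> /andP[]; lra.
have := @filippov_le d f z v unit (fun=> -1) (fun=> k) (- f z k 0) fv.
rewrite !big_const !card_unit/= addr0 mulN1r lerN2; apply => e /fd[delta d0 H].
exists delta => // y /H; rewrite big_const card_unit/= addr0 mulN1r ler_norml.
move=> /andP[]; lra.
Qed.

End Filippov.

Section Consensus.
Context {R : realType} {N : nat}.
Implicit Types (e : rel 'I_N) (a b d : 'I_N -> R).

Definition sgsum e b i := \sum_(j | e i j) Num.sg (b j - b i).

Definition mean a := N%:R^-1 * \sum_i a i.

(** Summation by parts on the graph: by symmetry each edge is met in both orientations, and
    averaging the two ways of writing the sum produces the differences of [a]. *)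
Lemma sum_sgsum_mull e a b : symmetric e ->
  \sum_i a i * sgsum e b i =
  - (2^-1 * \sum_i \sum_(j | e i j) (a i - a j) * Num.sg (b i - b j)).
Proof.
move=> esym.
have E1 : \sum_i a i * sgsum e b i =
    - \sum_i \sum_(j | e i j) a i * Num.sg (b i - b j).
  rewrite -sumrN; apply: eq_bigr => i _; rewrite mulr_sumr -sumrN.
  by apply: eq_bigr => j _; rewrite -opprB sgrN mulrN.
have E2 : \sum_i a i * sgsum e b i =
    \sum_i \sum_(j | e i j) a j * Num.sg (b i - b j).
  under eq_bigr => i _ do rewrite mulr_sumr.
  rewrite (exchange_big_dep predT)//=; apply: eq_bigr => i _.
  by apply: eq_big => // j; rewrite esym.
have : \sum_i \sum_(j | e i j) (a i - a j) * Num.sg (b i - b j) =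
    - (2 * \sum_i a i * sgsum e b i).
  rewrite mulr_natl mulr2n opprD {1}E1 E2 opprK -sumrB.
  by apply: eq_bigr => i _; rewrite -sumrB; apply: eq_bigr => j _; rewrite mulrBl.
by move=> ->; rewrite mulrN opprK mulrA mulVf// mul1r.
Qed.

Lemma sum_sgsum e b : symmetric e -> \sum_i sgsum e b i = 0.
Proof.
move=> esym; have := sum_sgsum_mull (fun=> 1) b esym.
under eq_bigr do rewrite mul1r.
move=> ->; rewrite big1 ?mulr0 ?oppr0// => i _; rewrite big1// => j _.
by rewrite subrr mul0r.
Qed.

(** Triangle inequality along a simple path. Its edges are distinct and each occurs twice in the
    double sum, which explains the factor one half; the remaining terms are nonnegative. *)
Lemma path_variation e b p s : symmetric e -> path e p s -> uniq (p :: s) ->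
  `|b p - b (last p s)| <=
  2^-1 * \sum_(i <- p :: s) \sum_(j <- p :: s | e i j) `|b i - b j|.
Proof.
move=> esym; elim: s p => [|q s IH] p /=.
  move=> _ _; rewrite subrr normr0 mulr_ge0// sumr_ge0// => i _.
  exact: sumr_ge0.
move=> /andP[epq qs] /andP[pqs uqs]; have := IH q qs uqs.
set S := \sum_(i <- q :: s) \sum_(j <- q :: s | e i j) `|b i - b j| => h.
have T0 : 0 <= \sum_(j <- s | e p j) `|b p - b j| by exact: sumr_ge0.
have U0 : 0 <= \sum_(i <- s | e i p) `|b i - b p| by exact: sumr_ge0.
have -> : \sum_(i <- [:: p, q & s]) \sum_(j <- [:: p, q & s] | e i j) `|b i - b j|
   = \sum_(j <- [:: p, q & s] | e p j) `|b p - b j|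
   + (\sum_(i <- q :: s | e i p) `|b i - b p| + S).
  rewrite big_cons; congr (_ + _).
  rewrite [X in _ = X + _]big_mkcond/= -big_split/=; apply: eq_bigr => i _.
  by rewrite big_cons; case: ifP => //; rewrite add0r.
rewrite !big_cons epq (esym q p) epq.
have := ler_normD (b p - b q) (b q - b (last q s)).
rewrite subrKA (distrC (b q) (b p)).
by case: (e p p); rewrite ?subrr ?normr0; lra.
Qed.

Lemma connected_variation e b p q : undirected_connected e ->
  `|b p - b q| <= 2^-1 * \sum_i \sum_(j | e i j) `|b i - b j|.
Proof.
move=> [esym /(_ p q) /connectP[s0 ps0 ->]].
case/shortenP: ps0 => s ps us _.
apply: le_trans (path_variation b esym ps us) _; apply: ler_wpM2l => //.
have ext (F : 'I_N -> R) : (forall i, 0 <= F i) ->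
    \sum_(i <- p :: s) F i <= \sum_i F i.
  move=> F0; rewrite big_uniq//= [leRHS](bigID (mem (p :: s)))/= lerDl.
  exact: sumr_ge0.
apply: le_trans (ext _ _); last by move=> i; exact: sumr_ge0.
apply: ler_sum => i _; rewrite big_mkcond [leRHS]big_mkcond/=.
by apply: ext => j; case: ifP.
Qed.

Lemma normr_sg_le1 (x : R) : `|Num.sg x| <= 1.
Proof. by rewrite normr_sg; case: (x != 0). Qed.

(* The signs are taken at b, a point near a, since the Filippov velocity at a is
   a limit of velocities at nearby states. *)
Lemma sgsum_dissipation e a b (m delta : R) p q : undirected_connected e ->
  (forall i, `|b i - a i| <= delta) ->
  \sum_i (a i - m) * sgsum e b i <= - `|a p - a q| + (2 + N%:R ^+ 2) * delta.
Proof.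
move=> ec ab; have [esym _] := ec.
(* As the signs sum to zero, the constant [m] drops out. Replacing [a] by [b] then costs at most
   [delta] times the degree, itself at most [N], at each node. *)
have S0 := sum_sgsum b esym.
have -> : \sum_i (a i - m) * sgsum e b i =
    \sum_i b i * sgsum e b i + \sum_i (a i - b i) * sgsum e b i.
  rewrite -big_split/=.
  transitivity (\sum_i a i * sgsum e b i - m * \sum_i sgsum e b i).
    by rewrite mulr_sumr -sumrB; apply: eq_bigr => i _; rewrite mulrBl.
  by rewrite S0 mulr0 subr0; apply: eq_bigr => i _; ring.
have h1 : \sum_i b i * sgsum e b i <= - `|b p - b q|.
  rewrite sum_sgsum_mull// lerN2.
  apply: le_trans (connected_variation b p q ec) _; apply: ler_wpM2l => //.
  apply: ler_sum => i _; apply: ler_sum => j _.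
  by rewrite mulrC -normrEsg.
have h2 : \sum_i (a i - b i) * sgsum e b i <= N%:R ^+ 2 * delta.
  have : \sum_i (a i - b i) * sgsum e b i <= \sum_(i < N) delta * N%:R.
    apply: ler_sum => i _; apply: le_trans (ler_norm _) _; rewrite normrM.
    apply: ler_pM => //; first by rewrite distrC.
    apply: le_trans (ler_norm_sum _ _ _) _.
    apply: (@le_trans _ _ (\sum_(j < N) 1)).
      rewrite big_mkcond/=; apply: ler_sum => j _; case: ifP => // _.
      exact: normr_sg_le1.
    by rewrite sumr_const card_ord.
  by rewrite sumr_const card_ord -[_ *+ N]mulr_natl expr2 => /le_trans; apply; rewrite mulrCA mulrC.
have h3 : `|a p - a q| <= `|b p - b q| + 2 * delta.
  have -> : a p - a q = (b p - b q) - (b p - a p) + (b q - a q) by ring.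
  apply: le_trans (ler_normD _ _) _; have := ler_normB (b p - b q) (b p - a p).
  have := ab p; have := ab q; lra.
lra.
Qed.

Hypothesis N_gt0 : (0 < N)%N.

Lemma deviation_mean a i : a i - mean a = N%:R^-1 * \sum_j (a i - a j).
Proof.
rewrite sumrB sumr_const card_ord mulrBr -[a i *+ N]mulr_natl mulKf//.
by rewrite pnatr_eq0 -lt0n.
Qed.

Lemma sum_deviation a : \sum_i (a i - mean a) = 0.
Proof.
rewrite sumrB sumr_const card_ord -[_ *+ N]mulr_natl /mean mulVKf ?subrr//.
by rewrite pnatr_eq0 -lt0n.
Qed.

Lemma deviation_le a i (M : R) : (forall i j, `|a i - a j| <= M) -> `|a i - mean a| <= M.
Proof.
move=> aM; rewrite deviation_mean normrM gtr0_norm ?invr_gt0 ?ltr0n//.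
rewrite ler_pdivrMl ?ltr0n//; apply: le_trans (ler_norm_sum _ _ _) _.
apply: le_trans (ler_sum _ (fun j _ => aM i j)) _.
by rewrite sumr_const card_ord mulr_natl.
Qed.

(** Source of the factor [N - 1] in the gain conditions: a deviation from the mean averages [N]
    differences, one of which, [a i - a i], is zero. *)
Lemma sum_deviation_mul_le a d (M D : R) : (forall i j, `|a i - a j| <= M) ->
  (forall i, `|d i| <= D) ->
  \sum_i (a i - mean a) * d i <= (N%:R - 1) * D * M.
Proof.
move=> aM dD.
have Np : 0 < N%:R :> R by rewrite ltr0n.
have h i : (a i - mean a) * d i <= N%:R^-1 * ((N%:R - 1) * M * D).
  rewrite deviation_mean -[leLHS]mulrA; apply: ler_wpM2l; first by rewrite invr_ge0 ltW.
  apply: le_trans (ler_norm _) _; rewrite normrM.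
  apply: ler_pM => //; rewrite (bigD1 i)//= subrr add0r.
  apply: le_trans (ler_norm_sum _ _ _) _.
  apply: le_trans (ler_sum _ (fun j _ => aM i j)) _.
  by rewrite sumr_const cardC1 card_ord -[M *+ _]mulr_natl -subn1 natrB.
apply: le_trans (ler_sum _ (fun i _ => h i)) _.
rewrite sumr_const card_ord -[_ *+ N]mulr_natl mulVKf ?gt_eqF//.
by rewrite mulrAC.
Qed.

End Consensus.

(** * Calculus of absolutely continuous functions and finite-time extinction *)

Section AbsoluteContinuityClosure.
Context {R : realType}.
Implicit Types f g h : R -> R.

Lemma ac_dominated (a b C : R) f g h : ac a b f -> ac a b g ->
  (forall s t, a <= s -> s <= t -> t <= b ->
     `|h t - h s| <= C * (`|f t - f s| + `|g t - g s|)) ->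
  ac a b h.
Proof.
move=> fac gac hfg e e0; pose K : R := `|C| + 1.
have K0 : 0 < K by rewrite ltr_wpDl.
have e1 : 0 < e / (2 * K) by rewrite divr_gt0// mulr_gt0.
have [r r0 fr] := fac _ e1; have [q q0 gq] := gac _ e1.
exists (Num.min r q); first by rewrite lt_min r0.
move=> p pab; rewrite lt_min => /andP[/(fr p pab) l1 /(gq p pab) l2].
have le1 : \sum_(u <- p) `|h u.2 - h u.1| <=
    K * (\sum_(u <- p) `|f u.2 - f u.1| + \sum_(u <- p) `|g u.2 - g u.1|).
  have /andP[/allP pab1 _] := pab.
  rewrite -big_split/= mulr_sumr big_seq [leRHS]big_seq.
  apply: ler_sum => u /pab1/andP[/andP[au uu] ub].
  apply: le_trans (hfg _ _ au uu ub) _; apply: ler_wpM2r; first by rewrite addr_ge0.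
  by rewrite (le_trans (ler_norm _))// lerDl.
apply: le_lt_trans le1 _; rewrite mulrC -ltr_pdivlMr//.
have -> : e / K = e / (2 * K) + e / (2 * K) by field; rewrite gt_eqF.
exact: ltrD.
Qed.

Lemma ac_uniform_continuous (a b e : R) f : ac a b f -> 0 < e ->
  exists2 delta : R, 0 < delta & forall s t, a <= s -> s <= t -> t <= b ->
    t - s < delta -> `|f t - f s| < e.
Proof.
move=> fac e0; have [delta d0 H] := fac _ e0; exists delta => // s t as_ st tb l.
by have := H [:: (s, t)]; rewrite !big_seq1/= /in_order/= as_ st tb; exact.
Qed.

Lemma ac_bounded (a b : R) f : ac a b f ->
  exists M, forall t, a <= t <= b -> `|f t| <= M.
Proof.
move=> fac; have [ab|ba] := lerP a b; last first.
  by exists 0 => t /andP[/le_trans /[apply]]; rewrite leNgt ba.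
have [delta d0 H] := ac_uniform_continuous fac ltr01.
apply: (@real_induction R a b (fun t => exists M : R, forall s, a <= s <= t -> `|f s| <= M)) => //.
  by exists `|f a| => s; rewrite -eq_le => /eqP <-.
move=> c cab; exists (delta / 2); first by rewrite divr_gt0.
move=> s t as_ sc ct tb sd td [M HM]; exists (M + 1) => u /andP[au ut].
have [us|/ltW su] := lerP u s.
  by apply: le_trans (HM u _) _; rewrite ?au// lerDl.
have := H s u as_ su (le_trans ut tb); have := HM s; rewrite as_ lexx => /(_ isT) h1.
move=> /(_ _)/ltW h2; have -> : f u = f s + (f u - f s) by ring.
apply: le_trans (ler_normD _ _) _; apply: lerD => //; apply: h2; lra.
Qed.

Lemma ac_cst (a b k : R) : ac a b (fun=> k).
Proof.
move=> e e0; exists 1 => // p _ _; rewrite big1// => u _.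
by rewrite subrr normr0.
Qed.

Lemma acD (a b : R) f g : ac a b f -> ac a b g -> ac a b (fun t => f t + g t).
Proof.
move=> fac gac; apply: (ac_dominated (C := 1) fac gac) => s t _ _ _.
by rewrite mul1r opprD addrACA ler_normD.
Qed.

Lemma acM (a b : R) f g : ac a b f -> ac a b g -> ac a b (fun t => f t * g t).
Proof.
move=> fac gac; have [M fM] := ac_bounded fac; have [M' gM] := ac_bounded gac.
apply: (ac_dominated (C := `|M| + `|M'|) fac gac) => s t as_ st tb.
have -> : f t * g t - f s * g s = (f t - f s) * g s + f t * (g t - g s) by ring.
apply: le_trans (ler_normD _ _) _; rewrite !normrM.
have h1 : `|g s| <= `|M'|.
  by apply: le_trans (ler_norm _); apply: gM; rewrite as_ (le_trans st).
have h2 : `|f t| <= `|M|.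
  by apply: le_trans (ler_norm _); apply: fM; rewrite tb (le_trans as_).
have h3 : `|f t - f s| * `|g s| <= `|f t - f s| * `|M'| by rewrite ler_wpM2l.
have h4 : `|f t| * `|g t - g s| <= `|M| * `|g t - g s| by rewrite ler_wpM2r.
have : 0 <= `|f t - f s| * `|M| by rewrite mulr_ge0.
have : 0 <= `|g t - g s| * `|M'| by rewrite mulr_ge0.
lra.
Qed.

Lemma ac_sum (I : Type) (r : seq I) (a b : R) (f : I -> R -> R) :
  (forall i, ac a b (f i)) -> ac a b (fun t => \sum_(i <- r) f i t).
Proof.
move=> fac; elim: r => [|i r IH].
  by under eq_fun do rewrite big_nil; exact: ac_cst.
by under eq_fun do rewrite big_cons; exact: (acD (fac i) IH).
Qed.

Lemma ac_sqrt (a b v : R) f : 0 < v -> (forall t, a <= t <= b -> v <= f t) ->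
  ac a b f -> ac a b (fun t => Num.sqrt (f t)).
Proof.
move=> v0 fv fac.
apply: (ac_dominated (C := (Num.sqrt v)^-1) fac (ac_cst _ _ 0)) => s t as_ st tb.
rewrite subrr normr0 addr0.
have fs : v <= f s by apply: fv; rewrite as_ (le_trans st).
have ft : v <= f t by apply: fv; rewrite tb (le_trans as_).
have sv : 0 < Num.sqrt v by rewrite sqrtr_gt0.
have s1 : Num.sqrt v <= Num.sqrt (f s) by rewrite ler_wsqrtr.
have s2 : Num.sqrt v <= Num.sqrt (f t) by rewrite ler_wsqrtr.
have -> : f t - f s = (Num.sqrt (f t) - Num.sqrt (f s)) * (Num.sqrt (f t) + Num.sqrt (f s)).
  rewrite -subr_sqr !sqr_sqrtr//.
    by rewrite (le_trans (ltW v0)).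
  by rewrite (le_trans (ltW v0)).
rewrite mulrC normrM ler_pdivlMr// ler_wpM2l//.
rewrite ger0_norm; lra.
Qed.

(** While [V] is positive, [sqrt V + (k / 2) * t] does not increase. The square root is not
    Lipschitz at 0, so the argument is by contradiction: [V] does not increase, hence [V t > 0]
    bounds it from below on all of [0, t]. *)
Lemma finite_time_zero (V : R -> R) (k : R) : 0 < k -> (forall t : R, 0 <= V t) ->
  (forall T : R, 0 < T -> ac 0 T V) ->
  {ae (@lebesgue_measure R), forall t : R, 0 <= t ->
     exists2 dV : R, is_derive t 1 V dV & dV <= - k * Num.sqrt (V t)} ->
  exists2 T0 : R, 0 < T0 & forall t, T0 <= t -> V t = 0.
Proof.
move=> k0 V0 Vac Hae.
have s0 : 0 <= Num.sqrt (V 0) by exact: sqrtr_ge0.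
(* The first term is the time at which the bound on [sqrt V] reaches 0; the [+ 1] makes the
   contradiction strict and the time positive. *)
exists (2 * Num.sqrt (V 0) / k + 1).
  by rewrite ltr_wpDl// divr_ge0 ?mulr_ge0// ltW.
move=> t Tt; have t0 : 0 < t.
  by apply: lt_le_trans Tt; rewrite ltr_wpDl// divr_ge0 ?mulr_ge0// ltW.
apply/eqP; rewrite eq_le V0 andbT leNgt; apply/negP => Vt.
have Vmono s : 0 <= s <= t -> V t <= V s.
  move=> /andP[s0' st].
  have sac : ac s t V.
    have := ac_affine 1 0 (Vac t t0) s0' (lexx t).
    by congr ac; apply/funext => u; rewrite mul1r mul0r addr0.
  apply: (ac_nonincreasing st sac).
  apply: (@filterS _ _ (ae_filter_ringOfSetsType (@lebesgue_measure R))) Hae.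
  move=> u Hu /andP[su _]; have [dV HV dV0] := Hu (le_trans s0' su).
  exists dV => //; apply: le_trans dV0 _.
  by rewrite mulNr oppr_le0 mulr_ge0 ?sqrtr_ge0// ltW.
have Wac : ac 0 t (fun s => 1 * Num.sqrt (V s) + (k / 2) * s).
  by apply: ac_affine (lexx 0) (lexx t); exact: ac_sqrt Vt Vmono (Vac t t0).
have := ac_nonincreasing (ltW t0) Wac.
rewrite mulr0 addr0 !mul1r => H.
have : Num.sqrt (V t) + k / 2 * t <= Num.sqrt (V 0).
  apply: H.
  apply: (@filterS _ _ (ae_filter_ringOfSetsType (@lebesgue_measure R))) Hae.
  move=> u Hu /andP[u0 ut]; have [dV HV dV0] := Hu u0.
  have Vu : 0 < V u by apply: lt_le_trans Vt _; apply: Vmono; rewrite u0.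
  have su : 0 < Num.sqrt (V u) by rewrite sqrtr_gt0.
  exists ((2 * Num.sqrt (V u))^-1 * dV + k / 2).
    have h := is_derive1_comp (is_derive1_sqrt Vu) HV.
    have := is_deriveD (is_deriveZ 1 h) (is_deriveZ (k / 2) (is_derive_id u 1)).
    by rewrite [_ *: 1]mulr1 scale1r.
  have : (2 * Num.sqrt (V u))^-1 * dV <= (2 * Num.sqrt (V u))^-1 * (- k * Num.sqrt (V u)).
    by rewrite ler_pM2l// invr_gt0 mulr_gt0.
  have -> : (2 * Num.sqrt (V u))^-1 * (- k * Num.sqrt (V u)) = - (k / 2).
    by field; rewrite gt_eqF.
  lra.
have h1 : k * (2 * Num.sqrt (V 0) / k + 1) = 2 * Num.sqrt (V 0) + k.
  by field; rewrite gt_eqF.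
have : k * (2 * Num.sqrt (V 0) / k + 1) <= k * t by rewrite ler_pM2l.
rewrite h1; have := sqrtr_ge0 (V t); lra.
Qed.

(** [V] is the sum of squared deviations. The derivative of the mean drops out of [V'] because the
    deviations sum to zero, so dissipation of the largest difference is all that is required. *)
Lemma finite_time_consensus (N : nat) (a : 'I_N -> R -> R) (k : R) :
  (0 < N)%N -> 0 < k -> (forall i (T : R), 0 < T -> ac 0 T (a i)) ->
  {ae (@lebesgue_measure R), forall t : R, 0 <= t -> exists2 da : 'I_N -> R,
     (forall i, is_derive t 1 (a i) (da i)) &
     forall p q, (forall i j, `|a i t - a j t| <= `|a p t - a q t|) ->
       \sum_i (a i t - mean (a^~ t)) * da i <= - k * `|a p t - a q t|} ->
  exists2 T0 : R, 0 < T0 & forall t, T0 <= t -> forall i, a i t = mean (a^~ t).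
Proof.
move=> N0 k0 aac Hae.
have Np : 0 < N%:R :> R by rewrite ltr0n.
have sN : 0 < Num.sqrt N%:R :> R by rewrite sqrtr_gt0.
pose b i t := a i t - mean (a^~ t).
pose V t := \sum_i b i t * b i t.
have mac T : 0 < T -> ac 0 T (fun t => mean (a^~ t)).
  by move=> T0; apply: acM; [exact: ac_cst|apply: ac_sum => i; exact: aac].
have bac i T : 0 < T -> ac 0 T (b i).
  move=> T0; apply: acD; first exact: aac.
  have := acM (ac_cst 0 T (-1)) (mac T T0).
  by under eq_fun do rewrite mulN1r.
have V0 t : 0 <= V t by apply: sumr_ge0 => i _; rewrite -expr2 sqr_ge0.
(* With [M] the largest difference, [V' <= - 2 * k * M], and [sqrt V <= sqrt N * M] since no
   deviation exceeds [M]. *)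
have kk : 0 < 2 * k / Num.sqrt N%:R by rewrite divr_gt0// mulr_gt0.
have [||T0 T00 VT] := @finite_time_zero V _ kk V0.
- by move=> T T0; apply: ac_sum => i; apply: acM; exact: bac.
- apply: (@filterS _ _ (ae_filter_ringOfSetsType (@lebesgue_measure R))) Hae.
  move=> t Ht t0; have [da dE dle] := Ht t0.
  have md : is_derive t 1 (fun t => mean (a^~ t)) (mean da).
    have -> : (fun t => mean (a^~ t)) = N%:R^-1 *: (\sum_i a i).
      by apply/funext => s; rewrite /mean /= fct_sumE.
    exact: is_deriveZ (is_derive_sum dE).
  have bd i : is_derive t 1 (b i) (da i - mean da) by exact: is_deriveB.
  exists (\sum_i (b i t *: (da i - mean da) + b i t *: (da i - mean da))).
    have -> : V = \sum_i (b i * b i).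
      by apply/funext => s; rewrite /V /= fct_sumE.
    by apply: is_derive_sum => i; exact: is_deriveM.
  have -> : \sum_i (b i t *: (da i - mean da) + b i t *: (da i - mean da)) =
      2 * \sum_i b i t * da i.
    transitivity (2 * (\sum_i b i t * da i) - 2 * mean da * \sum_i b i t).
      rewrite !mulr_sumr -sumrB; apply: eq_bigr => i _.
      by rewrite -![_ *: _]/(_ * _); ring.
    by rewrite [\sum_i b i t]sum_deviation// mulr0 subr0.
  have [[p q] _ pqmax] := @arg_maxP _ _ _ (Ordinal N0, Ordinal N0) xpredT
    (fun pq : 'I_N * 'I_N => `|a pq.1 t - a pq.2 t|) isT.
  have pqM i j : `|a i t - a j t| <= `|a p t - a q t| by exact: (pqmax (i, j)).
  have := dle p q pqM; set M := `|a p t - a q t| => dM.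
  have VM : Num.sqrt (V t) <= Num.sqrt N%:R * M.
    have M0 : 0 <= M by exact: normr_ge0.
    rewrite -[M]ger0_norm// -sqrtr_sqr -sqrtrM ?ler0n//.
    apply: ler_wsqrtr; rewrite /V mulr_natl.
    have -> : M ^+ 2 *+ N = \sum_(i < N) M ^+ 2 by rewrite sumr_const card_ord.
    apply: ler_sum => i _; rewrite -expr2 -real_normK ?num_real//.
    rewrite ler_pXn2r ?nnegrE//; exact: deviation_le.
  have : 2 * k / Num.sqrt N%:R * Num.sqrt (V t) <= 2 * k * M.
    have VM' : Num.sqrt (V t) / Num.sqrt N%:R <= M by rewrite ler_pdivrMr// mulrC.
    have -> : 2 * k / Num.sqrt N%:R * Num.sqrt (V t) = 2 * k * (Num.sqrt (V t) / Num.sqrt N%:R).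
      by rewrite -[LHS]mulrA [_^-1 * _]mulrC.
    by apply: ler_wpM2l => //; rewrite mulr_ge0// ltW.
  lra.
exists T0 => // t /VT/eqP Vt i; move: Vt; rewrite psumr_eq0; last first.
  by move=> j _; rewrite -expr2 sqr_ge0.
move=> /allP/(_ i (mem_index_enum _))/=; rewrite mulf_eq0 orbb subr_eq0.
by move=> /eqP.
Qed.

End AbsoluteContinuityClosure.

(** * The gap function and variational inequalities *)

Section Compactness.
Context {R : realType}.

(** Replaces extraction of subsequences: a single cluster point passes every continuous test whose
    values along the sequence are at most of order [1 / (n + 1)]. *)
Lemma compact_limit d (K : set 'cV[R]_d) (u : nat -> 'cV[R]_d) :
  compact K -> (forall n, K (u n)) ->
  exists2 v, K v & forall (f : 'cV[R]_d -> R) (C : R), continuous f ->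
    (forall n, f (u n) <= C * n.+1%:R^-1) -> f v <= 0.
Proof.
move=> Kco Ku.
have FK : (u @ \oo) K by exists 0%N => // n _; exact: Ku.
have [v [Kv cv]] := Kco (u @ \oo) _ FK.
exists v => // f C fc fu; apply/ler_addgt0Pr => e e0; rewrite add0r.
have e2 : 0 < e / 2 by rewrite divr_gt0.
have /(@cvgrPdist_lt _ _ _ (nbhs v))/(_ (e / 2) e2) fv := fc v.
have [n0 _ Hn0] : \forall n \near \oo, `|C| * n.+1%:R^-1 < e / 2.
  have /cvgrPdist_lt/(_ (e / 2) e2) : `|C| * n.+1%:R^-1 @[n --> \oo] --> (0 : R).
    by rewrite -[X in _ --> X](mulr0 `|C|); apply: cvgMr; exact: cvg_harmonic.
  apply: filterS => n; rewrite sub0r normrN; apply: le_lt_trans; exact: ler_norm.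
have [w [[n /= n0n <-] fw]] := cv (u @` [set n | (n0 <= n)%N]) _
  (ex_intro2 _ _ n0 I (fun n H => ex_intro2 _ _ n H erefl)) fv.
have := Hn0 n n0n; have := fu n; have := fw.
rewrite ltr_norml => /andP[_ h1] h2 h3.
have : C * n.+1%:R^-1 <= `|C| * n.+1%:R^-1 by rewrite ler_wpM2r ?invr_ge0// ler_norm.
by move: h1 h2 h3; move: (C / _) (`|C| / _) (f (u n)) (f v) => p q r s *; lra.
Qed.

Lemma compact_enorm_bounded d (K : set 'cV[R]_d) : compact K ->
  exists2 M : R, 0 < M & forall u, K u -> enorm u <= M.
Proof.
move=> Kco; have [[w Kw]|K0] := pselect (K !=set0); last first.
  by exists 1 => // u Ku; case: K0; exists u.
have fc : continuous (fun u : 'cV[R]_d => - enorm u).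
  by move=> u; apply: (@cvgN _ _ _ (nbhs u)); exact: enorm_continuous.
have [y Ky yP] := compact_minimum (ex_intro _ w Kw) Kco fc.
exists (enorm y + 1); first by rewrite ltr_wpDl ?enorm_ge0.
by move=> u /yP; rewrite lerN2 => /le_trans; apply; rewrite lerDl.
Qed.

Lemma compact_closed_cV d (K : set 'cV[R]_d) : compact K -> closed K.
Proof. by apply: compact_closed; exact: norm_hausdorff. Qed.

(** The distance to [C] is 1-Lipschitz, even where [proj] merely selects one of several nearest
    points; this suits the set of equilibria. *)
Lemma dist_proj_continuous d (C : set 'cV[R]_d) : closed C -> C !=set0 ->
  continuous (fun w : 'cV[R]_d => enorm (w - proj C w)).
Proof.
move=> Ccl C0.
have H u v : enorm (u - proj C u) <= enorm (v - proj C v) + enorm (v - u).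
  have [Cv _] := proj_exists v Ccl C0; have [_ /(_ _ Cv)] := proj_exists u Ccl C0.
  move=> /le_trans; apply; move: (proj C v) => p.
  by rewrite [leRHS]addrC (enormBC v u); exact: enorm_triangle.
move=> u; apply/(@cvgrPdist_lt _ _ _ (nbhs u)) => e e0; apply/nbhs_enormP.
exists e => // v vu; have := H u v; have := H v u; rewrite (enormBC u v); move: vu.
move: (enorm (u - _)) (enorm (v - proj C v)) (enorm (v - u)) => p q r h1 h2 h3.
by rewrite ltr_norml; apply/andP; split; lra.
Qed.

End Compactness.

Section MeanValue.
Context {R : realType}.

Lemma mean_value (s t : R) (f df : R -> R) : s <= t ->
  (forall u, s <= u <= t -> is_derive u 1 f (df u)) ->
  exists2 u, s <= u <= t & f t - f s = df u * (t - s).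
Proof.
move=> st fd; have [||u] := @MVT_segment R f df s t st.
- by move=> u; rewrite in_itv/= => /andP[/ltW su /ltW ut]; apply: fd; rewrite su.
- apply: derivable_within_continuous => u; rewrite in_itv/= => /fd.
  by case.
by rewrite in_itv/=; exists u.
Qed.

(** The mean value theorem fails for vector curves; it is applied to the component of [f] along its
    own increment [w]. *)
Lemma curve_lipschitz d (s t L : R) (f df : R -> 'cV[R]_d) : s <= t ->
  (forall u, s <= u <= t -> is_derive u 1 f (df u)) ->
  (forall u, s <= u <= t -> enorm (df u) <= L) ->
  enorm (f t - f s) <= L * (t - s).
Proof.
move=> st fd fL; set w := f t - f s.
have [u ust] := @mean_value s t (fun u => dotv w (f u)) (fun u => dotv w (df u)) st
  (fun u ust => is_derive_eq (is_derive_dotv (is_derive_cst w u 1) (fd u ust))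
     (etrans (congr1 (+%R^~ _) (dotv0l _)) (add0r _))).
have -> : dotv w (f t) - dotv w (f s) = enorm w ^+ 2.
  by rewrite sqr_enorm /w dotvDr dotvNr.
move=> wE; have [->|w0] := eqVneq (enorm w) 0.
  rewrite mulr_ge0 ?subr_ge0//; apply: le_trans (fL s _); first exact: enorm_ge0.
  by rewrite lexx.
have w1 : 0 < enorm w by rewrite lt_neqAle eq_sym w0 enorm_ge0.
rewrite -(ler_pM2l w1) -expr2 wE mulrA ler_wpM2r ?subr_ge0//.
apply: le_trans (dotv_le_enorm _ _) _; apply: ler_wpM2l; first exact: enorm_ge0.
exact: fL.
Qed.

Lemma is_derive_ge0_right (f : R -> R) (df r : R) : is_derive (0 : R) 1 f df -> 0 < r ->
  (forall s : R, 0 <= s <= r -> f 0 <= f s) -> 0 <= df.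
Proof.
move=> /is_deriveP fd r0 fr; rewrite leNgt; apply/negP => df0.
have e0 : 0 < - df / 2 by rewrite divr_gt0// oppr_gt0.
have [dt dt0 H] := fd _ e0.
pose h := Num.min (dt / 2) r.
have h0 : 0 < h by rewrite lt_min r0 divr_gt0.
have hr : h <= r by rewrite ge_min lexx orbT.
have hdt : h < dt by rewrite gt_min ltr_pdivrMr// ltr_pMr// ltr1n.
have := H h; rewrite gtr0_norm// add0r -[h *: df]/(h * df) => /(_ hdt).
have := fr h; rewrite (ltW h0) hr => /(_ isT) fh.
rewrite ler_norml => /andP[_]; have : h * df < 0 by rewrite pmulr_rlt0.
lra.
Qed.

End MeanValue.

Section Gap.
Context {R : realType} {d : nat}.
Variable Omega : set 'cV[R]_d.
Hypotheses (Ocl : closed Omega) (Oconv : @convex_set R 'cV[R]_d Omega)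
  (O0 : Omega !=set0).
Local Notation P := (proj Omega).

(* Fukushima's regularised gap function, g standing for the value at x of the
   map of the variational inequality. *)
Definition gap (x g : 'cV[R]_d) := 2^-1 * dotv g g - half_sqdist Omega (x - g).

Lemma residual_projE (x g p : 'cV[R]_d) : x - g - p = - (g + (p - x)).
Proof. by rewrite opprD opprB addrA (addrC (- g)). Qed.

Lemma gapE x g : let v := P (x - g) - x in
  gap x g = - dotv g v - 2^-1 * dotv v v.
Proof.
move=> v; rewrite /gap /half_sqdist.
have -> : x - g - P (x - g) = - (g + v) by exact: residual_projE.
rewrite dotvNl dotvNr opprK dotvDD; move: (dotv g g) (dotv g v) (dotv v v) => *.
by field.
Qed.

Lemma gap_direction x g : Omega x -> let v := P (x - g) - x in
  dotv v v + dotv g v <= 0.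
Proof.
move=> Ox /=; set v := _ - x; have := proj_vi Ocl Oconv O0 (x - g) Ox.
have -> : x - g - P (x - g) = - (g + v) by exact: residual_projE.
have -> : x - P (x - g) = - v by rewrite opprB.
by rewrite dotvNl dotvNr opprK dotvDl addrC.
Qed.

Lemma gap_ge0 x g : Omega x -> 0 <= gap x g.
Proof.
move=> Ox; rewrite gapE; have /= := gap_direction g Ox.
have := dotv_ge0 (P (x - g) - x).
by move: (dotv _ _) (dotv g _) => *; lra.
Qed.

(** Differentiating the half squared distance suffices, so the formula holds although the projection
    may have no derivative. *)
Lemma is_derive_gap (x g : R -> 'cV[R]_d) (t : R) (dx dg : 'cV[R]_d) :
  is_derive t 1 x dx -> is_derive t 1 g dg ->
  let v := P (x t - g t) - x t in
  is_derive t 1 (fun s => gap (x s) (g s)) (dotv (v + g t) dx - dotv v dg).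
Proof.
move=> xd gd v.
have h1 := is_derive_half_sqdist Ocl Oconv O0 (is_deriveB xd gd).
have h2 := is_derive_dotv gd gd.
apply: is_derive_eq (is_deriveB (is_deriveZ 2^-1 h2) h1) _.
have -> : (x \- g) t - proj Omega ((x \- g) t) = - (g t + v).
  exact: residual_projE.
rewrite -[_ *: _]/(_ * _) (dotvC dg) !(dotvNl, dotvDl, dotvDr, dotvNr).
move: (dotv _ _) (dotv _ _) (dotv _ _) (dotv _ _) => *.
by field.
Qed.

Lemma vi_proj x g : Omega x ->
  (P (x - g) = x <-> forall y, Omega y -> 0 <= dotv g (y - x)).
Proof.
move=> Ox; split=> [Px y Oy|H].
  have := proj_vi Ocl Oconv O0 (x - g) Oy; rewrite Px.
  by rewrite addrAC subrr add0r dotvNl oppr_le0.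
apply: proj_unique => // y Oy.
by rewrite addrAC subrr add0r dotvNl oppr_le0 H.
Qed.

(* The minimiser of the gap function over Omega: the direction towards the
   projection is a descent direction unless it vanishes. *)
Lemma vi_exists (G : 'cV[R]_d -> 'cV[R]_d) (e : R) : compact Omega ->
  continuous G -> 0 < e ->
  (forall x y, Omega x -> Omega y -> exists2 D : 'cV[R]_d,
     is_derive (0 : R) 1 (fun s : R => G (x + s *: (y - x))) D &
     e * dotv (y - x) (y - x) <= dotv D (y - x)) ->
  exists2 x, Omega x & P (x - G x) = x.
Proof.
move=> Oco Gc e0 GD.
have gc : continuous (fun x => gap x (G x)).
  move=> x; rewrite /continuous_at.
  have -> : (fun x => gap x (G x)) = (fun x => - dotv (G x) (P (x - G x) - x)
      - 2^-1 * dotv (P (x - G x) - x) (P (x - G x) - x)).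
    by apply/funext => y; rewrite gapE.
  have vc : P (y - G y) - y @[y --> x] --> P (x - G x) - x.
    apply: (@cvgB _ _ _ (nbhs x)); last exact: cvg_id.
    apply: (@cvg_comp _ _ _ (fun y => y - G y) P (nbhs x) (nbhs (x - G x))).
      by apply: (@cvgB _ _ _ (nbhs x)); [exact: cvg_id|exact: Gc].
    exact: proj_continuous.
  rewrite gapE; apply: (@cvgB _ _ _ (nbhs x)).
    by apply: (@cvgN _ _ _ (nbhs x)); apply: dotv_continuous => //; exact: Gc.
  apply: (@cvgM _ _ (nbhs x)); first exact: cvg_cst.
  exact: dotv_continuous.
have [x Ox xmin] := compact_minimum O0 Oco gc.
exists x => //; set h := P (x - G x).
have Oh : Omega h by exact: proj_in.
have [D DE De] := GD x h Ox Oh.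
have xd : is_derive (0 : R) 1 (fun s : R => x + s *: (h - x)) (h - x).
  apply/is_deriveP => r r0; exists 1 => // s _.
  rewrite [X in `|X|](_ : _ = 0) ?normr0 ?mulr_ge0// ?ltW//.
  by apply/colP => k; rewrite !mxE; ring.
have := is_derive_gap xd DE; rewrite /= scale0r addr0 -/h => gd.
have := is_derive_ge0_right gd ltr01; rewrite scale0r addr0 => /(_ _) H.
have {}H : 0 <= dotv (h - x + G x) (h - x) - dotv (h - x) D.
  apply: H => s s01; apply: xmin.
  have -> : x + s *: (h - x) = s *: h + (1 - s) *: x.
    by rewrite scalerBr scalerBl scale1r addrCA.
  exact: (convex_setP _).1.
(* Minimality gives [dotv (v + G x) v >= dotv D v] with [v = h - x]; the left side is at most 0 by
   this inequality and the right side is at least [e * |v|^2], so [v = 0]. *)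
have := gap_direction (G x) Ox; rewrite -/h /= => H2.
rewrite dotvDl (dotvC (h - x) D) in H.
apply/eqP; rewrite -subr_eq0; apply/eqP/dotv_eq0/eqP.
rewrite eq_le dotv_ge0 andbT -(pmulr_rle0 _ e0).
move: H H2 De; move: (dotv _ _) (dotv _ _) (dotv _ _) => *; lra.
Qed.

End Gap.

(** * Equilibria under a linear constraint *)

Section ConstrainedVI.
Context {R : realType} {d l : nat}.
Variables (Omega : set 'cV[R]_d) (F : 'cV[R]_d -> 'cV[R]_d)
  (A : 'M[R]_(l, d)) (b : 'cV[R]_l) (c : R).
Hypotheses (Oco : compact Omega) (Oconv : @convex_set R 'cV[R]_d Omega)
  (Fdiff : forall x, differentiable F x)
  (Fmono : strictly_monotone_on Omega F) (c0 : 0 < c).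
Local Notation P := (proj Omega).

Let Ocl : closed Omega := compact_closed_cV Oco.

Definition vi_equilibria : set 'cV[R]_(d + l) :=
  [set w | let x := usubmx w in let lam := dsubmx w in
     0 = P (x - F x - c *: (A^T *m lam)) - x /\ 0 = c *: (A *m x - b)].

Lemma F_continuous : continuous F.
Proof. by move=> x; exact: differentiable_continuous. Qed.

Lemma is_derive_comp_diff (V : normedModType R) (f : 'cV[R]_d -> V)
    (x : R -> 'cV[R]_d) (t : R) (dx : 'cV[R]_d) :
  differentiable f (x t) -> is_derive t 1 x dx ->
  is_derive t 1 (f \o x) ('d f (x t) dx).
Proof.
move=> fd [xd xE]; have xdiff : differentiable x t by apply/derivable1_diffP.
have fxdiff : differentiable (f \o x) t by exact: differentiable_comp.
split; first exact/derivable1_diffP.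
by rewrite deriveE// diff_comp//= -xE deriveE.
Qed.

Lemma is_derive_line (x v : 'cV[R]_d) (t : R) :
  is_derive t 1 (fun s : R => x + s *: v) v.
Proof.
apply/is_deriveP => r r0; exists 1 => // s _.
rewrite [X in `|X|](_ : _ = 0) ?normr0 ?mulr_ge0// ?ltW//.
by apply/colP => k; rewrite !mxE; ring.
Qed.

Lemma monotone_ge0 x y : Omega x -> Omega y -> 0 <= dotv (x - y) (F x - F y).
Proof.
move=> Ox Oy; have [->|/eqP xy] := eqVneq x y; first by rewrite subrr dotv0l.
exact/ltW/Fmono.
Qed.

(** Monotonicity is known only on [Omega], so the differential is tested only along segments of
    [Omega]: [dotv (F (x + s v)) v] is smallest at [s = 0]. *)
Lemma monotone_diff_ge0 x y : Omega x -> Omega y ->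
  0 <= dotv ('d F x (y - x)) (y - x).
Proof.
move=> Ox Oy; set v := y - x.
have Fd : is_derive (0 : R) 1 (F \o (fun s : R => x + s *: v)) ('d F x v).
  have := @is_derive_comp_diff _ F (fun s : R => x + s *: v) 0 v.
  by rewrite scale0r addr0; apply => //; exact: is_derive_line.
have := is_derive_dotv Fd (is_derive_cst v (0 : R) 1).
rewrite dotv0r addr0 => H; apply: (is_derive_ge0_right H ltr01) => s /andP[s0 s1].
rewrite /= scale0r addr0.
have [->|sn0] := eqVneq s 0; first by rewrite scale0r addr0.
have Ox' : Omega (x + s *: v).
  have -> : x + s *: v = s *: y + (1 - s) *: x.
    by rewrite scalerBr scalerBl scale1r addrCA.
  by apply: (convex_setP _).1 => //; rewrite s0.
have := monotone_ge0 Ox' Ox.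
rewrite addrAC subrr add0r dotvZl pmulr_rge0 ?lt_neqAle ?s0 ?andbT 1?eq_sym//.
by rewrite dotvC dotvDl dotvNl subr_ge0.
Qed.

Lemma equilibriumP (w : 'cV[R]_(d + l)) : Omega !=set0 ->
  let x := usubmx w in let lam := dsubmx w in
  vi_equilibria w <->
  [/\ Omega x, A *m x = b &
    forall y, Omega y -> 0 <= dotv (F x + c *: (A^T *m lam)) (y - x)].
Proof.
move=> O0 x lam.
have E : x - F x - c *: (A^T *m lam) = x - (F x + c *: (A^T *m lam)).
  by rewrite opprD addrA.
split=> [[/esym/eqP h1 /esym/eqP h2]|[Ox Axb H]].
  rewrite subr_eq0 in h1; move/eqP: h1; rewrite -/x -/lam E => h1.
  have Ox : Omega x by rewrite -h1; exact: proj_in.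
  split => //; last exact: (vi_proj Ocl Oconv O0 _ Ox).1.
  by move: h2; rewrite scaler_eq0 gt_eqF//= subr_eq0 => /eqP.
split; last by rewrite -/x Axb subrr scaler0.
rewrite -/x -/lam E (vi_proj Ocl Oconv O0 _ Ox).2//.
by rewrite subrr.
Qed.

Let primal (w : 'cV[R]_(d + l)) := F (usubmx w) + c *: (A^T *m dsubmx w).

Lemma primal_continuous : continuous primal.
Proof.
move=> w; have uw := @usubmx_continuous R d l w; have dw := @dsubmx_continuous R d l w.
apply: (@cvgD _ _ _ (nbhs w)).
  exact: (@cvg_comp _ _ _ usubmx F _ _ _ uw (@F_continuous (usubmx w))).
by apply: cvgZ; [exact: cvg_cst|exact: mulmx_cvg].
Qed.

(** A continuous function vanishing exactly at the equilibria. It gives their closedness and, along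
    the flow, equals the norm of [x'] plus that of [lambda']. *)
Definition vi_residual (w : 'cV[R]_(d + l)) : R :=
  let x := usubmx w in let lam := dsubmx w in
  enorm (P (x - F x - c *: (A^T *m lam)) - x) + enorm (c *: (A *m x - b)).

Lemma vi_residual_continuous : Omega !=set0 -> continuous vi_residual.
Proof.
move=> O0 w; have uw := @usubmx_continuous R d l w; have dw := @dsubmx_continuous R d l w.
have Fw : F (usubmx v) @[v --> w] --> F (usubmx w).
  exact: (@cvg_comp _ _ _ usubmx F _ _ _ uw (@F_continuous (usubmx w))).
apply: (@cvgD _ _ _ (nbhs w)).
  apply: (@enorm_cvg R _ (nbhs w) _ d
    (fun v => P (usubmx v - F (usubmx v) - c *: (A^T *m dsubmx v)) - usubmx v)).
  apply: (@cvgB _ _ _ (nbhs w)) => //.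
  apply: (@cvg_comp _ _ _ (fun v => usubmx v - F (usubmx v) - c *: (A^T *m dsubmx v)) P
    (nbhs w) (nbhs (usubmx w - F (usubmx w) - c *: (A^T *m dsubmx w)))).
    apply: (@cvgB _ _ _ (nbhs w)); first exact: (@cvgB _ _ _ (nbhs w)).
    by apply: cvgZ; [exact: cvg_cst|exact: mulmx_cvg].
  exact: proj_continuous.
apply: (@enorm_cvg R _ (nbhs w) _ l (fun v => c *: (A *m usubmx v - b))).
apply: cvgZ; first exact: cvg_cst.
by apply: (@cvgB _ _ _ (nbhs w)); [exact: mulmx_cvg|exact: cvg_cst].
Qed.

Lemma vi_residual_eq0 w : vi_residual w = 0 <-> vi_equilibria w.
Proof.
rewrite /vi_residual; split=> [/eqP|[<- <-]]; last by rewrite !enorm0 addr0.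
rewrite paddr_eq0 ?enorm_ge0// => /andP[/eqP/enorm_eq0 h1 /eqP/enorm_eq0 h2].
by split.
Qed.

Lemma equilibria_closed : Omega !=set0 -> closed vi_equilibria.
Proof.
move=> O0; have -> : vi_equilibria = vi_residual @^-1` [set r | r = 0].
  by apply/seteqP; split => w /vi_residual_eq0.
apply: preimage_closed => [w _|]; last exact: closed_eq.
exact: vi_residual_continuous.
Qed.

Hypothesis qualification :
  rint [set z1 - z2 | z1 in Omega & z2 in [set x | A *m x = b]] 0.

Lemma qualification_feasible : exists2 x, Omega x & A *m x = b.
Proof.
have [z1 Oz1 [z2 z2b /eqP]] := qualification.1.
by rewrite subr_eq0 => /eqP z12; exists z1 => //; rewrite z12.
Qed.

(* Every residual A y - b can be reversed by moving inside Omega, up to a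
   positive factor: this is what the constraint qualification provides. *)
Lemma qualification_reverse y : Omega y ->
  exists2 s, 0 < s & exists2 z, Omega z & A *m z - b = - s *: (A *m y - b).
Proof.
move=> Oy; have [x Ox Axb] := qualification_feasible.
have [_ [e e0 He]] := qualification.
pose v := y - x; pose s := e / (2 * (enorm v + 1)).
have v1 : 0 < enorm v + 1 by rewrite ltr_wpDl ?enorm_ge0.
have s0 : 0 < s by rewrite divr_gt0// mulr_gt0.
exists s => //.
have [|z1 Oz1 [z2 z2b z12]] := He (- s *: v).
  split; rewrite /=.
    rewrite subr0 enormZ normrN gtr0_norm//.
    have : s * (enorm v + 1) = e / 2 by rewrite /s; field; rewrite gt_eqF.
    have := enorm_ge0 v; have : 0 <= s * 1 by rewrite mulr1 ltW.
    lra.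
  move=> S [Saff SD].
  (* Affine combinations allow the negative coefficient [- s], so the affine hull contains the
     reversed point; the relative interior then puts it in the difference set. *)
  have -> : - s *: v = - s *: v + (1 - - s) *: 0 by rewrite scaler0 addr0.
  apply: Saff; apply: SD.
    by exists y => //; exists x.
  by exists x => //; exists x => //; rewrite subrr.
exists z1 => //; have : A *m (z1 - z2) = A *m (- s *: v) by rewrite z12.
rewrite mulmxBr z2b => ->; rewrite -scalemxAr /v mulmxBr Axb//.
Qed.

(** A functional of constant sign on the residuals must vanish on them, because every residual can
    be reversed. *)
Lemma qualification_orthogonal mu :
  (forall y, Omega y -> 0 <= dotv mu (A *m y - b)) ->
  forall y, Omega y -> dotv mu (A *m y - b) = 0.
Proof.
move=> H y Oy; have [s s0 [z Oz zE]] := qualification_reverse Oy.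
have := H z Oz; rewrite zE dotvZr mulNr oppr_ge0 pmulr_rle0// => h.
by apply/eqP; rewrite eq_le h H.
Qed.

(* Solutions of the penalised problem, the penalty c * (c / e) of the constraint
   producing the multiplier lam; the qualification bounds lam as e tends to 0. *)
Lemma regularised_equilibrium (e : R) : 0 < e ->
  exists2 x, Omega x & let lam := (c / e) *: (A *m x - b) in
    forall y, Omega y ->
      0 <= dotv (F x + e *: x + c *: (A^T *m lam)) (y - x).
Proof.
move=> e0; have [x0 Ox0 _] := qualification_feasible.
have O0 : Omega !=set0 by exists x0.
pose G x := F x + e *: x + c *: (A^T *m ((c / e) *: (A *m x - b))).
pose L (x : 'cV[R]_d) : 'cV[R]_d := A^T *m (A *m x).
have GE x : G x = F x + e *: x + (c * (c / e)) *: (L x - A^T *m b).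
  by rewrite /G -scalemxAr scalerA mulmxBr.
have Gc : continuous G.
  move=> x; rewrite /continuous_at (_ : G = fun x => F x + e *: x + (c * (c / e)) *: (L x - A^T *m b)); last first.
    by apply/funext => y; exact: GE.
  apply: (@cvgD _ _ _ (nbhs x)).
    apply: (@cvgD _ _ _ (nbhs x)); first exact: F_continuous.
    by apply: (@cvgZ _ _ _ (nbhs x)); [exact: cvg_cst|exact: cvg_id].
  apply: (@cvgZ _ _ _ (nbhs x)); first exact: cvg_cst.
  apply: (@cvgB _ _ _ (nbhs x)); last exact: cvg_cst.
  by do 2 apply: (@mulmx_cvg _ _ (nbhs x)); exact: cvg_id.
have [|x Ox xP] := @vi_exists R d Omega Ocl Oconv O0 G e Oco Gc e0.
  move=> x y Ox Oy; set v := y - x.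
  have ld := is_derive_line x v 0.
  have Fd : is_derive (0 : R) 1 (fun s : R => F (x + s *: v)) ('d F x v).
    have := @is_derive_comp_diff _ F (fun s : R => x + s *: v) 0 v.
    by rewrite scale0r addr0; apply => //; exact: is_derive_line.
  exists ('d F x v + e *: v + (c * (c / e)) *: (L v)).
    have -> : (fun s : R => G (x + s *: v)) = (fun s => F (x + s *: v) +
       e *: (x + s *: v) + (c * (c / e)) *: (L (x + s *: v) - A^T *m b)).
      by apply/funext => s; exact: GE.
    have h1 := is_derive_mulmx A^T (is_derive_mulmx A ld).
    have h2 := is_deriveB h1 (is_derive_cst (A^T *m b) (0 : R) 1).
    have := is_deriveD (is_deriveD Fd (is_deriveZ e ld)) (is_deriveZ (c * (c / e)) h2).
    by rewrite subr0.
  have h1 := monotone_diff_ge0 Ox Oy; rewrite -/v in h1.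
  have h2 : 0 <= c * (c / e) * dotv (L v) v.
    by rewrite /L dotv_trmx mulr_ge0// ?dotv_ge0// mulr_ge0 ?divr_ge0 ?ltW.
  clearbody v; rewrite dotvDl [dotv (_ *: L v) v]dotvZl dotvDl [dotv (e *: v) v]dotvZl.
  by rewrite addrAC lerDr addr_ge0.
exists x => //= y Oy; exact: (vi_proj Ocl Oconv O0 _ Ox).1.
Qed.

(** Limit of the regularised problems with [e = 1 / (n + 1)]. The crux is that the multipliers
    [ls n] stay bounded: otherwise a limit of their normalisations contradicts the qualification. *)
Lemma equilibrium_exists : vi_equilibria !=set0.
Proof.
have [x0 Ox0 Ax0] := qualification_feasible.
have O0 : Omega !=set0 by exists x0.
have en (n : nat) : 0 < (n.+1%:R^-1 : R) by rewrite invr_gt0.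
have {}en (n : nat) := regularised_equilibrium (en n).
pose xs n := s2val (cid2 (en n)).
have Oxs n : Omega (xs n) by exact: s2valP (cid2 (en n)).
pose ls n := (c / n.+1%:R^-1) *: (A *m xs n - b).
have VI n y : Omega y ->
    0 <= dotv (F (xs n) + n.+1%:R^-1 *: xs n + c *: (A^T *m ls n)) (y - xs n).
  exact: (s2valP' (cid2 (en n))).
clearbody xs; clear en.
have [M M0 OM] := compact_enorm_bounded Oco.
have [M' M'0 FM] : exists2 M' : R, 0 < M' & forall x, Omega x -> enorm (F x) <= M'.
  have [M' M'0 H] : exists2 M' : R, 0 < M' & forall u, (F @` Omega) u -> enorm u <= M'.
    apply: compact_enorm_bounded; apply: continuous_compact => //.
    by apply: continuous_subspaceT; exact: F_continuous.
  by exists M' => // x Ox; apply: H; exists x.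
(* Bounds, uniformly in [n], the part of the variational inequality free of the multiplier: [e <= 1]
   and the diameter of [Omega] is at most [2 * M]. *)
pose C := (M' + M) * (2 * M).
have C0 : 0 < C by rewrite mulr_gt0 ?addr_gt0// mulr_gt0.
have inv1 n : n.+1%:R^-1 <= (1 : R) by rewrite invf_le1// ler1n.
have bnd x y : Omega x -> Omega y -> enorm (y - x) <= 2 * M.
  move=> Ox Oy; apply: le_trans (enormD _ _) _; rewrite enormN.
  have := OM _ Ox; have := OM _ Oy; lra.
have lq n y : Omega y -> - C <= c * dotv (ls n) (A *m y - b).
  move=> Oy; have := VI n y Oy; rewrite dotvDl dotvZl dotv_trmx mulmxBr => h.
  have h1 : dotv (F (xs n) + n.+1%:R^-1 *: xs n) (y - xs n) <= C.
    apply: le_trans (dotv_le_enorm _ _) _; apply: ler_pM; rewrite ?enorm_ge0 ?bnd//.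
    apply: le_trans (enormD _ _) _; apply: lerD; first exact: FM.
    rewrite enormZ gtr0_norm ?invr_gt0//.
    rewrite -[leRHS]mul1r; apply: ler_pM => //; rewrite ?enorm_ge0 ?invr_ge0//.
    exact: OM.
  have h2 : 0 <= dotv (ls n) (A *m xs n - b).
    rewrite /ls dotvZl mulr_ge0 ?dotv_ge0// divr_ge0 ?ltW// invr_gt0//.
  have h3 : dotv (ls n) (A *m y - A *m xs n) =
      dotv (ls n) (A *m y - b) - dotv (ls n) (A *m xs n - b).
    by rewrite !dotvDr !dotvNr; ring.
  have h4 : 0 <= c * dotv (ls n) (A *m xs n - b) by rewrite mulr_ge0// ltW.
  rewrite h3 in h; lra.
have lU n u : (forall y, Omega y -> dotv u (A *m y - b) = 0) -> dotv u (ls n) = 0.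
  by move=> H; rewrite /ls dotvZr H// mulr0.
have [B B0 lB] : exists2 B : R, 0 < B & forall n, enorm (ls n) <= B.
  apply: contrapT => noB.
  have big (k : nat) : exists n, k.+1%:R < enorm (ls n).
    apply: contrapT => H; apply: noB; exists k.+1%:R; first by rewrite ltr0n.
    by move=> n; rewrite leNgt; apply/negP => ?; apply: H; exists n.
  pose nk k := sval (cid (big k)).
  have nkP k : k.+1%:R < enorm (ls (nk k)) by exact: svalP (cid (big k)).
  pose mu k := (enorm (ls (nk k)))^-1 *: ls (nk k).
  have lp k : 0 < enorm (ls (nk k)) by apply: le_lt_trans (nkP k); rewrite ler0n.
  have mu1 k : enorm (mu k) = 1.
    by rewrite /mu enormZ gtr0_norm ?invr_gt0// mulVf// gt_eqF.
  pose K := [set u : 'cV[R]_l | enorm u = 1].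
  have Kco : compact K.
    apply: (@bounded_closed_compact_cV _ _ _ 1); first by move=> u ->.
    apply: (@preimage_closed _ _ (@enorm R l) [set r | r = 1]).
      by move=> u _; exact: enorm_continuous.
    exact: closed_eq.
  have [v Kv Hv] := compact_limit Kco mu1.
  have v0 y : Omega y -> 0 <= dotv v (A *m y - b).
    move=> Oy; rewrite -oppr_le0.
    apply: (Hv (fun v => - dotv v (A *m y - b)) (C / c)).
      move=> u; apply: (@cvgN _ _ _ (nbhs u)); apply: dotv_continuous.
        exact: cvg_id.
      exact: cvg_cst.
    move=> k; rewrite /mu dotvZl -mulrN.
    have h1 : - dotv (ls (nk k)) (A *m y - b) <= C / c.
      by rewrite ler_pdivlMr// mulrC mulrN lerNl; exact: lq.
    rewrite mulrC.
    apply: (@le_trans _ _ (C / c * (enorm (ls (nk k)))^-1)).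
      by rewrite ler_wpM2r// invr_ge0 ltW.
    rewrite ler_wpM2l//; first by rewrite divr_ge0// ltW.
    by rewrite lef_pV2 ?posrE//; exact: ltW.
  have vq := qualification_orthogonal v0.
  (* [v] annihilates all residuals, hence every [ls n], a multiple of a residual; the limit [v] is
     then orthogonal to itself, against [enorm v = 1]. *)
  have : dotv v v <= 0.
    apply: (Hv (fun w => dotv v w) 0).
      by move=> u; apply: (@dotv_continuous R _ (nbhs u) _ l (fun=> v) id); [exact: cvg_cst|exact: cvg_id].
    by move=> k; rewrite mul0r /mu dotvZr lU// mulr0.
  by rewrite -sqr_enorm Kv expr1n ler10.
pose w n : 'cV[R]_(d + l) := col_mx (xs n) (ls n).
have wu n : usubmx (w n) = xs n by rewrite col_mxKu.
have wd n : dsubmx (w n) = ls n by rewrite col_mxKd.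
pose K := [set v : 'cV[R]_(d + l) | enorm v <= M + B].
have Kco : compact K.
  apply: (@bounded_closed_compact_cV _ _ _ (M + B)) => //.
  apply: (@preimage_closed _ _ (@enorm R (d + l)) [set r | r <= M + B]).
    by move=> u _; exact: enorm_continuous.
  exact: closed_le.
have Kw n : K (w n).
  by apply: le_trans (enorm_col_mx_le _ _) _; apply: lerD; [exact: OM|exact: lB].
have [v _ Hv] := compact_limit Kco Kw.
have uc := @usubmx_continuous R d l.
exists v; apply/equilibriumP => //; split.
- have : enorm (usubmx v - P (usubmx v)) <= 0.
    apply: (Hv (fun v => enorm (usubmx v - P (usubmx v))) 0).
      move=> u; apply: (@enorm_cvg R _ (nbhs u) _ d (fun v => usubmx v - P (usubmx v))).
      apply: (@cvgB _ _ _ (nbhs u)); first exact: uc.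
      exact: (@cvg_comp _ _ _ usubmx P _ _ _ (uc u) (@proj_continuous R d Omega Ocl Oconv O0 (usubmx u))).
    move=> n; rewrite wu mul0r (_ : P (xs n) = xs n) ?subrr ?enorm0//.
    by apply: proj_unique => // y _; rewrite subrr dotv0l.
  move=> h; have /enorm_eq0/eqP : enorm (usubmx v - P (usubmx v)) = 0.
    by apply/eqP; rewrite eq_le h enorm_ge0.
  by rewrite subr_eq0 => /eqP ->; exact: proj_in.
- have : enorm (A *m usubmx v - b) <= 0.
    apply: (Hv (fun v => enorm (A *m usubmx v - b)) (B / c)).
      move=> u; apply: (@enorm_cvg R _ (nbhs u) _ l (fun v => A *m usubmx v - b)).
      apply: (@cvgB _ _ _ (nbhs u)); last exact: cvg_cst.
      by apply: mulmx_cvg; exact: uc.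
    move=> n; rewrite wu.
    (* The definition of the multiplier read backwards: boundedness of [ls] forces the residual to
       0. *)
    have -> : A *m xs n - b = (c^-1 * n.+1%:R^-1) *: ls n.
      rewrite /ls scalerA invrK mulrACA mulVf ?gt_eqF// mulVf ?pnatr_eq0//.
      by rewrite mulr1 scale1r.
    have e0 : 0 < c^-1 * n.+1%:R^-1 :> R by rewrite mulr_gt0// invr_gt0.
    rewrite enormZ gtr0_norm// mulrC mulrA; apply: ler_wpM2r; first by rewrite invr_ge0.
    by apply: ler_wpM2r => //; rewrite invr_ge0 ltW.
  move=> h; have /enorm_eq0/eqP : enorm (A *m usubmx v - b) = 0.
    by apply/eqP; rewrite eq_le h enorm_ge0.
  by rewrite subr_eq0 => /eqP.
- move=> y Oy; rewrite -oppr_le0.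
  apply: (Hv (fun v => - dotv (primal v) (y - usubmx v)) (M * (2 * M))).
    move=> u; apply: (@cvgN _ _ _ (nbhs u)); apply: dotv_continuous.
      exact: primal_continuous.
    by apply: (@cvgB _ _ _ (nbhs u)); [exact: cvg_cst|exact: uc].
  move=> n; rewrite /primal wu wd; have := VI n y Oy.
  rewrite [F (xs n) + _ + _]addrAC [dotv (_ + n.+1%:R^-1 *: _) _]dotvDl.
  rewrite [dotv (n.+1%:R^-1 *: _) _]dotvZl.
  have h : n.+1%:R^-1 * dotv (xs n) (y - xs n) <= M * (2 * M) * n.+1%:R^-1.
    rewrite mulrC; apply: ler_wpM2r; first by rewrite invr_ge0.
    apply: le_trans (dotv_le_enorm _ _) _.
    by apply: ler_pM; rewrite ?enorm_ge0 ?bnd// OM.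
  move: (n.+1%:R^-1 * dotv (xs n) (y - xs n)) (M * (2 * M) / n.+1%:R) h => p q h.
  by move: (dotv _ _) => z *; lra.
Qed.

End ConstrainedVI.

(** * Convergence of the projected primal-dual flow *)

Lemma subrACA (V : zmodType) (x y z t : V) : x - y - (z - t) = x - z - (y - t).
Proof. by rewrite !opprD addrACA. Qed.

Lemma coordB_le_enorm (R : realType) d (u w : 'cV[R]_d) k :
  `|u k 0 - w k 0| <= enorm (u - w).
Proof. by have := coord_le_enorm (u - w) k; rewrite !mxE. Qed.

Section PrimalDual.
Context {R : realType} {d l : nat}.
Variables (Omega : set 'cV[R]_d) (F : 'cV[R]_d -> 'cV[R]_d)
  (A : 'M[R]_(l, d)) (b : 'cV[R]_l) (c : R).
Hypotheses (Oco : compact Omega) (Oconv : @convex_set R 'cV[R]_d Omega)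
  (Fdiff : forall x, differentiable F x)
  (Fmono : strictly_monotone_on Omega F) (c0 : 0 < c)
  (qualification :
    rint [set z1 - z2 | z1 in Omega & z2 in [set x | A *m x = b]] 0).
Variables (x : R -> 'cV[R]_d) (lam : R -> 'cV[R]_l) (T0 : R).
Local Notation P := (proj Omega).
Local Notation E := (vi_equilibria Omega F A b c).
Hypotheses (x_in : forall t, T0 <= t -> Omega (x t))
  (x_flow : forall t : R, T0 <= t ->
     is_derive t 1 x (P (x t - F (x t) - c *: (A^T *m lam t)) - x t))
  (lam_flow : forall t : R, T0 <= t -> is_derive t 1 lam (c *: (A *m x t - b))).

Let Ocl : closed Omega := compact_closed_cV Oco.
Let O0 : Omega !=set0 := ex_intro _ _ (x_in (lexx T0)).

Let g t := F (x t) + c *: (A^T *m lam t).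
Let v t := P (x t - g t) - x t.
Let r t := c *: (A *m x t - b).

Lemma flow_direction t : T0 <= t -> is_derive t 1 x (v t).
Proof. by move=> /x_flow; rewrite /v /g opprD addrA. Qed.

Lemma is_derive_half_sqr p (u : R -> 'cV[R]_p) (t : R) (du : 'cV[R]_p) :
  is_derive t 1 u du ->
  is_derive t 1 (fun s => 2^-1 * dotv (u s) (u s)) (dotv (u t) du).
Proof.
move=> ud; apply: is_derive_eq (is_deriveZ 2^-1 (is_derive_dotv ud ud)) _.
by rewrite -[_ *: _]/(_ * _) (dotvC du); move: (dotv _ _) => p'; field.
Qed.

Lemma is_derive_g t : T0 <= t ->
  is_derive t 1 g ('d F (x t) (v t) + c *: (A^T *m r t)).
Proof.
move=> Tt; apply: is_deriveD.
  exact: (@is_derive_comp_diff R d 'cV[R]_d F x t (v t) (Fdiff _) (flow_direction Tt)).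
by apply: is_deriveZ; apply: is_derive_mulmx; exact: lam_flow.
Qed.

Lemma is_derive_r t : T0 <= t -> is_derive t 1 r (c *: (A *m v t)).
Proof.
move=> Tt; apply: is_deriveZ.
have := is_deriveB (is_derive_mulmx A (flow_direction Tt)) (is_derive_cst b t 1).
by rewrite subr0.
Qed.

Section Lyapunov.
Variables (xs : 'cV[R]_d) (ls : 'cV[R]_l).
Hypotheses (Oxs : Omega xs) (Axs : A *m xs = b)
  (vi_xs : forall y, Omega y -> 0 <= dotv (F xs + c *: (A^T *m ls)) (y - xs)).

(* The term in r cancels the contribution c A^T r of g' to the derivative of
   the gap. *)
Let V t := gap Omega (x t) (g t) + (2^-1 * dotv (r t) (r t) +
  (2^-1 * dotv (x t - xs) (x t - xs) + 2^-1 * dotv (lam t - ls) (lam t - ls))).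

Let rho y := dotv (y - xs) (F y - F xs).

Let dV t := (dotv (v t + g t) (v t) - dotv (v t) ('d F (x t) (v t) + c *: (A^T *m r t)))
  + (dotv (r t) (c *: (A *m v t)) +
     (dotv (x t - xs) (v t) + dotv (lam t - ls) (r t))).

Lemma is_derive_V t : T0 <= t -> is_derive t 1 V (dV t).
Proof.
move=> Tt; have xd := flow_direction Tt; have ld := lam_flow Tt.
apply: is_deriveD; first exact: (is_derive_gap Ocl Oconv O0 xd (is_derive_g Tt)).
apply: is_deriveD; first exact: (is_derive_half_sqr (is_derive_r Tt)).
apply: is_deriveD; apply: is_derive_half_sqr.
  by have := is_deriveB xd (is_derive_cst xs t 1); rewrite subr0.
by have := is_deriveB ld (is_derive_cst ls t 1); rewrite subr0.
Qed.

(** The projection inequality at [xs] absorbs [|v|^2 + g . v] from the gap and [(x - xs) . v] from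
    the distance, leaving [- g . (x - xs)]. Its multiplier part combines with [(lam - ls) . r] into
    a term in [ls] alone, which the inequality at the equilibrium controls. The term with the
    differential of [F] has the right sign by monotonicity. *)
Lemma dV_le t : T0 <= t -> dV t <= - rho (x t).
Proof.
move=> Tt; have Ox := x_in Tt.
have h1 : dotv (g t + v t) (x t - xs + v t) <= 0.
  have := proj_vi Ocl Oconv O0 (x t - g t) Oxs.
  rewrite residual_projE -/(v t) (_ : xs - _ = - (x t - xs + v t)).
    by rewrite dotvNl dotvNr opprK.
  by apply/colP => k; rewrite /v !mxE; ring.
have h2 : 0 <= dotv ('d F (x t) (v t)) (v t).
  exact: (monotone_diff_ge0 Oconv Fdiff Fmono Ox (proj_in Ocl O0 _)).
have h3 := vi_xs Ox.
have qE : A *m (x t - xs) = A *m x t - b by rewrite mulmxBr Axs.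
have gx : dotv (g t) (x t - xs) = dotv (F (x t)) (x t - xs) + c * dotv (lam t) (A *m x t - b).
  by rewrite /g dotvDl dotvZl dotv_trmx qE.
rewrite dotvDl dotvZl dotv_trmx qE in h3.
rewrite /dV /rho /r; move: h1 h2 h3 gx; clear qE.
move: (A *m x t - b) (x t - xs) (v t) (g t) => q dx w gt.
move: ('d F (x t) w) => Fw.
rewrite !dotvDl !dotvDr !dotvNl !dotvNr !dotvZr.
rewrite (dotvC w (A^T *m _)) dotv_trmx (dotvC w Fw) (dotvC dx w).
rewrite (dotvC dx (F (x t))) (dotvC dx (F xs)) => h1 h2 h3 gx.
rewrite gx in h1; move: h1 h2 h3.
move: (dotv gt w) (dotv w dx) (dotv w w) (dotv Fw w) (dotv (F xs) dx).
by move: (dotv (F (x t)) dx) (dotv (lam t) q) (dotv ls q) (dotv _ (A *m w)) => *; lra.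
Qed.

Lemma rho_ge0 t : T0 <= t -> 0 <= rho (x t).
Proof. by move=> Tt; apply: (monotone_ge0 Fmono) => //; exact: x_in. Qed.

Lemma V_ge t : T0 <= t -> 2^-1 * dotv (lam t - ls) (lam t - ls) <= V t.
Proof.
move=> Tt; rewrite /V; have := gap_ge0 Ocl Oconv O0 (g t) (x_in Tt).
have := dotv_ge0 (r t); have := dotv_ge0 (x t - xs).
move: (gap _ _ _) (dotv (r t) _) (dotv _ _) (dotv (lam t - ls) _) => *; lra.
Qed.

Lemma V_ge0 t : T0 <= t -> 0 <= V t.
Proof.
by move=> /V_ge; apply: le_trans; rewrite mulr_ge0// dotv_ge0.
Qed.

Lemma V_decay delta s t : T0 <= s -> s <= t ->
  (forall u, s <= u <= t -> delta <= rho (x u)) -> V t <= V s - delta * (t - s).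
Proof.
move=> Ts st H; have [|u sut E1] := @mean_value R s t V dV st.
  by move=> u /andP[su _]; apply: is_derive_V; exact: le_trans su.
have /andP[su _] := sut; have := dV_le (le_trans Ts su); have := H u sut.
have ts : 0 <= t - s by rewrite subr_ge0.
move=> h1 h2; have : dV u * (t - s) <= - delta * (t - s).
  by apply: ler_wpM2r => //; apply: le_trans h2 _; rewrite lerN2.
rewrite -E1; lra.
Qed.

Lemma V_mono s t : T0 <= s -> s <= t -> V t <= V s.
Proof.
move=> Ts st; have := @V_decay 0 s t Ts st; rewrite mul0r subr0; apply.
by move=> u /andP[su _]; apply: rho_ge0; exact: le_trans su.
Qed.

Lemma v_bounded : exists2 L : R, 0 < L & forall t, T0 <= t -> enorm (v t) <= L.
Proof.
have [M M0 OM] := compact_enorm_bounded Oco; exists (M + M); first by rewrite addr_gt0.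
move=> t Tt; apply: le_trans (enormD _ _) _; rewrite enormN.
by apply: lerD; apply: OM; [exact: proj_in|exact: x_in].
Qed.

(** Compactness makes strict monotonicity uniform away from [xs]; where no such point exists, any
    [delta] will do. *)
Lemma rho_away (e : R) : 0 < e -> exists2 delta : R, 0 < delta &
  forall y, Omega y -> e <= enorm (y - xs) -> delta <= rho y.
Proof.
move=> e0; pose K := Omega `&` [set y | e <= enorm (y - xs)].
have [[y0 Ky0]|K0] := pselect (K !=set0); last first.
  by exists 1 => // y Oy ye; case: K0; exists y.
have Fc := @F_continuous R d F Fdiff.
have Bc : continuous (fun y : 'cV[R]_d => y - xs).
  by move=> y; apply: (@cvgB _ _ _ (nbhs y)); [exact: cvg_id|exact: cvg_cst].
have Kco : compact K.
  apply: compact_closedI => //.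
  apply: (@preimage_closed _ _ (fun y : 'cV[R]_d => enorm (y - xs)) [set z | e <= z]).
    by move=> y _; apply: (@enorm_cvg R _ (nbhs y) _ d (fun y => y - xs)); exact: Bc.
  exact: closed_ge.
have rc : continuous rho.
  move=> y; apply: (@dotv_continuous R _ (nbhs y) _ d (fun y => y - xs) (fun y => F y - F xs)).
    exact: Bc.
  by apply: (@cvgB _ _ _ (nbhs y)); [exact: Fc|exact: cvg_cst].
have [y [Oy ye] yP] := compact_minimum (ex_intro _ y0 Ky0) Kco rc.
exists (rho y); last by move=> z Oz ze; exact: yP.
apply: Fmono => // yx; move: ye; rewrite /= yx subrr enorm0 leNgt.
by rewrite e0.
Qed.

(** From some time on [V] is within [delta * tau] of its infimum. If [x] were far from [xs] later,
    its bounded speed would keep it away for a time [tau], and [V] would fall below that infimum. *)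
Lemma x_cvg (e : R) : 0 < e ->
  exists2 T : R, T0 <= T & forall t, T <= t -> enorm (x t - xs) < e.
Proof.
move=> e0; have [L L0 vL] := v_bounded.
have e2 : 0 < e / 2 by rewrite divr_gt0.
have [delta d0 Hd] := rho_away e2.
(* At speed at most [L], a point at distance [e] remains at distance [e / 2] during a time [tau]. *)
pose tau := e / (2 * L); have tau0 : 0 < tau by rewrite divr_gt0// mulr_gt0.
pose S := [set V t | t in [set t | T0 <= t]].
have hinf : has_inf S.
  by split; [exists (V T0), T0 => /=|exists 0 => _ [t Tt <-]; exact: V_ge0].
have [_ [T /= TT <-] VT] := inf_adherent (mulr_gt0 d0 tau0) hinf.
exists T => // t Tt; rewrite ltNge; apply/negP => far.
have T0t : T0 <= t := le_trans TT Tt.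
have t1 : t <= t + tau by rewrite lerDl ltW.
have dec : V (t + tau) <= V t - delta * (t + tau - t).
  apply: V_decay => // u /andP[tu ut]; apply: Hd.
    by apply: x_in; exact: le_trans tu.
  have h1 : enorm (x u - x t) <= L * (u - t).
    apply: (@curve_lipschitz R d t u L x v tu).
      by move=> s /andP[ts _]; apply: flow_direction; exact: le_trans ts.
    by move=> s /andP[ts _]; apply: vL; exact: le_trans ts.
  have h2 : L * (u - t) <= L * tau by rewrite ler_pM2l//; lra.
  have h3 : L * tau = e / 2 by rewrite /tau; field; rewrite gt_eqF.
  have := enorm_triangle (x u) (x t) xs; rewrite (enormBC (x t) (x u)).
  move: far h1; move: (enorm _) (enorm _) (enorm _) => *; lra.
have h1 := V_mono TT Tt.
have h2 : inf S <= V (t + tau).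
  apply: ge_inf; first by case: hinf.
  by exists (t + tau) => //=; exact: le_trans t1.
move: dec; have -> : t + tau - t = tau by ring.
move: (V _) (V _) (V _) (inf S) VT h1 h2 => *; lra.
Qed.

Lemma cvg_along p (f : 'cV[R]_d -> 'cV[R]_p) (e : R) : continuous f -> 0 < e ->
  exists2 T : R, T0 <= T & forall t, T <= t -> enorm (f (x t) - f xs) < e.
Proof.
move=> fc e0; have /(@cvg_enormP R _ (nbhs xs))/(_ e e0)/nbhs_enormP := fc xs.
move=> [delta d0 Hd]; have [T TT HT] := x_cvg d0.
by exists T => // t /HT; exact: Hd.
Qed.

Lemma r_cvg (e : R) : 0 < e ->
  exists2 T : R, T0 <= T & forall t, T <= t -> enorm (r t) < e.
Proof.
move=> e0; have [|T TT HT] := @cvg_along l (fun y => c *: (A *m y - b)) e _ e0.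
  move=> y; apply: (@cvgZ _ _ _ (nbhs y)); first exact: cvg_cst.
  by apply: (@cvgB _ _ _ (nbhs y)); [apply: (@mulmx_cvg R _ (nbhs y)); exact: cvg_id|exact: cvg_cst].
by exists T => // t /HT; rewrite Axs subrr scaler0 subr0.
Qed.

(* Barbalat's argument: x converges and v, its derivative, varies little on unit
   intervals, so the mean value theorem makes every coordinate of v small. *)
Lemma v_cvg (e : R) : 0 < e ->
  exists2 T : R, T0 <= T & forall t, T <= t -> enorm (v t) < e.
Proof.
(* A coordinate of [v] is at most its oscillation [7 * h] plus the increment [2 * h] of [x] over
   unit time; the sum over the [d] coordinates remains below [e]. *)
move=> e0; pose h := e / (9 * (d%:R + 1)).
have d1 : 0 < d%:R + 1 :> R by rewrite ltr_wpDl.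
have h0 : 0 < h by rewrite divr_gt0// mulr_gt0.
have [T1 TT1 H1] := x_cvg h0.
have [T2 TT2 H2] := cvg_along (@F_continuous R d F Fdiff) h0.
have [|T3 TT3 H3] := @cvg_along d (fun y => c *: (A^T *m (c *: (A *m y - b)))) h _ h0.
  move=> y; apply: (@cvgZ _ _ _ (nbhs y)); first exact: cvg_cst.
  apply: (@mulmx_cvg R _ (nbhs y)); apply: (@cvgZ _ _ _ (nbhs y)); first exact: cvg_cst.
  by apply: (@cvgB _ _ _ (nbhs y)); [apply: (@mulmx_cvg R _ (nbhs y)); exact: cvg_id|exact: cvg_cst].
pose T := Num.max T1 (Num.max T2 T3).
have TT : T0 <= T by rewrite le_max TT1.
exists T => // t Tt.
have in1 s : t <= s -> [/\ T0 <= s, T1 <= s, T2 <= s & T3 <= s].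
  move=> ts; have : T <= s by exact: le_trans ts.
  rewrite !ge_max => /and3P[s1 s2 s3]; split => //; exact: le_trans s1.
have [t0 t1 t2 t3] := in1 t (lexx t).
have osc s : t <= s -> s <= t + 1 -> enorm (v t - v s) <= 7 * h.
  move=> ts st; have [s0 s1 s2 s3] := in1 s ts.
  have p1 : enorm (c *: (A^T *m lam s) - c *: (A^T *m lam t)) <= h * (s - t).
    apply: (@curve_lipschitz R d t s h (fun u => c *: (A^T *m lam u))
      (fun u => c *: (A^T *m r u)) ts) => u /andP[tu us].
      have [u0 _ _ _] := in1 u tu.
      by apply: is_deriveZ; apply: is_derive_mulmx; exact: lam_flow.
    have [_ _ _ /H3] := in1 u tu; rewrite Axs subrr scaler0 mulmx0 scaler0 subr0.
    exact: ltW.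
  have p2 : h * (s - t) <= h by rewrite ger_pMr//; lra.
  have x1 : enorm (x t - x s) <= h + h.
    apply: le_trans (enorm_triangle xs _ _) _; rewrite (enormBC xs).
    by apply: lerD; apply: ltW; exact: H1.
  have F1 : enorm (F (x t) - F (x s)) <= h + h.
    apply: le_trans (enorm_triangle (F xs) _ _) _; rewrite (enormBC (F xs)).
    by apply: lerD; apply: ltW; exact: H2.
  have g1 : enorm (g t - g s) <= h + h + h.
    rewrite /g opprD addrACA; apply: le_trans (enormD _ _) _; apply: lerD => //.
    by rewrite enormBC (le_trans p1).
  have -> : v t - v s = (P (x t - g t) - P (x s - g s)) - (x t - x s).
    exact: subrACA.
  apply: le_trans (enormD _ _) _; rewrite enormN.
  have := proj_nonexpansive Ocl Oconv O0 (x t - g t) (x s - g s).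
  have -> : x t - g t - (x s - g s) = (x t - x s) - (g t - g s).
    exact: subrACA.
  have := enormD (x t - x s) (- (g t - g s)); rewrite (enormN (g t - g s)).
  move: x1 g1; move: (enorm _) (enorm _) (enorm _) (enorm _) => *; lra.
have coord k : `|v t k 0| <= 9 * h.
  have tt1 : t <= t + 1 by rewrite lerDl.
  have [u /andP[tu ut]] := @mean_value R t (t + 1) (fun s => x s k 0) (fun s => v s k 0) tt1
    (fun s ts => is_derive_coord k (flow_direction (le_trans t0 (andP ts).1))).
  have -> : t + 1 - t = 1 by ring.
  rewrite mulr1 => E1.
  have := coordB_le_enorm (v t) (v u) k.
  have := coordB_le_enorm (x (t + 1)) (x t) k; rewrite E1.
  have x1 : enorm (x (t + 1) - x t) <= h + h.
    apply: le_trans (enorm_triangle xs _ _) _; rewrite (enormBC xs).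
    by have [_ ? _ _] := in1 _ tt1; apply: lerD; apply: ltW; exact: H1.
  have v1 := osc u tu ut; have := ler_normD (v t k 0 - v u k 0) (v u k 0).
  rewrite subrK; move: x1 v1.
  by move: (enorm _) (enorm _) `|_| `|_| `|_| => *; lra.
apply: le_lt_trans (enorm_le_sum _) _.
apply: le_lt_trans (ler_sum _ (fun k _ => coord k)) _.
rewrite sumr_const card_ord -[_ *+ d]mulr_natl.
have -> : e = (d%:R + 1) * (9 * h) by rewrite /h; field; rewrite gt_eqF.
by rewrite ltr_pM2r ?mulr_gt0// ltrDl.
Qed.

Lemma lam_bounded : exists M : R, forall t, T0 <= t -> enorm (lam t) <= M.
Proof.
exists (1 + 2 * V T0 + enorm ls) => t Tt.
have h1 := le_trans (V_ge Tt) (V_mono (lexx T0) Tt).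
have := enormD (lam t - ls) ls; rewrite subrK => /le_trans; apply.
rewrite lerD2r; move: h1; rewrite -sqr_enorm; move: (enorm_ge0 (lam t - ls)).
move: (enorm _) (V T0) => a w a0 h; have := sqr_ge0 (a - 1); rewrite !expr2 in h *.
nra.
Qed.

End Lyapunov.

Theorem primal_dual_convergence :
  enorm (col_mx (x t) (lam t) - proj E (col_mx (x t) (lam t))) @[t --> +oo] --> (0 : R).
Proof.
have [ws ws_E] := equilibrium_exists Oco Oconv Fdiff Fmono c0 qualification.
have [Oxs Axs vi_xs] := (@equilibriumP R d l Omega F A b c Oco Oconv c0 ws O0).1 ws_E.
set xs := usubmx ws in Oxs Axs vi_xs; set ls := dsubmx ws in vi_xs.
have Ecl : closed E := equilibria_closed Oco Oconv Fdiff O0.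
have E0 : E !=set0 by exists ws.
have [M1 M10 OM] := compact_enorm_bounded Oco.
have [M2 lM] := lam_bounded Oxs Axs vi_xs.
pose w t : 'cV[R]_(d + l) := col_mx (x t) (lam t).
apply/cvgrPdist_lt => e e0.
pose K := [set u : 'cV[R]_(d + l) | enorm u <= M1 + M2] `&`
  [set u | e <= enorm (u - proj E u)].
have Kcl : closed K.
  apply: closedI.
    apply: (@preimage_closed _ _ (@enorm R (d + l)) [set z | z <= M1 + M2]).
      by move=> u _; exact: enorm_continuous.
    exact: closed_le.
  apply: (@preimage_closed _ _ (fun u : 'cV[R]_(d + l) => enorm (u - proj E u)) [set z | e <= z]).
    by move=> u _; exact: dist_proj_continuous.
  exact: closed_ge.
have Kco : compact K by apply: (@bounded_closed_compact_cV _ _ _ (M1 + M2)) => // u [].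
(* On bounded points at distance at least [e] from the equilibria the residual has a positive
   minimum. Along the flow it tends to 0, so such points are eventually left. *)
have [delta d0 Hd] : exists2 delta : R, 0 < delta &
    forall u, K u -> delta <= vi_residual Omega F A b c u.
  have [[u0 Ku0]|K0] := pselect (K !=set0); last first.
    by exists 1 => // u Ku; case: K0; exists u.
  have [u Ku uP] := compact_minimum (ex_intro _ u0 Ku0) Kco
    (vi_residual_continuous (A := A) (b := b) (c := c) Oco Oconv Fdiff O0).
  exists (vi_residual Omega F A b c u) => //.
  rewrite lt_neqAle addr_ge0 ?enorm_ge0// andbT eq_sym; apply/eqP.
  move=> /vi_residual_eq0 Eu; have [_ /(_ _ Eu)] := proj_exists u Ecl E0.
  by rewrite subrr enorm0 => /(le_trans Ku.2); rewrite leNgt e0.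
have d2 : 0 < delta / 2 by rewrite divr_gt0.
have [T1 TT1 H1] := v_cvg Oxs Axs vi_xs d2.
have [T2 TT2 H2] := r_cvg Oxs Axs vi_xs d2.
exists (Num.max T1 T2); split; first exact: num_real.
move=> t; rewrite gt_max => /andP[/ltW t1 /ltW t2].
have Tt := le_trans TT1 t1.
rewrite sub0r normrN ger0_norm ?enorm_ge0// ltNge; apply/negP => far.
have : delta <= vi_residual Omega F A b c (w t).
  apply: Hd; split => //=; apply: le_trans (enorm_col_mx_le _ _) _.
  by apply: lerD; [apply: OM; exact: x_in|exact: lM].
rewrite /vi_residual col_mxKu col_mxKd leNgt => /negP; apply.
have := H1 t t1; have := H2 t t2; rewrite /v /g /r opprD addrA.
move: (enorm _) (enorm _) => *; lra.
Qed.

End PrimalDual.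

(** * Block structure and the pseudo-gradient *)

Section Blocks.
Context {R : realType} {N : nat} {n_ : 'I_N -> nat}.
Local Notation n := (\sum_i n_ i)%N.
Implicit Types u v : 'cV[R]_n.

Lemma dotv_blocks u v : dotv u v = \sum_i dotv (submxcol u i) (submxcol v i).
Proof.
rewrite -{1}[u]submxcolK -{1}[v]submxcolK /dotv tr_mxcol mul_mxrow_mxcol.
by rewrite summxE.
Qed.

Lemma enorm_submxcol_le u i : enorm (submxcol u i) <= enorm u.
Proof.
rewrite -(ler_pXn2r (ltn0Sn 1)) ?nnegrE ?enorm_ge0// !sqr_enorm.
rewrite dotv_blocks (bigD1 i)//= lerDl; apply: sumr_ge0 => j _; exact: dotv_ge0.
Qed.

Lemma submxcol_cvg T (F : set_system T) {FF : Filter F} (f : T -> 'cV[R]_n) u i :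
  f t @[t --> F] --> u -> submxcol (f t) i @[t --> F] --> submxcol u i.
Proof.
move=> /cvg_enormP H; apply/cvg_enormP => e /H; apply: filterS => t.
by apply: le_lt_trans; rewrite -submxcolB enorm_submxcol_le.
Qed.

Lemma is_derive_submxcol (f : R -> 'cV[R]_n) (t : R) (df : 'cV[R]_n) i :
  is_derive t 1 f df -> is_derive t 1 (fun s => submxcol (f s) i) (submxcol df i).
Proof.
move=> fd; apply: is_derive_col => k.
have -> : (fun s => submxcol (f s) i k 0) = (fun s => f s (tagnat.Rank i k) 0).
  by apply/funext => s; rewrite mxE.
by rewrite mxE; exact: is_derive_coord.
Qed.

Lemma submxcolZ a u i : submxcol (a *: u) i = a *: submxcol u i.
Proof. by apply/matrixP => k j; rewrite !mxE. Qed.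

Lemma submxcol_delta i (k : 'I_(n_ i)) j :
  submxcol (delta_mx (tagnat.Rank i k) 0 : 'cV[R]_n) j =
  @eqtype.dfwith _ (fun j => 'cV[R]_(n_ j)) (fun=> 0) i (delta_mx k 0) j.
Proof.
case: eqtype.dfwithP => [|j' ij]; apply/colP => q; rewrite !mxE eqxx !andbT.
  by rewrite -val_eqE/= tagnat.eq_Rank eqxx/= val_eqE.
by rewrite -val_eqE/= tagnat.eq_Rank eq_sym (negbTE ij).
Qed.

Variable Omega_ : forall i : 'I_N, set 'cV[R]_(n_ i).
Arguments Omega_ i : clear implicits.
Hypotheses (Ocl : forall i, closed (Omega_ i))
  (Oconv : forall i, @convex_set R 'cV[R]_(n_ i) (Omega_ i))
  (O0 : forall i, Omega_ i !=set0).

(** The inner product splits over the blocks, so the blockwise projections satisfy the variational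
    inequality that characterises the projection on the product. *)
Lemma proj_blocks u : closed (Omega Omega_) ->
  @convex_set R 'cV[R]_n (Omega Omega_) -> Omega Omega_ !=set0 ->
  proj (Omega Omega_) u = \mxcol_i proj (Omega_ i) (submxcol u i).
Proof.
move=> cl conv ne; apply: proj_unique => //.
  by move=> i; rewrite mxcolK; exact: proj_in.
move=> w Ow; rewrite dotv_blocks; apply: sumr_le0 => i _.
by rewrite !submxcolB mxcolK; exact: proj_vi.
Qed.

End Blocks.

(** * Operator norms, Jacobians and gradients *)

Section Jacobian.
Context {R : realType}.

(** A crude bound by the entries, showing that the supremum in [opnorm] is over a bounded set. *)
Lemma mulmx_bounded p d (M : 'M[R]_(p, d)) :
  exists2 C : R, 0 < C & forall v, enorm (M *m v) <= C * enorm v.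
Proof.
pose C := 1 + \sum_k \sum_j `|M k j|.
have S0 : 0 <= \sum_k \sum_j `|M k j| by do 2 (apply: sumr_ge0 => ? _).
exists C; first by rewrite ltr_pwDl.
move=> v; apply: le_trans (enorm_le_sum _) _.
apply: (@le_trans _ _ ((\sum_k \sum_j `|M k j|) * enorm v)); last first.
  by rewrite ler_wpM2r ?enorm_ge0// lerDr.
rewrite mulr_suml; apply: ler_sum => k _; rewrite mxE mulr_suml.
apply: le_trans (ler_norm_sum _ _ _) _; apply: ler_sum => j _.
by rewrite normrM ler_wpM2l// coord_le_enorm.
Qed.

Lemma enorm_mulmx_le p d (M : 'M[R]_(p, d)) v :
  enorm (M *m v) <= opnorm M * enorm v.
Proof.
have [->|v0] := eqVneq v 0; first by rewrite mulmx0 !enorm0 mulr0.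
have ev := enorm_gt0 v0.
have [C C0 MC] := mulmx_bounded M.
rewrite -ler_pdivrMr//; apply: ub_le_sup.
  exists C => _ [w /= w1 <-]; apply: le_trans (MC w) _.
  by rewrite -[leRHS]mulr1 ler_wpM2l// ltW.
exists ((enorm v)^-1 *: v) => /=.
  by rewrite enormZ gtr0_norm ?invr_gt0// mulVf ?gt_eqF.
by rewrite -scalemxAr enormZ gtr0_norm ?invr_gt0// mulrC.
Qed.

Lemma cV_sum_delta d (v : 'cV[R]_d) : v = \sum_k v k 0 *: delta_mx k 0.
Proof.
by rewrite {1}[v]matrix_sum_delta; apply: eq_bigr => k _; rewrite big_ord1.
Qed.

Lemma diff_jac d p (f : 'cV[R]_d -> 'cV[R]_p) x v : differentiable f x ->
  'd f x v = jac f x *m v.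
Proof.
move=> fd; rewrite {1}[v]cV_sum_delta linear_sum; apply/colP => k.
rewrite summxE mxE; apply: eq_bigr => j _.
by rewrite linearZ/= !mxE deriveE// mulrC.
Qed.

Lemma diff_grad d (f : 'cV[R]_d -> R^o) x v : differentiable f x ->
  'd f x v = dotv (grad f x) v.
Proof.
move=> fd; rewrite {1}[v]cV_sum_delta linear_sum dotvE.
by apply: eq_bigr => j _; rewrite linearZ/= !mxE deriveE// mulrC.
Qed.

Lemma is_derive_col_mx p q (f : R -> 'cV[R]_p) (g : R -> 'cV[R]_q) (t : R)
    (df : 'cV[R]_p) (dg : 'cV[R]_q) :
  is_derive t 1 f df -> is_derive t 1 g dg ->
  is_derive t 1 (fun s => col_mx (f s) (g s)) (col_mx df dg).
Proof.
move=> /is_derive_enormP H1 /is_derive_enormP H2; apply/is_derive_enormP => e e0.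
have e2 : 0 < e / 2 by rewrite divr_gt0.
have [d1 d10 {}H1] := H1 _ e2; have [d2 d20 {}H2] := H2 _ e2.
exists (Num.min d1 d2); first by rewrite lt_min d10.
move=> h; rewrite lt_min => /andP[/H1 h1 /H2 h2].
rewrite opp_col_mx add_col_mx scale_col_mx opp_col_mx add_col_mx.
apply: le_trans (enorm_col_mx_le _ _) _.
by rewrite [e in leRHS]splitr mulrDl; exact: lerD.
Qed.

Lemma is_derive_sum_fun (V : normedModType R) (I : Type) (r : seq I)
    (f : I -> R -> V) (t : R) (df : I -> V) :
  (forall i, is_derive t 1 (f i) (df i)) ->
  is_derive t 1 (fun s => \sum_(i <- r) f i s) (\sum_(i <- r) df i).
Proof.
move=> fd; elim: r => [|i r IH].
  by rewrite big_nil; under eq_fun do rewrite big_nil; exact: is_derive_cst.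
by rewrite big_cons; under eq_fun do rewrite big_cons; exact: is_deriveD.
Qed.

Lemma convex_lipschitz d p (f : 'cV[R]_d -> 'cV[R]_p) (C : set 'cV[R]_d) (L : R) :
  @convex_set R 'cV[R]_d C -> (forall x, differentiable f x) ->
  (forall x, C x -> opnorm (jac f x) <= L) ->
  forall u w, C u -> C w -> enorm (f u - f w) <= L * enorm (u - w).
Proof.
move=> Cconv fd fL u w Cu Cw.
pose c (s : R) := w + s *: (u - w).
have cd (s : R) : is_derive s 1 c (u - w) by exact: is_derive_line.
have := @curve_lipschitz R p 0 1 (L * enorm (u - w)) (f \o c)
  (fun s => 'd f (c s) (u - w)) ler01.
rewrite /= subr0 mulr1 /c scale1r scale0r addr0 [w + _]addrC subrK; apply.
  move=> s _; exact: (@is_derive_comp_diff R d 'cV[R]_p f c s _ (fd _) (cd s)).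
move=> s /andP[s0 s1]; rewrite diff_jac//.
apply: le_trans (enorm_mulmx_le _ _) _; apply: ler_wpM2r; first exact: enorm_ge0.
apply: fL; rewrite (_ : _ + _ = s *: u + (1 - s) *: w).
  by apply: (convex_setP _).1 => //; rewrite s0.
by rewrite scalerBr scalerBl scale1r addrCA.
Qed.

Lemma differentiable_cV (V : normedModType R) p (f : V -> 'cV[R]_p) x :
  (forall k, differentiable (fun y => f y k 0 : R^o) x) -> differentiable f x.
Proof.
move=> fd; have -> : f = \sum_k (fun y => f y k 0 *: (delta_mx k 0 : 'cV[R]_p)).
  by apply/funext => y; rewrite fct_sumE {1}[f y]cV_sum_delta.
apply: differentiable_sum => k.
exact: (@differentiableZl _ _ _ (fun y => f y k 0 : R^o) (delta_mx k 0)).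
Qed.

End Jacobian.

Section PseudoGradient.
Context {R : realType} {N : nat} {n_ : 'I_N -> nat} {m : nat}.
Local Notation n := (\sum_i n_ i)%N.
Variables (theta : forall i : 'I_N, 'cV[R]_(n_ i + m) -> R^o)
  (phi : forall i : 'I_N, 'cV[R]_(n_ i) -> 'cV[R]_m).
Arguments theta i : clear implicits.
Arguments phi i : clear implicits.
Hypotheses (theta_diff : forall i u, differentiable (theta i) u)
  (phi_diff : forall i u, differentiable (phi i) u)
  (smooth : forall i, C2 (cost theta phi i)).

Lemma pseudo_grad_differentiable x : differentiable (pseudo_grad theta phi) x.
Proof.
apply: differentiable_cV => r.
have -> : (fun y => pseudo_grad theta phi y r 0 : R^o) =
    (fun y => 'D_(delta_mx r 0) (cost theta phi (tagnat.sig1 r)) y).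
  by apply/funext => y; rewrite !mxE tagnat.sig2K.
by have [_ /(_ (delta_mx r 0))[]] := smooth (tagnat.sig1 r).
Qed.

(** The cost is differentiated along a coordinate line of player [i] both directly and through
    [theta]. Such a move changes the aggregate only through [phi i], with weight [1 / N]; uniqueness
    of the derivative identifies the two results. *)
Lemma pseudo_grad_block x i :
  submxcol (pseudo_grad theta phi x) i =
  Gmap theta phi i (submxcol x i) (sigma phi x).
Proof.
rewrite mxcolK; apply/colP => k; rewrite !mxE.
set e : 'cV[R]_n := delta_mx _ 0; set d : 'cV[R]_(n_ i) := delta_mx k 0.
have [[cd _] _] := smooth i; rewrite deriveE//.
set w := col_mx (submxcol x i) (sigma phi x).
have line := @is_derive_line R n x e 0.
have h1 : is_derive (0 : R) 1 (fun s : R => cost theta phi i (x + s *: e))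
    ('d (cost theta phi i) x e).
  have := @is_derive_comp_diff R n R^o (cost theta phi i) (fun s : R => x + s *: e) 0 e.
  by rewrite scale0r addr0; exact.
have block j : is_derive (0 : R) 1 (fun s : R => submxcol (x + s *: e) j) (submxcol e j).
  exact: is_derive_submxcol.
have dphi j : is_derive (0 : R) 1 (fun s : R => phi j (submxcol (x + s *: e) j))
    ('d (phi j) (submxcol x j) (submxcol e j)).
  have := @is_derive_comp_diff R _ 'cV[R]_m (phi j)
    (fun s : R => submxcol (x + s *: e) j) 0 (submxcol e j).
  by rewrite scale0r addr0; exact.
pose sg (s : R) := N%:R^-1 *: \sum_j phi j (submxcol (x + s *: e) j).
have dsigma : is_derive (0 : R) 1 sg
    (N%:R^-1 *: \sum_j 'd (phi j) (submxcol x j) (submxcol e j)).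
  exact: (is_deriveZ N%:R^-1 (is_derive_sum_fun (index_enum 'I_N) dphi)).
have dcurve := is_derive_col_mx (block i) dsigma.
have h2 := @is_derive_comp_diff R _ R^o (theta i) _ 0 _ (@theta_diff i _) dcurve.
have := @derive_val _ _ _ _ _ _ _ h1; rewrite (@derive_val _ _ _ _ _ _ _ h2) => <-.
have -> : col_mx (submxcol (x + 0 *: e) i) (sg 0) = w by rewrite /sg scale0r addr0.
rewrite diff_grad//.
have -> : \sum_(j <- index_enum 'I_N) 'd (phi j) (submxcol x j) (submxcol e j) =
    jac (phi i) (submxcol x i) *m d.
  rewrite (bigD1 i)//= big1 ?addr0 => [|j ji].
    by rewrite submxcol_delta eqtype.dfwith_in diff_jac.
  by rewrite submxcol_delta eqtype.dfwith_out 1?eq_sym// linear0.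
rewrite submxcol_delta eqtype.dfwith_in -{1}(vsubmxK (grad (theta i) w)) dotv_col_mx.
have dotd p (u : 'cV[R]_p) q : dotv u (delta_mx q 0) = u q 0.
  rewrite dotvE (bigD1 q)//= mxE !eqxx mulr1 big1 ?addr0// => r rq.
  by rewrite mxE (negbTE rq) mulr0.
by rewrite dotvZr -dotv_trmx !dotd !mxE.
Qed.

End PseudoGradient.

(** * Dissipation and conservation for Filippov velocities of sign protocols *)

Section FilippovConsensus.
Context {R : realType} {d N : nat}.
Variables (f : 'cV[R]_d -> 'cV[R]_d) (z v : 'cV[R]_d) (r : 'I_N -> 'I_d)
  (e : rel 'I_N) (k : R) (s : 'cV[R]_d -> 'I_N -> R) (h : 'I_N -> 'cV[R]_d -> R).
Hypotheses (ec : undirected_connected e) (k0 : 0 <= k)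
  (fE : forall y i, f y (r i) 0 = k * sgsum e (s y) i + h i y)
  (sc : forall i, {for z, continuous (fun y => s y i)})
  (hc : forall i, {for z, continuous (h i)})
  (fv : filippov f z v).

Lemma near_weighted_le (w : 'I_N -> R) (eps : R) : 0 < eps ->
  \forall y \near nbhs z, \sum_i w i * h i y <= \sum_i w i * h i z + eps.
Proof.
move=> e0; have Hc : \sum_i w i * h i y @[y --> z] --> \sum_i w i * h i z.
  apply: (@cvg_sum _ _ _ (nbhs z)) => i _.
  by apply: cvgM; [exact: cvg_cst|exact: hc].
move/cvgrPdist_le : Hc => /(_ eps e0); apply: filterS => y.
by rewrite ler_norml => /andP[+ _]; lra.
Qed.

(** [s] holds the quantities compared by the signs and [h] the continuous input. Keeping [s] apart
    from the state coordinates [r] covers the protocol for [zeta], whose signs act on [eta]. *)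
Lemma filippov_consensus_le (c : R) (p q : 'I_N) :
  \sum_i (s z i - c) * v (r i) 0 <=
  - k * `|s z p - s z q| + \sum_i (s z i - c) * h i z.
Proof.
apply: filippov_le fv _ => eps e0.
(* Chosen so that the error [(2 + N ^ 2) * delta] of the dissipation estimate, with
   [delta = eps / M] and multiplied by [k], is at most [eps / 2]. *)
pose M : R := 2 * (k + 1) * (2 + N%:R ^+ 2).
have N2 : 0 <= N%:R ^+ 2 :> R by rewrite exprn_ge0.
have k1 : 0 < k + 1 by rewrite ltr_wpDl.
have N3 : 0 < 2 + N%:R ^+ 2 :> R by rewrite ltr_pwDl.
have M0 : 0 < M by rewrite !mulr_gt0.
have e1 : 0 < eps / M by rewrite divr_gt0.
have e2 : 0 < eps / 2 by rewrite divr_gt0.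
have sn : \forall y \near nbhs z, forall i, `|s y i - s z i| <= eps / M.
  apply: filter_forall => i.
  have /cvgrPdist_le/(_ _ e1) := sc (i := i).
  by apply: filterS => y; rewrite distrC.
have hn := near_weighted_le (fun i => s z i - c) e2.
have [delta d0 H] := (nbhs_enormP z _).1 (filterI sn hn).
exists delta => // y /H[sy hy].
have -> : \sum_i (s z i - c) * f y (r i) 0 =
    k * (\sum_i (s z i - c) * sgsum e (s y) i) + \sum_i (s z i - c) * h i y.
  by rewrite mulr_sumr -big_split/=; apply: eq_bigr => i _; rewrite fE; ring.
have := sgsum_dissipation c p q ec sy.
move=> /(ler_wpM2l k0) h1.
have h2 : k * ((2 + N%:R ^+ 2) * (eps / M)) <= eps / 2.
  have -> : eps / 2 = (k + 1) * ((2 + N%:R ^+ 2) * (eps / M)).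
    rewrite /M; field.
    by rewrite !gt_eqF.
  apply: ler_wpM2r; last by rewrite lerDl.
  by rewrite mulr_ge0 ?ltW.
move: h1 h2 hy; rewrite mulrDr; move: (\sum_i _) (\sum_i _) (\sum_i _) => S1 S2 S3.
move: (k * (_ * (eps / M))) => u h1 h2 h3; lra.
Qed.

(** At every nearby state the signs cancel in the sum, which is therefore continuous; the linear
    bound is used with both signs of [a]. *)
Lemma filippov_consensus_sum : \sum_i v (r i) 0 = \sum_i h i z.
Proof.
have esym := ec.1.
have key (a : R) : \sum_i a * v (r i) 0 <= \sum_i a * h i z.
  apply: filippov_le fv _ => eps e0.
  have /nbhs_enormP[delta d0 H] := near_weighted_le (fun=> a) e0.
  exists delta => // y /H; apply: le_trans.
  have -> : \sum_i a * f y (r i) 0 = \sum_i a * h i y + a * k * \sum_i sgsum e (s y) i.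
    by rewrite mulr_sumr -big_split/=; apply: eq_bigr => i _; rewrite fE; ring.
  by rewrite sum_sgsum// mulr0 addr0.
have := key 1; have := key (-1); rewrite -!mulr_sumr !mul1r !mulN1r lerN2 => h1 h2.
by apply/eqP; rewrite eq_le h1 h2.
Qed.

End FilippovConsensus.

(** * Integrals and constancy of absolutely continuous functions *)

Section AbsoluteContinuityIntegral.
Context {R : realType}.
Notation mu := (@lebesgue_measure R).

Lemma ac_within_continuous (a b : R) (f : R -> R) : ac a b f ->
  {within `[a, b], continuous f}.
Proof.
move=> fac; apply/subspace_continuousP => x /=; rewrite in_itv/= => /andP[ax xb].
apply/cvgrPdist_lt => e e0; have [delta d0 H] := ac_uniform_continuous fac e0.
apply/nbhs_ballP; exists delta => //= y; rewrite /ball/= => xy.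
rewrite in_itv/= => /andP[ay yb]; have [xy'|/ltW yx] := leP x y.
  by rewrite distrC; apply: H => //; move: xy; rewrite ltr_norml; lra.
by apply: H => //; move: xy; rewrite ltr_norml; lra.
Qed.

Lemma ac_continuous (a b c : R) (f : R -> R) : ac a b f -> a < c < b ->
  {for c, continuous f}.
Proof.
move=> /ac_within_continuous fc /andP[ac cb].
have /(continuous_within_itvP _ (lt_trans ac cb))[H _ _] := fc.
by apply: H; rewrite in_itv/= ac cb.
Qed.

(** Since [g] is continuous, the almost everywhere derivative holds at every interior point and the
    classical fundamental theorem applies. *)
Lemma ac_integral (T : R) (F g : R -> R) : 0 < T -> ac 0 T F -> ac 0 T g ->
  {ae mu, forall t, 0 <= t <= T -> is_derive t 1 F (g t)} ->
  \int[mu]_(s in `[0, T]) g s = F T - F 0.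
Proof.
move=> T0 Fac gac Hae; rewrite /Rintegral (@continuous_FTC2 R g F 0 T T0)//=.
- exact: ac_within_continuous.
- have /ac_within_continuous/(continuous_within_itvP _ T0)[_ F0 FT] := Fac.
  split => // t; rewrite in_itv/= => tT.
  by case: (ac_is_derive tT Fac Hae (ac_continuous gac tT)).
- move=> t; rewrite in_itv/= => tT; rewrite derive1E.
  by case: (ac_is_derive tT Fac Hae (ac_continuous gac tT)).
Qed.

Lemma ac_constant (T : R) (F : R -> R) : 0 <= T -> ac 0 T F ->
  {ae mu, forall t, 0 <= t <= T -> is_derive t 1 F 0} -> F T = F 0.
Proof.
move=> T0 Fac Hae.
have slope (k : R) : k * F T <= k * F 0.
  have kac : ac 0 T (fun t => k * F t).
    by apply: acM => //; exact: ac_cst.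
  apply: (ac_nonincreasing T0 kac).
  apply: (@filterS _ _ (ae_filter_ringOfSetsType mu)) Hae => t Ht /Ht tF.
  exists 0 => //; have := is_deriveZ k tF; by rewrite scaler0.
have := slope 1; have := slope (-1); rewrite !mul1r !mulN1r lerN2 => h1 h2.
by apply/eqP; rewrite eq_le h1 h2.
Qed.

End AbsoluteContinuityIntegral.

Section State.
Context {R : realType} {N : nat} {n_ : 'I_N -> nat} {m l : nat}.
Local Notation n := (\sum_i n_ i)%N.
Local Notation L := (\sum_(i < N) l)%N.
Local Notation M := (\sum_(i < N) m)%N.
Implicit Types (y : 'cV[R]_(n + (L + M))) (x : 'cV[R]_n).

Definition lam_index (k : 'I_l) (i : 'I_N) : 'I_(n + (L + M)) :=
  rshift n (lshift M (@tagnat.Rank N (fun=> l) i k)).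

Definition zeta_index (k : 'I_m) (i : 'I_N) : 'I_(n + (L + M)) :=
  rshift n (rshift L (@tagnat.Rank N (fun=> m) i k)).

Lemma state_x x (lam : 'I_N -> 'cV[R]_l) (zeta : 'I_N -> 'cV[R]_m) k :
  state x lam zeta (lshift (L + M) k) 0 = x k 0.
Proof. exact: col_mxEu. Qed.

Lemma state_lam x (lam : 'I_N -> 'cV[R]_l) (zeta : 'I_N -> 'cV[R]_m) k i :
  state x lam zeta (lam_index k i) 0 = lam i k 0.
Proof.
rewrite [LHS]col_mxEd col_mxEu -[in RHS](@mxcolK _ _ (fun=> l) _ lam i).
by rewrite [RHS]mxE.
Qed.

Lemma state_zeta x (lam : 'I_N -> 'cV[R]_l) (zeta : 'I_N -> 'cV[R]_m) k i :
  state x lam zeta (zeta_index k i) 0 = zeta i k 0.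
Proof.
rewrite [LHS]col_mxEd col_mxEd -[in RHS](@mxcolK _ _ (fun=> m) _ zeta i).
by rewrite [RHS]mxE.
Qed.

Lemma lam_indexE y k i :
  submxcol (usubmx (dsubmx y)) i k 0 = y (lam_index k i) 0.
Proof. by rewrite !mxE. Qed.

Lemma zeta_indexE y k i :
  submxcol (dsubmx (dsubmx y)) i k 0 = y (zeta_index k i) 0.
Proof. by rewrite !mxE. Qed.

End State.

Section Suprema.
Context {R : realType}.

Lemma le_sup_ord N (F : 'I_N -> R) i : F i <= sup [set F j | j in [set: 'I_N]].
Proof.
apply: ub_le_sup; last by exists i.
exists (\sum_j `|F j|) => _ [j _ <-]; apply: le_trans (ler_norm _) _.
by rewrite (bigD1 j)//= lerDl sumr_ge0.
Qed.

Lemma opnorm_ge0 p d (A : 'M[R]_(p, d)) : 0 <= opnorm A.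
Proof.
have [C C0 AC] := mulmx_bounded A.
apply: ub_le_sup; last by exists 0; rewrite /= ?mulmx0 enorm0.
exists C => _ [w /= w1 <-]; apply: le_trans (AC w) _.
by rewrite -[leRHS]mulr1 ler_wpM2l// ltW.
Qed.

Lemma col_mx_cvg T (F : set_system T) {FF : Filter F} p q
    (f : T -> 'cV[R]_p) (g : T -> 'cV[R]_q) (u : 'cV[R]_p) (v : 'cV[R]_q) :
  f t @[t --> F] --> u -> g t @[t --> F] --> v ->
  col_mx (f t) (g t) @[t --> F] --> col_mx u v.
Proof.
move=> /cvg_enormP H1 /cvg_enormP H2; apply/cvg_enormP => e e0.
have e2 : 0 < e / 2 by rewrite divr_gt0.
apply: filterS2 (H1 _ e2) (H2 _ e2) => t h1 h2.
rewrite opp_col_mx add_col_mx; apply: le_lt_trans (enorm_col_mx_le _ _) _.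
by rewrite [e]splitr; exact: ltrD.
Qed.

Lemma coord_cvg T (F : set_system T) {FF : Filter F} p
    (f : T -> 'cV[R]_p) (u : 'cV[R]_p) k :
  f t @[t --> F] --> u -> f t k 0 @[t --> F] --> u k 0.
Proof. by move=> fu; exact: (cvg_comp _ _ fu (@coord_continuous R _ _ k 0 u)). Qed.

Lemma cV_cvg T (F : set_system T) {FF : Filter F} p
    (f : T -> 'cV[R]_p) (u : 'cV[R]_p) :
  (forall k, f t k 0 @[t --> F] --> u k 0) -> f t @[t --> F] --> u.
Proof.
move=> fu; have -> : f = fun t => \sum_k f t k 0 *: delta_mx k 0.
  by apply/funext => t; exact: cV_sum_delta.
rewrite [u]cV_sum_delta; apply: cvg_sum => k _.
by apply: cvgZ; [exact: fu|exact: cvg_cst].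
Qed.

Lemma eventually_ord p (P : 'I_p -> R -> Prop) :
  (forall k, exists2 T : R, 0 < T & forall t, T <= t -> P k t) ->
  exists2 T : R, 0 < T & forall k t, T <= t -> P k t.
Proof.
move=> HP; have /choice [T TP] k : exists T : R, 0 < T /\ forall t, T <= t -> P k t.
  by have [T T0 PT] := HP k; exists T.
have T0 k : 0 <= T k by have [/ltW] := TP k.
(* The sum of the nonnegative times dominates each of them; the 1 ensures positivity when
   [p = 0]. *)
exists (1 + \sum_k T k) => [|k t Tt]; first by rewrite ltr_pwDl// sumr_ge0.
have [_] := TP k; apply; apply: le_trans Tt.
by rewrite (bigD1 k)//= addrCA lerDl addr_ge0// sumr_ge0.
Qed.

End Suprema.

(** * Solutions of the algorithm *)

Section Dynamics.
Variables (R : realType) (N : nat) (N_gt0 : (0 < N)%N)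
  (n_ : 'I_N -> nat) (m l : nat)
  (Omega_ : forall i : 'I_N, set 'cV[R]_(n_ i))
  (theta : forall i : 'I_N, 'cV[R]_(n_ i + m) -> R^o)
  (phi : forall i : 'I_N, 'cV[R]_(n_ i) -> 'cV[R]_m)
  (A_ : forall i : 'I_N, 'M[R]_(l, n_ i))
  (b_ : 'I_N -> 'cV[R]_l).
Arguments Omega_ i : clear implicits.
Arguments theta i : clear implicits.
Arguments phi i : clear implicits.
Hypotheses (Omega_closed : forall i, closed (Omega_ i))
  (Omega_convex : forall i, @convex_set R 'cV[R]_(n_ i) (Omega_ i))
  (Omega_nonempty : forall i, Omega_ i !=set0)
  (theta_diff : forall i u, differentiable (theta i) u)
  (phi_diff : forall i u, differentiable (phi i) u)
  (G_continuous : forall i, continuous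
     (fun w : 'cV[R]_(n_ i + m) =>
        Gmap theta phi i (usubmx w) (dsubmx w)))
  (f1bar_finite : forall i,
     has_ubound [set opnorm (jac (phi i) u) | u in Omega_ i])
  (smooth : forall i, C2 (cost theta phi i))
  (monotone : strictly_monotone_on (Omega Omega_) (pseudo_grad theta phi))
  (compact_Omega : compact (Omega Omega_))
  (convex_Omega : @convex_set R 'cV[R]_(\sum_i n_ i) (Omega Omega_))
  (qualification :
     rint [set z1 - z2 | z1 in Omega Omega_ & z2 in coupled_set A_ b_] 0).
Variables (G : R -> rel 'I_N) (alpha beta gamma : R).
Hypotheses (graph : forall t : R, 0 <= t -> undirected_connected (G t))
  (alpha_gt0 : 0 < alpha) (beta_gt0 : 0 < beta) (gamma_gt0 : 0 < gamma)
  (alpha_large : (N%:R - 1) * f1bar Omega_ phi < alpha)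
  (beta_large : gamma * (N%:R - 1) * f2bar Omega_ A_ b_ < beta).
Variables (x : R -> 'cV[R]_(\sum_i n_ i))
  (lam : 'I_N -> R -> 'cV[R]_l) (zeta : 'I_N -> R -> 'cV[R]_m).
Hypotheses (solution : filippov_solution
     (algo_field Omega_ theta phi A_ b_ alpha beta gamma G)
     (fun t => state (x t) (fun i => lam i t) (fun i => zeta i t)))
  (x_init : forall i, Omega_ i (submxcol (x 0) i))
  (lam_init : forall i, lam i 0 = A_ i *m submxcol (x 0) i - b_ i)
  (zeta_init : forall i, zeta i 0 = 0).

Local Notation n := (\sum_i n_ i)%N.
Local Notation D := (n + ((\sum_(i < N) l) + (\sum_(i < N) m)))%N.
Local Notation mu := (@lebesgue_measure R).
Local Notation OmegaN := (Omega Omega_).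
Local Notation c := (gamma / N%:R).

Let z t : 'cV[R]_D := state (x t) (fun i => lam i t) (fun i => zeta i t).
Let field t := algo_field Omega_ theta phi A_ b_ alpha beta gamma G t.

Let c_gt0 : 0 < c. Proof. by rewrite divr_gt0// ltr0n. Qed.
Let Ocl : closed OmegaN := compact_closed_cV compact_Omega.
Let Ox0 : OmegaN (x 0). Proof. by []. Qed.
Let O0 : OmegaN !=set0. Proof. by exists (x 0). Qed.

Lemma diameter_bound u w : OmegaN u -> OmegaN w ->
  enorm (u - w) <= sup [set enorm (y - z) | y in OmegaN & z in OmegaN].
Proof.
move=> Ou Ow; apply: ub_le_sup; last by exists u => //; exists w.
have [M M0 OM] := compact_enorm_bounded compact_Omega.
exists (M + M) => _ [y Oy [y' Oy' <-]]; apply: le_trans (enormD _ _) _.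
by rewrite enormN; apply: lerD; exact: OM.
Qed.

(** [f1bar_finite] and the compactness of the strategy set make both inner suprema genuine upper
    bounds. *)
Lemma f1bar_bound i u (y w : 'cV[R]_n) : Omega_ i u -> OmegaN y -> OmegaN w ->
  opnorm (jac (phi i) u) * enorm (y - w) <= f1bar Omega_ phi.
Proof.
move=> Ou Oy Ow; apply: le_trans (le_sup_ord _ i).
apply: ler_pM; rewrite ?opnorm_ge0 ?enorm_ge0//; last exact: diameter_bound.
by apply: ub_le_sup => //; exists u.
Qed.

Lemma f2bar_bound i u : Omega_ i u -> enorm (A_ i *m u - b_ i) <= f2bar Omega_ A_ b_.
Proof.
move=> Ou; apply: le_trans (le_sup_ord _ i); apply: ub_le_sup; last by exists u.
have [M M0 OM] := compact_enorm_bounded compact_Omega.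
have [C C0 AC] := mulmx_bounded (A_ i).
exists (C * M + enorm (b_ i)) => _ [w Ow <-].
apply: le_trans (enormD _ _) _; rewrite enormN lerD2r.
apply: le_trans (AC w) _; rewrite ler_pM2l//.
(* Compactness is given for the product, so [w] is completed by the blocks of [x 0] to a profile of
   bounded norm. *)
pose y : 'cV[R]_n := \mxcol_j eqtype.dfwith (fun j => submxcol (x 0) j) w j.
have -> : w = submxcol y i by rewrite mxcolK eqtype.dfwith_in.
apply: le_trans (enorm_submxcol_le _ _) _; apply: OM => j.
by rewrite mxcolK; case: eqtype.dfwithP.
Qed.

Let xblock (y : 'cV[R]_D) i := submxcol (usubmx y) i.
Let eta (y : 'cV[R]_D) i := submxcol (dsubmx (dsubmx y)) i + phi i (xblock y i).

Let tblock (y : 'cV[R]_D) i : 'cV[R]_(n_ i) :=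
  proj (Omega_ i) (xblock y i - Gmap theta phi i (xblock y i) (eta y i)
    - c *: ((A_ i)^T *m submxcol (usubmx (dsubmx y)) i)).

(** The point towards which [x] moves. It involves neither the graph nor a sign, hence is continuous
    in the state and free of [t]. *)
Let target (y : 'cV[R]_D) : 'cV[R]_n := \mxcol_i tblock y i.

Lemma target_in y : OmegaN (target y).
Proof. by move=> i; rewrite mxcolK; exact: proj_in. Qed.

Lemma field_x t y : usubmx (field t y) = target y - usubmx y.
Proof.
rewrite /field /algo_field /field_at /state col_mxKu; apply/mxcolP => i.
by rewrite submxcolB !mxcolK.
Qed.

Lemma field_lam t y k i : field t y (lam_index k i) 0 =
  beta * sgsum (G t) (fun j => y (lam_index k j) 0) i +
  gamma * (A_ i *m xblock y i - b_ i) k 0.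
Proof.
rewrite /field /algo_field /field_at state_lam [LHS]mxE [X in X + _]mxE summxE.
rewrite [X in _ + X]mxE; congr (_ * _ + _); apply: eq_bigr => j _.
by rewrite mxE [X in Num.sg X]mxE [X in _ + X]mxE !lam_indexE.
Qed.

(** The trailing [+ 0] is the zero input, which gives both protocols the same shape. *)
Lemma field_zeta t y k i : field t y (zeta_index k i) 0 =
  alpha * sgsum (G t) (fun j => eta y j k 0) i + 0.
Proof.
rewrite /field /algo_field /field_at state_zeta [LHS]mxE summxE addr0.
congr (_ * _); apply: eq_bigr => j _.
by rewrite mxE [X in Num.sg X]mxE [X in _ + X]mxE.
Qed.

Lemma xblock_cvg (y : 'cV[R]_D) i : xblock w i @[w --> y] --> xblock y i.
Proof.
by apply: (@submxcol_cvg R N n_ _ (nbhs y)); exact: usubmx_continuous.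
Qed.

Lemma eta_cvg (y : 'cV[R]_D) i : eta w i @[w --> y] --> eta y i.
Proof.
apply: (@cvgD _ _ _ (nbhs y)).
  apply: (@submxcol_cvg R N (fun=> m) _ (nbhs y)).
  apply: (@cvg_comp _ _ _ (fun w : 'cV[R]_D => dsubmx w) _ (nbhs y) (nbhs (dsubmx y))).
    exact: dsubmx_continuous.
  exact: dsubmx_continuous.
apply: (@cvg_comp _ _ _ (fun w : 'cV[R]_D => xblock w i) (phi i) (nbhs y) (nbhs (xblock y i))).
  exact: xblock_cvg.
exact: (differentiable_continuous (@phi_diff i (xblock y i))).
Qed.

Lemma Gmap_cvg (y : 'cV[R]_D) i :
  Gmap theta phi i (xblock w i) (eta w i) @[w --> y] -->
  Gmap theta phi i (xblock y i) (eta y i).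
Proof.
pose g (w : 'cV[R]_(n_ i + m)) := Gmap theta phi i (usubmx w) (dsubmx w).
have gE u v : Gmap theta phi i u v = g (col_mx u v) by rewrite /g col_mxKu col_mxKd.
have -> : (fun w => Gmap theta phi i (xblock w i) (eta w i)) =
    (fun w => g (col_mx (xblock w i) (eta w i))) by apply/funext => w; rewrite gE.
rewrite gE; apply: (@cvg_comp _ _ _ (fun w => col_mx (xblock w i) (eta w i)) g
  (nbhs y) (nbhs (col_mx (xblock y i) (eta y i)))); last exact: G_continuous.
by apply: (@col_mx_cvg R _ (nbhs y)); [exact: xblock_cvg|exact: eta_cvg].
Qed.

Lemma tblock_cvg (y : 'cV[R]_D) i : tblock w i @[w --> y] --> tblock y i.
Proof.
pose a (w : 'cV[R]_D) := xblock w i - Gmap theta phi i (xblock w i) (eta w i)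
    - c *: ((A_ i)^T *m submxcol (usubmx (dsubmx w)) i).
apply: (@cvg_comp _ _ _ a (proj (Omega_ i)) (nbhs y) (nbhs (a y))); last first.
  exact: proj_continuous.
apply: (@cvgB _ _ _ (nbhs y)).
  by apply: (@cvgB _ _ _ (nbhs y)); [exact: xblock_cvg|exact: Gmap_cvg].
apply: (@cvgZ _ _ _ (nbhs y)); first exact: cvg_cst.
apply: (@mulmx_cvg R _ (nbhs y)); apply: (@submxcol_cvg R N (fun=> l) _ (nbhs y)).
apply: (@cvg_comp _ _ _ (fun w : 'cV[R]_D => dsubmx w) _ (nbhs y) (nbhs (dsubmx y))).
  exact: dsubmx_continuous.
exact: usubmx_continuous.
Qed.

Lemma target_cvg (y : 'cV[R]_D) : target w @[w --> y] --> target y.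
Proof.
apply: (@cV_cvg R _ (nbhs y)) => r.
have tE w : target w r 0 = tblock w (tagnat.sig1 r) (tagnat.sig2 r) 0 by rewrite mxE.
have -> : (fun w => target w r 0) =
    (fun w => tblock w (tagnat.sig1 r) (tagnat.sig2 r) 0) by apply/funext.
by rewrite tE; apply: (@coord_cvg R _ (nbhs y)); exact: tblock_cvg.
Qed.

Lemma flow_ae : {ae mu, forall t : R, 0 <= t -> exists v : 'cV[R]_D,
  [/\ is_derive t 1 z v, filippov (field t) (z t) v &
      is_derive t 1 x (target (z t) - x t)]}.
Proof.
apply: (@filterS _ _ (ae_filter_ringOfSetsType mu)) solution.2.
move=> t H t0; have [zd fz] := H t0; exists ('D_1 z t).
have zd' : is_derive t 1 z ('D_1 z t) by split.
split => //; apply: is_derive_col => k.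
have := is_derive_coord (lshift _ k) zd'.
have -> : (fun s => z s (lshift _ k) 0) = (fun s => x s k 0).
  by apply/funext => s; rewrite /z state_x.
suff -> : 'D_1 z t (lshift _ k) 0 = (target (z t) - x t) k 0 by [].
have fk y : field t y (lshift _ k) 0 = (target y - usubmx y) k 0.
  by rewrite -(field_x t y) [RHS]mxE.
have fc : {for z t, continuous (fun y => field t y (lshift _ k) 0)}.
  have -> : (fun y => field t y (lshift _ k) 0) = (fun y => (target y - usubmx y) k 0).
    by apply/funext.
  apply: (@coord_cvg R _ (nbhs (z t))); apply: (@cvgB _ _ _ (nbhs (z t))).
    exact: target_cvg.
  exact: usubmx_continuous.
by rewrite (filippov_coord fz fc) fk /z /state col_mxKu.
Qed.

Lemma ac_state T r : 0 < T -> ac 0 T (fun t => z t r 0).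
Proof.
move=> T0; apply: (@ac_lipschitz R D 0 T 1 z); first exact: solution.1.
move=> s t _ st _; rewrite mul1r; apply: le_trans (coordB_le_enorm _ _ _) _.
by rewrite lerDl subr_ge0.
Qed.

Lemma ac_x T k : 0 < T -> ac 0 T (fun t => x t k 0).
Proof.
move=> T0; have := ac_state (lshift _ k) T0.
by under eq_fun do rewrite state_x.
Qed.

(** The velocity points to a point of the convex set, so the half squared distance of [x] to that
    set does not increase from its initial value 0. *)
Lemma x_in_Omega t : 0 <= t -> OmegaN (x t).
Proof.
rewrite le_eqVlt => /predU1P[<-//|t0].
pose V s := half_sqdist OmegaN (x s).
have Vac : ac 0 t V.
  have Pac k : ac 0 t (fun s => proj OmegaN (x s) k 0).
    apply: (@ac_lipschitz R D 0 t 1 z); first exact: solution.1.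
    move=> s u _ su _; rewrite mul1r; apply: le_trans (coordB_le_enorm _ _ _) _.
    apply: le_trans (proj_nonexpansive Ocl convex_Omega O0 _ _) _.
    have -> : x u - x s = usubmx (z u - z s) by rewrite linearB/= /z /state !col_mxKu.
    by apply: le_trans (enorm_usubmx_le _) _; rewrite lerDl subr_ge0.
  have dac k : ac 0 t (fun s => x s k 0 - proj OmegaN (x s) k 0).
    apply: acD; first exact: ac_x.
    have := acM (ac_cst 0 t (-1)) (Pac k).
    by under eq_fun do rewrite mulN1r.
  have := acM (ac_cst 0 t 2^-1) (ac_sum (index_enum 'I_n) (fun k => acM (dac k) (dac k))).
  congr ac; apply/funext => s; rewrite /V /half_sqdist dotvE.
  by congr (_ * _); apply: eq_bigr => k _; rewrite !mxE.
apply: (half_sqdist_eq0 Ocl O0); apply/eqP; rewrite eq_le half_sqdist_ge0 andbT.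
rewrite -[leRHS](half_sqdist_in Ocl convex_Omega O0 Ox0).
apply: (ac_nonincreasing (ltW t0) Vac).
apply: (@filterS _ _ (ae_filter_ringOfSetsType mu)) flow_ae.
move=> s H /andP[s0 _]; have [v [_ _ xd]] := H s0.
exists (dotv (x s - proj OmegaN (x s)) (target (z s) - x s)).
  exact: (is_derive_half_sqdist Ocl convex_Omega O0 xd).
have := proj_vi Ocl convex_Omega O0 (x s) (target_in (z s)).
have := dotv_ge0 (x s - proj OmegaN (x s)).
set p := proj OmegaN (x s); set u := x s - p.
have -> : target (z s) - x s = (target (z s) - p) - u by rewrite /u opprB addrA subrK.
rewrite [X in _ -> _ -> X <= _]dotvDr dotvNr.
move: (dotv u _) (dotv u _) => a b; lra.
Qed.

Lemma xblockE t i : xblock (z t) i = submxcol (x t) i.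
Proof. by rewrite /xblock /z /state col_mxKu. Qed.

Lemma etaE t i k : eta (z t) i k 0 = z t (zeta_index k i) 0 + phi i (submxcol (x t) i) k 0.
Proof. by rewrite /eta mxE zeta_indexE xblockE. Qed.

Lemma lam_consensus k : exists2 T0 : R, 0 < T0 & forall t, T0 <= t -> forall i,
  z t (lam_index k i) 0 = mean (fun j => z t (lam_index k j) 0).
Proof.
apply: (@finite_time_consensus R N (fun i t => z t (lam_index k i) 0)
  (beta - gamma * (N%:R - 1) * f2bar Omega_ A_ b_)) => //.
- by rewrite subr_gt0.
- by move=> i T; exact: ac_state.
apply: (@filterS _ _ (ae_filter_ringOfSetsType mu)) flow_ae.
move=> t H t0; have [v [zd fv _]] := H t0.
exists (fun i => v (lam_index k i) 0) => [i|p q pq]; first exact: is_derive_coord.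
pose h (i : 'I_N) (y : 'cV[R]_D) := gamma * (A_ i *m xblock y i - b_ i) k 0.
have hc i : {for z t, continuous (h i)}.
  apply: (@cvgM _ _ (nbhs (z t))); first exact: cvg_cst.
  apply: (@coord_cvg R _ (nbhs (z t))); apply: (@cvgB _ _ _ (nbhs (z t))).
    by apply: (@mulmx_cvg R _ (nbhs (z t))); exact: xblock_cvg.
  exact: cvg_cst.
have sc i : {for z t, continuous (fun y : 'cV[R]_D => y (lam_index k i) 0)}.
  exact: coord_continuous.
have h1 := filippov_consensus_le (s := fun y i => y (lam_index k i) 0) (graph t0)
  (ltW beta_gt0) (fun y i => field_lam t y k i) sc hc fv
  (mean (fun j => z t (lam_index k j) 0)) p q.
have hb i : `|h i (z t)| <= gamma * f2bar Omega_ A_ b_.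
  rewrite /h normrM gtr0_norm// ler_pM2l//; apply: le_trans (coord_le_enorm _ _) _.
  by apply: f2bar_bound; rewrite xblockE; exact: x_in_Omega.
have h2 := sum_deviation_mul_le N_gt0 pq hb.
apply: le_trans h1 _; apply: le_trans (lerD (lexx _) h2) _.
by rewrite le_eqVlt; apply/orP; left; apply/eqP; ring.
Qed.

(** Conservation law behind the tracking: the mean of the [eta] is the true aggregate at all times,
    so consensus among them means agreement on [sigma]. *)
Lemma zeta_sum t : 0 <= t -> \sum_i zeta i t = 0.
Proof.
move=> t0; apply/colP => k; rewrite summxE mxE.
transitivity (\sum_i z t (zeta_index k i) 0).
  by apply: eq_bigr => i _; rewrite /z state_zeta.
transitivity (\sum_i z 0 (zeta_index k i) 0); last first.
  by apply: big1 => i _; rewrite /z state_zeta zeta_init mxE.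
move: t0; rewrite le_eqVlt => /predU1P[<-//|t0].
apply: (@ac_constant R t (fun s => \sum_i z s (zeta_index k i) 0)) => //.
- exact: ltW.
- by apply: ac_sum => i; exact: ac_state.
apply: (@filterS _ _ (ae_filter_ringOfSetsType mu)) flow_ae.
move=> s H /andP[s0 _]; have [v [zd fv _]] := H s0.
have hc (i : 'I_N) : {for z s, continuous (fun _ : 'cV[R]_D => 0 : R)}.
  exact: cst_continuous.
have := filippov_consensus_sum (s := fun y i => eta y i k 0) (graph s0)
  (fun y i => field_zeta s y k i) hc fv.
rewrite [X in _ = X -> _]big1// => vs; rewrite -[X in is_derive _ _ _ X]vs.
apply: is_derive_sum_fun => i; exact: is_derive_coord.
Qed.

(** The bound on the Jacobian over the convex strategy set makes [phi] Lipschitz there, and [x]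
    never leaves that set. *)
Lemma ac_eta T i k : 0 < T -> ac 0 T (fun t => eta (z t) i k 0).
Proof.
move=> T0; have [L HL] := @f1bar_finite i.
have opL u : Omega_ i u -> opnorm (jac (phi i) u) <= L by move=> Ou; apply: HL; exists u.
have L0 : 0 <= L := le_trans (opnorm_ge0 _) (opL _ (@x_init i)).
have -> : (fun t => eta (z t) i k 0) =
    (fun t => z t (zeta_index k i) 0 + phi i (submxcol (x t) i) k 0).
  by apply/funext => t; rewrite etaE.
apply: acD; first exact: ac_state.
apply: (@ac_lipschitz R D 0 T L z); first exact: solution.1.
move=> s t s0 st _; apply: le_trans (coordB_le_enorm _ _ _) _.
have t0 := le_trans s0 st.
apply: le_trans (convex_lipschitz (@Omega_convex i) (@phi_diff i) opL (x_in_Omega t0 i) (x_in_Omega s0 i)) _.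
apply: ler_wpM2l => //; rewrite -submxcolB; apply: le_trans (enorm_submxcol_le _ _) _.
have -> : x t - x s = usubmx (z t - z s) by rewrite linearB/= /z /state !col_mxKu.
by apply: le_trans (enorm_usubmx_le _) _; rewrite lerDl subr_ge0.
Qed.

(** The input is the Jacobian of [phi] applied to [target - x]. Both points lie in the strategy set,
    which is why the constant multiplies a Jacobian bound by a diameter. *)
Lemma eta_consensus k : exists2 T0 : R, 0 < T0 & forall t, T0 <= t -> forall i,
  eta (z t) i k 0 = mean (fun j => eta (z t) j k 0).
Proof.
apply: (@finite_time_consensus R N (fun i t => eta (z t) i k 0)
  (alpha - (N%:R - 1) * f1bar Omega_ phi)) => //.
- by rewrite subr_gt0.
- by move=> i T; exact: ac_eta.
apply: (@filterS _ _ (ae_filter_ringOfSetsType mu)) flow_ae.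
move=> t H t0; have [v [zd fv xd]] := H t0.
pose dphi i : 'cV[R]_m :=
  jac (phi i) (submxcol (x t) i) *m submxcol (target (z t) - x t) i.
exists (fun i => v (zeta_index k i) 0 + dphi i k 0) => [i|p q pq].
  have -> : (fun t => eta (z t) i k 0) =
      (fun t => z t (zeta_index k i) 0 + phi i (submxcol (x t) i) k 0).
    by apply/funext => s; rewrite etaE.
  apply: is_deriveD; first exact: is_derive_coord.
  apply: (@is_derive_coord R m (fun s => phi i (submxcol (x s) i))).
  rewrite /dphi -diff_jac; last exact: phi_diff.
  by apply: is_derive_comp_diff; [exact: phi_diff|exact: is_derive_submxcol].
have sc i : {for z t, continuous (fun y : 'cV[R]_D => eta y i k 0)}.
  by apply: (@coord_cvg R _ (nbhs (z t))); exact: eta_cvg.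
have hc (i : 'I_N) : {for z t, continuous (fun _ : 'cV[R]_D => 0 : R)}.
  exact: cst_continuous.
have h1 := filippov_consensus_le (s := fun y i => eta y i k 0) (graph t0)
  (ltW alpha_gt0) (fun y i => field_zeta t y k i) sc hc fv
  (mean (fun j => eta (z t) j k 0)) p q.
have hb i : `|dphi i k 0| <= f1bar Omega_ phi.
  apply: le_trans (coord_le_enorm _ _) _; apply: le_trans (enorm_mulmx_le _ _) _.
  apply: le_trans (ler_wpM2l (opnorm_ge0 _) (enorm_submxcol_le _ _)) _.
  by apply: f1bar_bound; [exact: x_in_Omega|exact: target_in|exact: x_in_Omega].
have h2 := sum_deviation_mul_le N_gt0 pq hb.
rewrite (eq_bigr (fun i => (eta (z t) i k 0 - mean (fun j => eta (z t) j k 0)) * v (zeta_index k i) 0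
  + (eta (z t) i k 0 - mean (fun j => eta (z t) j k 0)) * dphi i k 0)); last by move=> i _; rewrite mulrDr.
rewrite big_split/=.
apply: le_trans (lerD h1 h2) _; rewrite big1; last by move=> i _; rewrite mulr0.
by rewrite le_eqVlt; apply/orP; left; apply/eqP; ring.
Qed.

Let lbar (t : R) : 'cV[R]_l := N%:R^-1 *: \sum_i lam i t.

Lemma lbarE t k : lbar t k 0 = mean (fun i => z t (lam_index k i) 0).
Proof.
rewrite mxE summxE; congr (_ * _); apply: eq_bigr => i _.
by rewrite /z state_lam.
Qed.

Lemma consensus : exists2 T0 : R, 0 < T0 & forall t i, T0 <= t ->
  lam i t = lbar t /\ eta (z t) i = sigma phi (x t).
Proof.
have [T1 T10 lamT] := eventually_ord lam_consensus.
have [T2 T20 etaT] := eventually_ord eta_consensus.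
exists (Num.max T1 T2) => [|t i]; first by rewrite lt_max T10.
rewrite ge_max => /andP[T1t T2t]; split; apply/colP => k.
  by rewrite lbarE -(lamT k t T1t i) /z state_lam.
rewrite (etaT k t T2t i) mxE summxE; congr (_ * _).
have zs := congr1 (fun u : 'cV[R]_m => u k 0) (zeta_sum (le_trans (ltW T20) T2t)).
move: zs; rewrite summxE mxE => zs.
transitivity (\sum_j zeta j t k 0 + \sum_j phi j (submxcol (x t) j) k 0).
  by rewrite -big_split; apply: eq_bigr => j _; rewrite etaE /z state_zeta.
by rewrite zs add0r.
Qed.

Lemma Amx_mul (y : 'cV[R]_n) : Amx A_ *m y = \sum_i A_ i *m submxcol y i.
Proof. by rewrite -{1}[y]submxcolK mul_mxrow_mxcol. Qed.

Lemma Amx_residual (y : 'cV[R]_n) :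
  Amx A_ *m y - bvec b_ = \sum_i (A_ i *m submxcol y i - b_ i).
Proof. by rewrite Amx_mul sumrB. Qed.

Lemma lam_sum_derive k : {ae mu, forall t : R, 0 <= t ->
  is_derive t 1 (fun s => \sum_i z s (lam_index k i) 0)
    (gamma * (Amx A_ *m x t - bvec b_) k 0)}.
Proof.
apply: (@filterS _ _ (ae_filter_ringOfSetsType mu)) flow_ae.
move=> t H t0; have [v [zd fv _]] := H t0.
pose h (i : 'I_N) (y : 'cV[R]_D) := gamma * (A_ i *m xblock y i - b_ i) k 0.
have hc i : {for z t, continuous (h i)}.
  apply: (@cvgM _ _ (nbhs (z t))); first exact: cvg_cst.
  apply: (@coord_cvg R _ (nbhs (z t))); apply: (@cvgB _ _ _ (nbhs (z t))).
    by apply: (@mulmx_cvg R _ (nbhs (z t))); exact: xblock_cvg.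
  exact: cvg_cst.
have hs := filippov_consensus_sum (s := fun y i => y (lam_index k i) 0) (graph t0)
  (fun y i => field_lam t y k i) hc fv.
have -> : gamma * (Amx A_ *m x t - bvec b_) k 0 = \sum_i v (lam_index k i) 0.
  rewrite hs Amx_residual summxE mulr_sumr; apply: eq_bigr => i _.
  by rewrite /h xblockE.
by apply: is_derive_sum_fun => i; exact: is_derive_coord.
Qed.

Lemma lambda_barE t : 0 <= t -> lambda_bar A_ b_ gamma x t = lbar t.
Proof.
move=> t0; apply/colP => k; rewrite lbarE /lambda_bar /mean.
rewrite [LHS]mxE [X in X + _]mxE [X in _ + X]mxE [X in _ + _ * X]mxE.
have init : \sum_i z 0 (lam_index k i) 0 = (Amx A_ *m x 0 - bvec b_) k 0.
  rewrite Amx_residual summxE; apply: eq_bigr => i _.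
  by rewrite /z state_lam lam_init.
move: t0; rewrite le_eqVlt => /predU1P[<-|t0].
  by rewrite set_itv1 Rintegral_set1 mulr0 addr0 init.
(* The sum of the multipliers, divided by [gamma], is a primitive of the residual because the signs
   cancel; its initial value matches the constant term by the choice of [lam i 0]. *)
rewrite (@ac_integral R t (fun s => gamma^-1 * \sum_i z s (lam_index k i) 0))//.
- rewrite init; field; rewrite pnatr_eq0 -lt0n N_gt0 gt_eqF//.
- apply: acM; first exact: ac_cst.
  by apply: ac_sum => i; exact: ac_state.
- have -> : (fun s => (Amx A_ *m x s - bvec b_) k 0) =
      (fun s => \sum_j Amx A_ k j * x s j 0 + - bvec b_ k 0).
    by apply/funext => s; rewrite mxE [X in X + _]mxE [X in _ + X]mxE.
  apply: acD; last exact: ac_cst.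
  by apply: ac_sum => j; apply: acM; [exact: ac_cst|exact: ac_x].
apply: (@filterS _ _ (ae_filter_ringOfSetsType mu)) (lam_sum_derive k).
move=> s H /andP[s0 _]; have := is_deriveZ gamma^-1 (H s0).
by rewrite -[_ *: _]/(gamma^-1 * _) mulKf// gt_eqF.
Qed.

Lemma state_cvg (t : R) : 0 < t -> z s @[s --> t] --> z t.
Proof.
move=> t0; apply: (@cV_cvg R _ (nbhs t)) => r.
apply: (ac_continuous (ac_state r (addr_gt0 t0 ltr01))).
by rewrite t0 ltrDl ltr01.
Qed.

Lemma profile_cvg (t : R) : 0 < t -> x s @[s --> t] --> x t.
Proof.
move=> t0; have -> : x = (fun s => usubmx (z s)).
  by apply/funext => s; rewrite /z /state col_mxKu.
exact: (cvg_comp _ _ (state_cvg t0) (@usubmx_continuous _ _ _ _)).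
Qed.

(** The right-hand side is continuous along the trajectory, so the equation holds at every time.
    Time 0 is excluded because the derivative is two-sided and earlier values are arbitrary. *)
Lemma profile_derive (t : R) : 0 < t -> is_derive t 1 x (target (z t) - x t).
Proof.
move=> t0; apply: is_derive_col => k; have t1 := addr_gt0 t0 ltr01.
apply: (@ac_is_derive R 0 (t + 1) t _ (fun s => (target (z s) - x s) k 0)).
- by rewrite t0 ltrDl ltr01.
- exact: ac_x.
- apply: (@filterS _ _ (ae_filter_ringOfSetsType mu)) flow_ae.
  by move=> s H /andP[s0 _]; have [v [_ _ xd]] := H s0; exact: is_derive_coord.
apply: (@coord_cvg R _ (nbhs t)); apply: (@cvgB _ _ _ (nbhs t)); last exact: profile_cvg.
apply: (@cvg_comp _ _ _ z target (nbhs t) (nbhs (z t))); first exact: state_cvg.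
exact: target_cvg.
Qed.

Lemma lbar_derive (t : R) : 0 < t -> is_derive t 1 lbar (c *: (Amx A_ *m x t - bvec b_)).
Proof.
move=> t0; apply: is_derive_col => k; have t1 := addr_gt0 t0 ltr01.
have -> : (fun s => lbar s k 0) = (fun s => N%:R^-1 * \sum_i z s (lam_index k i) 0).
  by apply/funext => s; rewrite lbarE.
apply: (@ac_is_derive R 0 (t + 1) t _ (fun s => (c *: (Amx A_ *m x s - bvec b_)) k 0)).
- by rewrite t0 ltrDl ltr01.
- apply: acM; first exact: ac_cst.
  by apply: ac_sum => i; exact: ac_state.
- apply: (@filterS _ _ (ae_filter_ringOfSetsType mu)) (lam_sum_derive k).
  move=> s H /andP[s0 _]; have := is_deriveZ N%:R^-1 (H s0).
  by rewrite -[_ *: (gamma * _)]/(N%:R^-1 * _) mulrA [_ * gamma]mulrC [X in _ -> is_derive _ _ _ X]mxE.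
apply: (@coord_cvg R _ (nbhs t)); apply: (@cvgZ _ _ _ (nbhs t)); first exact: cvg_cst.
apply: (@cvgB _ _ _ (nbhs t)); last exact: cvg_cst.
by apply: (@mulmx_cvg R _ (nbhs t)); exact: profile_cvg.
Qed.

(** Once the estimates agree, each [Gmap] is a block of the pseudo-gradient, and the separate
    projections assemble into the projection on the product. *)
Lemma target_consensus t : (forall i, lam i t = lbar t) ->
  (forall i, eta (z t) i = sigma phi (x t)) ->
  target (z t) =
    proj OmegaN (x t - pseudo_grad theta phi (x t) - c *: ((Amx A_)^T *m lbar t)).
Proof.
move=> lamt etat; rewrite (proj_blocks Omega_closed Omega_convex Omega_nonempty _ Ocl convex_Omega O0).
apply: eq_mxcol => i.
rewrite !submxcolB submxcolZ (pseudo_grad_block theta_diff phi_diff smooth).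
rewrite /tblock xblockE etat.
congr (proj _ (_ - _ - _ *: _)).
rewrite /Amx tr_mxrow mxcol_mul.
rewrite mxcolK; congr (_ *m _); rewrite -(lamt i); apply/colP => k.
by rewrite lam_indexE /z state_lam.
Qed.

Lemma aggregative_convergence :
  (forall i, enorm (lam i t - lambda_bar A_ b_ gamma x t) @[t --> +oo] --> 0)
  /\
  (let w t := col_mx (x t) (lambda_bar A_ b_ gamma x t) in
   enorm (w t - proj (equilibria Omega_ theta phi A_ b_ gamma) (w t))
     @[t --> +oo] --> 0).
Proof.
have [T0 T00 HT] := consensus.
have near_lbar : \forall t \near +oo, T0 <= t /\ lambda_bar A_ b_ gamma x t = lbar t.
  exists T0; split; first exact: num_real.
  by move=> t /ltW T0t; rewrite lambda_barE// (le_trans _ T0t)// ltW.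
split=> [i|w].
  (* The consensus error is exactly 0 after the finite time [T0]. *)
  apply: cvg_near_cst; apply: filterS near_lbar => t [T0t ->].
  by rewrite (HT t i T0t).1 subrr enorm0.
have := @primal_dual_convergence R n l OmegaN (pseudo_grad theta phi) (Amx A_)
  (bvec b_) c compact_Omega convex_Omega (pseudo_grad_differentiable smooth)
  monotone c_gt0 qualification x lbar T0.
have h1 t : T0 <= t -> OmegaN (x t).
  by move=> T0t; apply: x_in_Omega; rewrite (le_trans _ T0t)// ltW.
have h2 (t : R) : T0 <= t -> is_derive t 1 x
    (proj OmegaN (x t - pseudo_grad theta phi (x t) - c *: ((Amx A_)^T *m lbar t)) - x t).
  move=> T0t; rewrite -target_consensus; first exact: profile_derive (lt_le_trans T00 T0t).
    by move=> i; exact: (HT t i T0t).1.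
  by move=> i; exact: (HT t i T0t).2.
have h3 (t : R) : T0 <= t -> is_derive t 1 lbar (c *: (Amx A_ *m x t - bvec b_)).
  by move=> T0t; exact: lbar_derive (lt_le_trans T00 T0t).
move=> /(_ h1 h2 h3); apply: cvg_trans; apply: near_eq_cvg.
by apply: filterS near_lbar => t [_ e]; rewrite /w e.
Qed.

End Dynamics.

Theorem theorem3
  (R : realType) (N : nat) (N_gt0 : (0 < N)%N)
  (n_ : 'I_N -> nat) (m l : nat)
  (Omega_ : forall i : 'I_N, set 'cV[R]_(n_ i))
  (theta : forall i : 'I_N, 'cV[R]_(n_ i + m) -> R^o)
  (phi : forall i : 'I_N, 'cV[R]_(n_ i) -> 'cV[R]_m)
  (A_ : forall i : 'I_N, 'M[R]_(l, n_ i))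
  (b_ : 'I_N -> 'cV[R]_l)
  (Omega_closed : forall i, closed (Omega_ i))
  (Omega_convex : forall i, @convex_set R 'cV[R]_(n_ i) (Omega_ i))
  (Omega_nonempty : forall i, Omega_ i !=set0)
  (theta_diff : forall i u, differentiable (theta i) u)
  (phi_diff : forall i u, differentiable (phi i) u)
  (G_continuous : forall i, continuous
     (fun w : 'cV[R]_(n_ i + m) =>
        Gmap theta phi i (usubmx w) (dsubmx w)))
  (f1bar_finite : forall i,
     has_ubound [set opnorm (jac (phi i) u) | u in Omega_ i])
  (smooth : forall i, C2 (cost theta phi i))
  (monotone : strictly_monotone_on (Omega Omega_) (pseudo_grad theta phi))
  (compact_Omega : compact (Omega Omega_))
  (convex_Omega : @convex_set R 'cV[R]_(\sum_i n_ i) (Omega Omega_))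
  (qualification :
     rint [set z1 - z2 | z1 in Omega Omega_ & z2 in coupled_set A_ b_] 0)
  (G : R -> rel 'I_N)
  (graph : forall t : R, 0 <= t -> undirected_connected (G t))
  (alpha beta gamma : R)
  (alpha_gt0 : 0 < alpha) (beta_gt0 : 0 < beta) (gamma_gt0 : 0 < gamma)
  (alpha_large : (N%:R - 1) * f1bar Omega_ phi < alpha)
  (beta_large : gamma * (N%:R - 1) * f2bar Omega_ A_ b_ < beta)
  (x : R -> 'cV[R]_(\sum_i n_ i))
  (lam : 'I_N -> R -> 'cV[R]_l) (zeta : 'I_N -> R -> 'cV[R]_m)
  (solution : filippov_solution
     (algo_field Omega_ theta phi A_ b_ alpha beta gamma G)
     (fun t => state (x t) (fun i => lam i t) (fun i => zeta i t)))
  (x_init : forall i, Omega_ i (submxcol (x 0) i))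
  (lam_init : forall i, lam i 0 = A_ i *m submxcol (x 0) i - b_ i)
  (zeta_init : forall i, zeta i 0 = 0) :
  (forall i, enorm (lam i t - lambda_bar A_ b_ gamma x t) @[t --> +oo] --> 0)
  /\
  (let w t := col_mx (x t) (lambda_bar A_ b_ gamma x t) in
   enorm (w t - proj (equilibria Omega_ theta phi A_ b_ gamma) (w t))
     @[t --> +oo] --> 0).
Proof.
exact: (aggregative_convergence N_gt0 Omega_closed Omega_convex Omega_nonempty
  theta_diff phi_diff G_continuous f1bar_finite smooth monotone compact_Omega
  convex_Omega qualification graph alpha_gt0 beta_gt0 gamma_gt0 alpha_large
  beta_large solution x_init lam_init zeta_init).
Qed.
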